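(* Let $\Xi\subseteq\Pi$. For any choice of reduced sequences $\{I_w\}_{w\in W^\Xi}$, each of the two families $\{A_\Xi(A_{I_u^{\mathrm{rev}}}(\tilde f_e))\}_{u\in W^\Xi}$ and $\{A_\Xi(B_{I_u^{\mathrm{rev}}}(\tilde f_e))\}_{u\in W^\Xi}$ is an $S$-module basis of $(\mathbf D_F^\star)^{W_\Xi}$.
   Context: Setting. $R$ is a commutative ring with unit and $F\in R[[x,y]]$ is a one-dimensional commutative formal group law. $(\Lambda,\Sigma)$ is a reduced semisimple root datum: $\Lambda$ is a free abelian group of finite rank, $\Sigma\subset\Lambda$ is the finite set of roots with coroots $\alpha^\vee\in\Lambda^\vee$, and $\Sigma$ spans $\Lambda\otimes\mathbb Q$. $\Pi=\{\alpha_1,\dots,\alpha_n\}$ is a set of simple roots, $\Sigma^{\pm}$ are the positive/negative roots, $W$ is the Weyl group generated by $s_\alpha(\lambda)=\lambda-\alpha^\vee(\lambda)\alpha$, $s_i=s_{\alpha_i}$, $\ell$ is the length function, $e$ the neutral element. The formal group algebra $S=R[[\Lambda]]_F$ is the quotient of $R[[x_\lambda,\lambda\in\Lambda]]$ (completion of the polynomial ring at the augmentation ideal) by the closure of the ideal generated by $x_0$ and all $x_{\lambda+\mu}-F(x_\lambda,x_\mu)$; $W$ acts by $w(x_\lambda)=x_{w(\lambda)}$. Standing assumption: $x_\alpha$ is not a zero divisor in $S$ for all $\alpha\in\Sigma$. $Q=S[x_\alpha^{-1}\mid\alpha\in\Sigma]$. $Q_W$ is the free left $Q$-module with basis $(\delta_w)_{w\in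 W}$ and product $(q\delta_w)(q'\delta_{w'})=q\,w(q')\,\delta_{ww'}$. Put $X_i=\frac1{x_{\alpha_i}}(1-\delta_{s_i})$, $Y_i=\frac1{x_{-\alpha_i}}+\frac1{x_{\alpha_i}}\delta_{s_i}$. For a sequence $I=(i_1,\dots,i_m)$ in $\{1,\dots,n\}$ put $I^{\mathrm{rev}}=(i_m,\dots,i_1)$; it is a reduced sequence for $w\in W$ if $w=s_{i_1}\cdots s_{i_m}$ and $m=\ell(w)$; $I_w$ denotes a chosen reduced sequence for $w$. $\mathbf D_F\subseteq Q_W$ is the $R$-subalgebra generated by $S$ and $X_1,\dots,X_n$. $Q_W^*=\mathrm{Hom}_Q(Q_W,Q)$ (left $Q$-linear maps), with basis $(f_w)$ dual to $(\delta_w)$. $Q_W$ acts on the left on $Q_W^*$ by $(z\bullet f)(z')=f(z'z)$; $W$ acts by $w(f)=\delta_w\bullet f$, and invariants are with respect to this action. $\mathbf D_F^\star=\mathrm{Hom}_S(\mathbf D_F,S)$ is identified with $\{f\in Q_W^*\mid f(\mathbf D_F)\subseteq S\}$. $A_i(f)=Y_i\bullet f$, $B_i(f)=X_i\bullet f$, $A_I=A_{i_1}\circ\cdots\circ A_{i_m}$, $B_I=B_{i_1}\circ\cdots\circ B_{i_m}$, $A_\emptyset=B_\emptyset=\mathrm{id}$. For $\Xi\subseteq\Pi$: $W_\Xi$ is the subgroup generated by $s_\alpha$, $\alpha\in\Xi$; $\Sigma_\Xi^-=\{\alpha\in\Sigma^-\mid s_\alpha\in W_\Xi\}$; $x_\Xi=\prod_{\alpha\in\Sigma_\Xi^-}x_\alpha$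 (so $x_\Pi=\prod_{\alpha\in\Sigma^-}x_\alpha$); $Y_\Xi=\big(\sum_{w\in W_\Xi}\delta_w\big)\frac1{x_\Xi}$; $A_\Xi(f)=Y_\Xi\bullet f$. $W^\Xi=\{w\in W\mid\ell(ws_\alpha)>\ell(w)\ \forall\alpha\in\Xi\}$. $\tilde f_e=x_\Pi\bullet f_e=x_\Pi f_e\in\mathbf D_F^\star$. *)

(* Defs.v *)
From HB Require Import structures.
From mathcomp Require Import all_boot all_order all_fingroup all_algebra.
From mathcomp Require Import finmap boolp monalg ring.

Set Implicit Arguments.
Unset Strict Implicit.
Unset Printing Implicit Defensive.

Import GRing.Theory.
Local Open Scope ring_scope.

Section Homogeneous.
Variables (R : comNzRingType) (I : choiceType).
Notation P := {malg R[{cmonom I}]}.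

Definition homog (d : nat) (p : P) : Prop :=
  forall m, m \in msupp p -> mdeg m = d.

Lemma homog0 d : homog d 0.
Proof. by move=> m; rewrite msupp0 inE. Qed.

Lemma homogD d p q : homog d p -> homog d q -> homog d (p + q).
Proof.
move=> hp hq m /(fsubsetP (msuppD_le p q)).
by rewrite inE => /orP[/hp|/hq].
Qed.

Lemma homogN d p : homog d p -> homog d (- p).
Proof. by move=> hp m; rewrite msuppN => /hp. Qed.

Lemma homogZ d c p : homog d p -> homog d (c *: p).
Proof. by move=> hp m /(fsubsetP (msuppZ_le c p)) /hp. Qed.

Lemma homog_sum d (J : Type) (r : seq J) (C : pred J) (G : J -> P) :
  (forall j, C j -> homog d (G j)) -> homog d (\sum_(j <- r | C j) G j).
Proof.
move=> h; elim/big_rec: _ => [|j p Cj hp]; first exact: homog0.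
by apply: homogD => //; exact: h.
Qed.

Lemma homogM d e p q : homog d p -> homog e q -> homog (d + e) (p * q).
Proof.
move=> hp hq m /(fsubsetP (@msuppM_incl _ _ p q)) /imfset2P[m1 /= h1 [m2 /= h2 ->]].
by rewrite mdegM (hp _ h1) (hq _ h2).
Qed.

Lemma homog1 : homog 0 (1 : P).
Proof.
move=> m; rewrite -mpolyC1E => /(fsubsetP (msuppC_le _)).
by rewrite inE => /eqP->; rewrite mdeg1.
Qed.

Lemma homogX i : homog 1 (mkmalgU (ucm i) 1 : P).
Proof.
move=> m /(fsubsetP msuppU_le).
by rewrite inE => /eqP->; rewrite mdegU.
Qed.

End Homogeneous.

(* The completion of the polynomial ring [R[x_i, i in I]] at its augmentation
   ideal: an element is a formal sum [f 0 + f 1 + f 2 + ...] where [f d] is a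
   homogeneous polynomial of degree [d].  [I] may be infinite. *)
Record mps (R : comNzRingType) (I : choiceType) := Mps {
  mcomp :> nat -> {malg R[{cmonom I}]};
  mcomp_homog : forall d, homog d (mcomp d) }.
Arguments mcomp_homog {R I} m d.

Section MpsRing.
Variables (R : comNzRingType) (I : choiceType).
Notation P := {malg R[{cmonom I}]}.
Notation T := (mps R I).

Lemma mps_ext (f g : T) : (forall d, f d = g d) -> f = g.
Proof.
case: f g => [f hf] [g hg] /= /funext e; case: g / e hg => hg.
by congr Mps; apply: Prop_irrelevance.
Qed.

HB.instance Definition _ := gen_eqMixin T.
HB.instance Definition _ := gen_choiceMixin T.

Definition mps0 : T := Mps (fun d => @homog0 R I d).
Definition mps_add (f g : T) : T :=
  Mps (fun d => homogD (mcomp_homog f d) (mcomp_homog g d)).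
Definition mps_opp (f : T) : T := Mps (fun d => homogN (mcomp_homog f d)).

Lemma mps_one_subproof d : homog d (if d == 0%N then 1 else 0 : P).
Proof. by case: d => [|d]; [exact: homog1 | exact: homog0]. Qed.
Definition mps_one : T := Mps mps_one_subproof.

Definition mps_conv (f g : nat -> P) d := \sum_(i < d.+1) f i * g (d - i)%N.

Lemma mps_mul_subproof (f g : T) d : homog d (mps_conv f g d).
Proof.
apply: homog_sum => i _.
have := homogM (mcomp_homog f i) (mcomp_homog g (d - i)%N).
by rewrite subnKC // -ltnS.
Qed.
Definition mps_mul (f g : T) : T := Mps (@mps_mul_subproof f g).

Definition mps_trunc n (f : nat -> P) : {poly P} := \poly_(i < n) f i.

Lemma mps_convE n (f g : nat -> P) d : (d < n)%N ->
  mps_conv f g d = (mps_trunc n f * mps_trunc n g)`_d.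
Proof.
move=> dn; rewrite coefM; apply: eq_bigr => i _; rewrite !coef_poly.
have id : (i <= d)%N by rewrite -ltnS.
by rewrite (leq_ltn_trans id dn) (leq_ltn_trans (leq_subr i d) dn).
Qed.

Lemma mps_addA : associative mps_add.
Proof. by move=> f g h; apply: mps_ext => d /=; rewrite addrA. Qed.
Lemma mps_addC : commutative mps_add.
Proof. by move=> f g; apply: mps_ext => d /=; rewrite addrC. Qed.
Lemma mps_add0 : left_id mps0 mps_add.
Proof. by move=> f; apply: mps_ext => d /=; rewrite add0r. Qed.
Lemma mps_addN : left_inverse mps0 mps_opp mps_add.
Proof. by move=> f; apply: mps_ext => d /=; rewrite addNr. Qed.

HB.instance Definition _ :=
  GRing.isZmodule.Build T mps_addA mps_addC mps_add0 mps_addN.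

Lemma mps_mulC : commutative mps_mul.
Proof.
by move=> f g; apply: mps_ext => d /=; rewrite !(@mps_convE d.+1) // mulrC.
Qed.

Lemma mps_mulA : associative mps_mul.
Proof.
move=> f g h; apply: mps_ext => d /=.
have -> : mps_conv f (mps_conv g h) d = (mps_trunc d.+1 f * (mps_trunc d.+1 g * mps_trunc d.+1 h))`_d.
  rewrite coefM; apply: eq_bigr => i _; rewrite coef_poly ltn_ord.
  by rewrite (@mps_convE d.+1) // ltnS leq_subr.
have -> : mps_conv (mps_conv f g) h d = (mps_trunc d.+1 f * mps_trunc d.+1 g * mps_trunc d.+1 h)`_d.
  rewrite coefM; apply: eq_bigr => i _.
  by rewrite coef_poly ltnS leq_subr (@mps_convE d.+1).
by rewrite mulrA.
Qed.

Lemma mps_mul1 : left_id mps_one mps_mul.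
Proof.
move=> f; apply: mps_ext => d /=; rewrite /mps_conv big_ord_recl /= mul1r subn0.
by rewrite big1 ?addr0 // => i _; rewrite mul0r.
Qed.

Lemma mps_mulDl : left_distributive mps_mul +%R.
Proof.
move=> f g h; apply: mps_ext => d /=; rewrite /mps_conv -big_split /=.
by apply: eq_bigr => i _; rewrite mulrDl.
Qed.

Lemma mps_one_neq0 : mps_one != 0.
Proof.
by apply/eqP => /(congr1 (fun f : T => f 0%N)) /= /eqP; rewrite oner_eq0.
Qed.

HB.instance Definition _ := GRing.Zmodule_isComNzRing.Build T
  mps_mulA mps_mulC mps_mul1 mps_mulDl mps_one_neq0.

Lemma mps_addE (f g : T) d : (f + g) d = f d + g d. Proof. by []. Qed.
Lemma mps_mulE (f g : T) d : (f * g) d = mps_conv f g d. Proof. by []. Qed.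

Lemma mpsX_subproof i d :
  homog d (if d == 1%N then mkmalgU (ucm i) 1 else 0 : P).
Proof. by case: eqP => [->|_]; [exact: homogX | exact: homog0]. Qed.
Definition mpsX (i : I) : T := Mps (@mpsX_subproof i).

(* The substitution [\sum_(i, j) F i j * g ^ i * h ^ j], for [g] and [h] without
   constant term: in degree [d] only the terms with [i, j <= d] contribute. *)
Lemma subst2_subproof (F : nat -> nat -> R) (g h : T) d :
  homog d (\sum_(i < d.+1) \sum_(j < d.+1) F i j *: (g ^+ i * h ^+ j : T) d).
Proof.
by do 2!apply: homog_sum => ? _; apply: homogZ; exact: mcomp_homog.
Qed.
Definition subst2 F g h : T := Mps (@subst2_subproof F g h).

End MpsRing.

(* [F i j] is the coefficient of [x ^ i * y ^ j]; the fields say in turn that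
   [F(x, 0) = x], [F(0, y) = y], [F(x, y) = F(y, x)] and
   [F(x, F(y, z)) = F(F(x, y), z)] in [R[[x, y, z]]]. *)
Record fgl (R : comNzRingType) := Fgl {
  fgl_coef :> nat -> nat -> R;
  fgl_x0 : forall i, fgl_coef i 0 = (i == 1%N)%:R;
  fgl_0x : forall j, fgl_coef 0 j = (j == 1%N)%:R;
  fgl_comm : forall i j, fgl_coef i j = fgl_coef j i;
  fgl_assoc :
    let x := mpsX R (0 : 'I_3) in
    let y := mpsX R (1 : 'I_3) in
    let z := mpsX R (2 : 'I_3) in
    subst2 fgl_coef x (subst2 fgl_coef y z) =
    subst2 fgl_coef (subst2 fgl_coef x y) z }.

Inductive ideal_gen (A : comNzRingType) (G : A -> Prop) : A -> Prop :=
| ideal_gen0 : ideal_gen G 0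
| ideal_genD a g f : G g -> ideal_gen G f -> ideal_gen G (a * g + f).

Section Ideal.
Variables (A : comNzRingType) (G : A -> Prop).

Lemma ideal_gen_add f g :
  ideal_gen G f -> ideal_gen G g -> ideal_gen G (f + g).
Proof.
move=> hf hg; elim: hf => [|a k f' Gk _ IH]; first by rewrite add0r.
by rewrite -addrA; constructor.
Qed.

Lemma ideal_gen_mul c f : ideal_gen G f -> ideal_gen G (c * f).
Proof.
elim=> [|a k f' Gk _ IH]; first by rewrite mulr0; constructor.
by rewrite mulrDr mulrA; constructor.
Qed.

End Ideal.

(* Closure for the topology of the completion: a basis of neighbourhoods of [0]
   is given by the series with vanishing components in degrees [< n]. *)
Definition mps_closure (R : comNzRingType) (I : choiceType) (J : mps R I -> Prop)
    (f : mps R I) : Prop :=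
  forall n, exists2 g, J g & forall d, (d < n)%N -> f d = g d.

Section Rename.
Variables (R : comNzRingType) (I J : choiceType) (r : I -> J).
Notation PI := {malg R[{cmonom I}]}.
Notation PJ := {malg R[{cmonom J}]}.

Definition cm_ren (m : {cmonom I}) : PJ :=
  \prod_(i <- finsupp m) mkmalgU (ucm (r i)) 1 ^+ m i.

Lemma cm_renEw (m : {cmonom I}) (d : {fset I}) : (finsupp m `<=` d)%fset ->
  cm_ren m = \prod_(i <- d) mkmalgU (ucm (r i)) 1 ^+ m i.
Proof.
move=> le; rewrite /cm_ren (big_fset_incl _ le) // => i _.
by rewrite -cmE_eq0 => /eqP->.
Qed.

Lemma cm_ren_mmorphism : mmorphism cm_ren.
Proof.
split=> [m1 m2|]; last by rewrite /cm_ren mdom1 big_seq_fset0.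
rewrite (@cm_renEw m1 (finsupp m1 `|` finsupp m2)%fset) ?fsubsetUl //.
rewrite (@cm_renEw m2 (finsupp m1 `|` finsupp m2)%fset) ?fsubsetUr //.
rewrite (@cm_renEw _ (finsupp m1 `|` finsupp m2)%fset) ?mdomD //.
rewrite -big_split /=; apply: eq_bigr => i _.
by rewrite cmM exprD.
Qed.

HB.instance Definition _ := isMultiplicative.Build _ _ cm_ren cm_ren_mmorphism.

Lemma homog_cm_ren m : homog (mdeg m) (cm_ren m).
Proof.
rewrite /cm_ren mdegE; elim/big_rec2: _ => [|i e p _ hp]; first exact: homog1.
apply: homogM => //; elim: (m i) => [|k IH]; first exact: homog1.
by rewrite exprS -add1n; apply: homogM => //; exact: homogX.
Qed.

(* The morphism of [R]-algebras [x_i |-> x_(r i)] of polynomial rings. *)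
Definition poly_ren : PI -> PJ := mmap (@mkmalgU {cmonom J} R mone) cm_ren.

HB.instance Definition _ := GRing.RMorphism.copy poly_ren
  (mmap (@mkmalgU {cmonom J} R mone) cm_ren).

Lemma poly_renZ c p : poly_ren (c *: p) = c *: poly_ren p.
Proof. by rewrite /poly_ren mmapZ mul_malgC. Qed.

Lemma poly_renX i : poly_ren (mkmalgU (ucm i) 1) = mkmalgU (ucm (r i)) 1.
Proof.
rewrite /poly_ren mmapU mul1r /cm_ren mdomU big_seq_fset1.
by rewrite cmUU expr1.
Qed.

Lemma homog_poly_ren d p : homog d p -> homog d (poly_ren p).
Proof.
move=> hp; rewrite /poly_ren mmapE big_seq; apply: homog_sum => m mp.
by rewrite mul_malgC; apply: homogZ; rewrite -(hp _ mp); exact: homog_cm_ren.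
Qed.

Definition mps_ren (f : mps R I) : mps R J :=
  Mps (fun d => homog_poly_ren (mcomp_homog f d)).

Lemma mps_ren_zmod : zmod_morphism mps_ren.
Proof. by move=> f g; apply: mps_ext => d /=; rewrite raddfB. Qed.
HB.instance Definition _ :=
  GRing.isZmodMorphism.Build (mps R I) (mps R J) mps_ren mps_ren_zmod.

Lemma mps_ren_monoid : monoid_morphism mps_ren.
Proof.
split=> [|f g]; apply: mps_ext => d /=; first by case: (d == 0%N); rewrite ?rmorph1 ?rmorph0.
by rewrite /mps_conv rmorph_sum; apply: eq_bigr => i _; rewrite rmorphM.
Qed.
HB.instance Definition _ :=
  GRing.isMonoidMorphism.Build (mps R I) (mps R J) mps_ren mps_ren_monoid.

Lemma mps_renX i : mps_ren (mpsX R i) = mpsX R (r i).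
Proof.
apply: mps_ext => d /=.
by case: (d == 1%N); rewrite ?rmorph0 ?poly_renX.
Qed.

Lemma mps_ren_subst2 F (g h : mps R I) :
  mps_ren (subst2 F g h) = subst2 F (mps_ren g) (mps_ren h).
Proof.
apply: mps_ext => d /=; rewrite rmorph_sum; apply: eq_bigr => i _.
rewrite rmorph_sum; apply: eq_bigr => j _; rewrite [LHS]poly_renZ.
congr (_ *: _).
have e : mps_ren (g ^+ i * h ^+ j) = mps_ren g ^+ i * mps_ren h ^+ j.
  by rewrite rmorphM !rmorphXn.
exact: (congr1 (fun f : mps R J => f d) e).
Qed.

End Rename.

Section RenameFunctor.
Variables (R : comNzRingType) (I J K : choiceType).

Lemma cm_ren_id (m : {cmonom I}) : cm_ren R id m = mkmalgU m 1.
Proof.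
have UM (m1 m2 : {cmonom I}) : mkmalgU m1 1 * mkmalgU m2 1 =
    mkmalgU (mmul m1 m2) 1 :> {malg R[{cmonom I}]}.
  by have := fgmulUU (1 : R) 1 m1 m2; rewrite mulr1 => <-.
have UX i n : mkmalgU (ucm i) 1 ^+ n =
    mkmalgU (iter n (mmul (ucm i)) mone) 1 :> {malg R[{cmonom I}]}.
  elim: n => [|n IH]; first by rewrite expr0 /= mpolyC1E.
  by rewrite exprS IH iterS; exact: UM.
have iE i n j : (iter n (mmul (ucm i)) mone : {cmonom I}) j = ((i == j) * n)%N.
  elim: n => [|n IH] /=; first by rewrite cm1 muln0.
  by rewrite cmM cmU IH mulnS.
rewrite /cm_ren; under eq_bigr do rewrite UX.
rewrite -(big_morph (fun k : {cmonom I} => mkmalgU k 1) (fun a b => esym (UM a b)) (mpolyC1E _ _)).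
congr (mkmalgU _ 1); apply/eqP/cmP => j.
rewrite (big_morph (fun k : {cmonom I} => k j) (id1 := 0%N) (op1 := addn));
  [|by move=> x y; rewrite cmM|by rewrite cm1].
under eq_bigr do rewrite iE.
have [jm|jm] := boolP (j \in finsupp m).
  rewrite (bigD1_seq j) ?fset_uniq //= eqxx mul1n big1 ?addn0 // => i /negPf ne.
  by rewrite ne.
rewrite big_seq big1 => [|i im]; first by apply/esym/eqP; rewrite cmE_eq0.
by case: eqP => // e; rewrite -e im in jm.
Qed.

Lemma mps_ren_id (f : mps R I) : mps_ren id f = f.
Proof.
apply: mps_ext => d /=; rewrite /poly_ren mmapE [RHS]monalgE.
apply: eq_bigr => m _; rewrite cm_ren_id.
have := fgmulUU (mcoeff m (f d)) 1 mone m.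
by rewrite mulr1 mul1m => <-.
Qed.

Lemma mps_ren_comp (r : J -> K) (q : I -> J) (f : mps R I) :
  mps_ren (r \o q) f = mps_ren r (mps_ren q f).
Proof.
apply: mps_ext => d /=; rewrite {1 3}/poly_ren !mmapE rmorph_sum.
apply: eq_bigr => m _; rewrite !mul_malgC [RHS]poly_renZ; congr (_ *: _).
rewrite [RHS]rmorph_prod; apply: eq_bigr => i _.
by rewrite [RHS]rmorphXn /= poly_renX.
Qed.

End RenameFunctor.

Section FormalGroupAlgebra.
Variables (R : comNzRingType) (F : fgl R) (L : zmodType).

Definition fga_rel (f : mps R L) : Prop :=
  f = mpsX R 0 \/
  exists l m, f = mpsX R (l + m) - subst2 F (mpsX R l) (mpsX R m).

Definition fga_ideal (f : mps R L) : bool :=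
  `[< mps_closure (ideal_gen fga_rel) f >].

Lemma fga_ideal_closed : idealr_closed fga_ideal.
Proof.
split=> [||a f g /asboolP hf /asboolP hg].
- by apply/asboolP => n; exists 0 => //; constructor.
- apply/asboolP => /(_ 1%N) [g hg /(_ 0%N isT)].
  have -> : g 0%N = 0.
    elim: hg => // b k f [->|[l [m ->]]] _ IH /=.
      by rewrite /mps_conv big_ord1 mulr0 IH addr0.
    rewrite /mps_conv big_ord1 IH addr0 /= !big_ord1 fgl_x0.
    by rewrite scale0r oppr0 add0r mulr0.
  by move=> /eqP; rewrite /= oner_eq0.
- apply/asboolP => n; have [f' Jf ef] := hf n; have [g' Jg eg] := hg n.
  exists (a * f' + g').
    by apply: ideal_gen_add => //; apply: ideal_gen_mul.
  move=> d dn; rewrite !mps_addE !mps_mulE (eg d dn).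
  suff -> : mps_conv a f d = mps_conv a f' d by [].
  apply: eq_bigr => i _; congr (_ * _); apply: ef; apply: leq_ltn_trans dn.
  exact: leq_subr.
Qed.

HB.instance Definition _ := isIdealr.Build (mps R L) fga_ideal fga_ideal_closed.

Definition fga := @Quotient.quot (mps R L) (Idealr.clone _ fga_ideal _).
HB.instance Definition _ := GRing.ComNzRing.on fga.

Definition fga_pi : mps R L -> fga := \pi_fga%qT.
HB.instance Definition _ := GRing.RMorphism.copy fga_pi \pi_fga%qT.

Definition fga_x (l : L) : fga := fga_pi (mpsX R l).

Lemma fga_pi_eq f g : fga_pi f = fga_pi g <-> fga_ideal (f - g).
Proof.
by split=> [/eqP|h]; [|apply/eqP]; rewrite /fga_pi -Quotient.idealrBE.
Qed.

(* The endomorphism [x_l |-> x_(w l)] induced by an endomorphism [w] of [L];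
   [fga_mapE] shows that it is well defined. *)
Definition fga_map (w : L -> L) (s : fga) : fga := fga_pi (mps_ren w (generic_quotient.repr s)).

Variable w : {additive L -> L}.

Lemma fga_ideal_ren f : fga_ideal f -> fga_ideal (mps_ren w f).
Proof.
move=> /asboolP hf; apply/asboolP => n; have [g Jg eg] := hf n.
exists (mps_ren w g); last by move=> d dn /=; rewrite eg.
elim: Jg => [|a k f' Gk _ IH]; first by rewrite rmorph0; constructor.
rewrite rmorphD rmorphM; constructor => //.
case: Gk => [->|[l [m ->]]].
  by left; rewrite [LHS]mps_renX raddf0.
right; exists (w l), (w m).
by rewrite rmorphB [X in _ - X]mps_ren_subst2 !mps_renX [X in X - _]mps_renX raddfD.
Qed.

Lemma fga_mapE f : fga_map w (fga_pi f) = fga_pi (mps_ren w f).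
Proof.
apply/fga_pi_eq; rewrite -rmorphB; apply: fga_ideal_ren.
by apply/fga_pi_eq; rewrite /fga_pi reprK.
Qed.

Lemma fga_pi_surj s : exists f, s = fga_pi f.
Proof. by exists (generic_quotient.repr s); rewrite /fga_pi reprK. Qed.

Lemma fga_map_x l : fga_map w (fga_x l) = fga_x (w l).
Proof. by rewrite /fga_x fga_mapE mps_renX. Qed.

Lemma fga_map_zmod : zmod_morphism (fga_map w).
Proof.
move=> s t; have [f ->] := fga_pi_surj s; have [g ->] := fga_pi_surj t.
by rewrite -rmorphB !fga_mapE !rmorphB.
Qed.
Lemma fga_map_monoid : monoid_morphism (fga_map w).
Proof.
split=> [|s t]; first by rewrite -(rmorph1 fga_pi) fga_mapE !rmorph1.
have [f ->] := fga_pi_surj s; have [g ->] := fga_pi_surj t.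
by rewrite -rmorphM !fga_mapE !rmorphM.
Qed.

End FormalGroupAlgebra.

Section FormalGroupAlgebraFunctor.
Variables (R : comNzRingType) (F : fgl R) (L : zmodType).

Lemma fga_map_id (s : fga F L) : fga_map id s = s.
Proof.
have [f ->] := fga_pi_surj s.
by rewrite -[LHS]/(fga_map (idfun : {additive L -> L}) _) fga_mapE mps_ren_id.
Qed.

Lemma fga_map_comp (v w : {additive L -> L}) (s : fga F L) :
  fga_map (v \o w) s = fga_map v (fga_map w s).
Proof.
have [f ->] := fga_pi_surj s.
rewrite -[LHS]/(fga_map (v \o w : {additive L -> L}) _) !fga_mapE.
by rewrite mps_ren_comp.
Qed.

End FormalGroupAlgebraFunctor.

Section Localization.
Variables (A : comNzRingType) (M : mulrClosed A).
Notation D := {d : A | d \in M}.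

Definition den1 : D := exist (fun d => d \in M) 1 (rpred1 M).
Definition denM (d e : D) : D :=
  exist (fun d => d \in M) (sval d * sval e) (rpredM (svalP d) (svalP e)).

Definition loc_eq (p q : A * D) : Prop :=
  exists2 c, c \in M & c * (p.1 * sval q.2) = c * (q.1 * sval p.2).
Definition loc_eqb (p q : A * D) : bool := `[< loc_eq p q >].

Lemma loc_eq_equiv : equiv_class_of loc_eqb.
Proof.
split=> [p|p q|q p r].
- by apply/asboolP; exists 1 => //; exact: rpred1.
- by apply/asboolP/asboolP => -[c cM e]; exists c.
- move=> /asboolP[c cM ec] /asboolP[e eM ee]; apply/asboolP.
  exists (c * e * sval q.2); first by rewrite !rpredM // (svalP q.2).
  transitivity (e * sval r.2 * (c * (p.1 * sval q.2))); first by ring.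
  rewrite ec; transitivity (c * sval p.2 * (e * (q.1 * sval r.2))); first by ring.
  by rewrite ee; ring.
Qed.

Canonical loc_equiv := EquivRelPack loc_eq_equiv.
Canonical loc_encModRel := defaultEncModRel loc_eqb.

Definition loc := {eq_quot loc_eqb}%qT.
HB.instance Definition _ := Choice.on loc.
HB.instance Definition _ := EqQuotient.on loc.

Definition loc_pi (p : A * D) : loc := \pi_loc%qT p.
Definition loc_repr (x : loc) : A * D := generic_quotient.repr x.

Lemma loc_reprK x : loc_pi (loc_repr x) = x.
Proof. exact: reprK. Qed.

Lemma loc_piP p q : loc_pi p = loc_pi q <-> loc_eq p q.
Proof. by split=> [/eqmodP/asboolP|h]; last by apply/eqmodP/asboolP. Qed.

Lemma loc_reprP p : loc_eq (loc_repr (loc_pi p)) p.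
Proof. by apply/loc_piP; rewrite loc_reprK. Qed.

Definition pair_add (p q : A * D) : A * D :=
  (p.1 * sval q.2 + q.1 * sval p.2, denM p.2 q.2).
Definition pair_mul (p q : A * D) : A * D := (p.1 * q.1, denM p.2 q.2).

Definition loc_zero := loc_pi (0, den1).
Definition loc_one := loc_pi (1, den1).
Definition loc_add x y := loc_pi (pair_add (loc_repr x) (loc_repr y)).
Definition loc_opp x := loc_pi (- (loc_repr x).1, (loc_repr x).2).
Definition loc_mul x y := loc_pi (pair_mul (loc_repr x) (loc_repr y)).

Lemma loc_pi_add p q : loc_add (loc_pi p) (loc_pi q) = loc_pi (pair_add p q).
Proof.
have [c cM ec] := loc_reprP p; have [d dM ed] := loc_reprP q.
apply/loc_piP; exists (c * d); first exact: rpredM.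
case: (loc_repr (loc_pi p)) ec => p1 p2 /= ec.
case: (loc_repr (loc_pi q)) ed => q1 q2 /= ed.
transitivity (d * sval q2 * sval q.2 * (c * (p1 * sval p.2)) +
              c * sval p2 * sval p.2 * (d * (q1 * sval q.2))); first by ring.
by rewrite ec ed; ring.
Qed.

Lemma loc_pi_opp p : loc_opp (loc_pi p) = loc_pi (- p.1, p.2).
Proof.
have [c cM ec] := loc_reprP p; apply/loc_piP; exists c => //.
by rewrite /= !mulNr !mulrN ec.
Qed.

Lemma loc_pi_mul p q : loc_mul (loc_pi p) (loc_pi q) = loc_pi (pair_mul p q).
Proof.
have [c cM ec] := loc_reprP p; have [d dM ed] := loc_reprP q.
apply/loc_piP; exists (c * d); first exact: rpredM.
case: (loc_repr (loc_pi p)) ec => p1 p2 /= ec.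
case: (loc_repr (loc_pi q)) ed => q1 q2 /= ed.
transitivity ((c * (p1 * sval p.2)) * (d * (q1 * sval q.2))); first by ring.
by rewrite ec ed; ring.
Qed.

Lemma loc_pi_eq1 p q : p.1 * sval q.2 = q.1 * sval p.2 -> loc_pi p = loc_pi q.
Proof. by move=> e; apply/loc_piP; exists 1; rewrite ?rpred1 ?e. Qed.

Lemma loc_ind (P : loc -> Prop) : (forall p, P (loc_pi p)) -> forall x, P x.
Proof. by move=> h x; rewrite -(loc_reprK x). Qed.

Lemma loc_addA : associative loc_add.
Proof.
elim/loc_ind=> p; elim/loc_ind=> q; elim/loc_ind=> r.
by rewrite !loc_pi_add; apply: loc_pi_eq1 => /=; ring.
Qed.
Lemma loc_addC : commutative loc_add.
Proof.
elim/loc_ind=> p; elim/loc_ind=> q.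
by rewrite !loc_pi_add; apply: loc_pi_eq1 => /=; ring.
Qed.
Lemma loc_add0 : left_id loc_zero loc_add.
Proof.
elim/loc_ind=> p.
by rewrite !loc_pi_add; apply: loc_pi_eq1 => /=; ring.
Qed.
Lemma loc_addN : left_inverse loc_zero loc_opp loc_add.
Proof.
elim/loc_ind=> p.
by rewrite loc_pi_opp !loc_pi_add; apply: loc_pi_eq1 => /=; ring.
Qed.

HB.instance Definition _ :=
  GRing.isZmodule.Build loc loc_addA loc_addC loc_add0 loc_addN.

Lemma loc_mulA : associative loc_mul.
Proof.
elim/loc_ind=> p; elim/loc_ind=> q; elim/loc_ind=> r.
by rewrite !loc_pi_mul; apply: loc_pi_eq1 => /=; ring.
Qed.
Lemma loc_mulC : commutative loc_mul.
Proof.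
elim/loc_ind=> p; elim/loc_ind=> q.
by rewrite !loc_pi_mul; apply: loc_pi_eq1 => /=; ring.
Qed.
Lemma loc_mul1 : left_id loc_one loc_mul.
Proof.
elim/loc_ind=> p.
by rewrite !loc_pi_mul; apply: loc_pi_eq1 => /=; ring.
Qed.
Lemma loc_mulDl : left_distributive loc_mul +%R.
Proof.
elim/loc_ind=> p; elim/loc_ind=> q; elim/loc_ind=> r.
rewrite -[LHS]/(loc_mul (loc_add _ _) _) -[RHS]/(loc_add _ _).
rewrite !(loc_pi_mul, loc_pi_add).
by apply: loc_pi_eq1 => /=; ring.
Qed.

HB.instance Definition _ := GRing.Zmodule_isComPzRing.Build loc
  loc_mulA loc_mulC loc_mul1 loc_mulDl.

(* The fraction [s / d]; it is meaningful only for [d] in [M]. *)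
Definition loc_frac (s d : A) : loc := loc_pi (s, insubd den1 d).

Definition loc_inj (s : A) : loc := loc_frac s 1.

Lemma loc_fracK s d : d \in M -> loc_mul (loc_frac s d) (loc_inj d) = loc_inj s.
Proof.
move=> dM; rewrite /loc_inj /loc_frac loc_pi_mul; apply: loc_pi_eq1 => /=.
rewrite -[sval (insubd _ d)]/(val (insubd den1 d)).
rewrite -[sval (insubd _ 1)]/(val (insubd den1 1)).
by rewrite !val_insubd dM rpred1; ring.
Qed.

Variable phi : {rmorphism A -> A}.
Hypothesis phiM : forall d, d \in M -> phi d \in M.

Definition loc_map_pair (p : A * D) : A * D :=
  (phi p.1, exist (fun d => d \in M) (phi (sval p.2)) (phiM (svalP p.2))).
Definition loc_map (x : loc) : loc := loc_pi (loc_map_pair (loc_repr x)).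

Lemma loc_mapE p : loc_map (loc_pi p) = loc_pi (loc_map_pair p).
Proof.
have [c cM ec] := loc_reprP p; apply/loc_piP.
by exists (phi c) => /=; rewrite ?phiM // -!rmorphM ec.
Qed.

Lemma loc_map_zmod : zmod_morphism loc_map.
Proof.
elim/loc_ind=> p; elim/loc_ind=> q.
rewrite -[X in loc_map X]/(loc_add _ (loc_opp _)).
rewrite -[RHS]/(loc_add _ (loc_opp _)).
rewrite !(loc_mapE, loc_pi_opp, loc_pi_add).
by apply: loc_pi_eq1; rewrite /= rmorphD !rmorphM rmorphN.
Qed.

Lemma loc_map_monoid : monoid_morphism loc_map.
Proof.
split.
  rewrite -[1]/loc_one loc_mapE; apply: loc_pi_eq1.
  by rewrite /= rmorph1.
elim/loc_ind=> p; elim/loc_ind=> q.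
rewrite -[X in loc_map X]/(loc_mul _ _) -[RHS]/(loc_mul _ _).
rewrite !(loc_mapE, loc_pi_mul).
by apply: loc_pi_eq1; rewrite /= !rmorphM.
Qed.

End Localization.

(* A reduced semisimple root datum on the lattice [L].  The conditions
   [rd_lattice] and [rd_semisimple] say that [L] is free of finite rank and that
   the roots span [L] over the rational numbers. *)
Record rootDatum (L : zmodType) := RootDatum {
  rd_roots : {fset L};
  coroot : rd_roots -> {additive L -> int};
  rd_lattice : exists (r : nat) (b : 'I_r -> L), forall l,
    exists! c : {ffun 'I_r -> int}, l = \sum_i b i *~ c i;
  rd_coroot_inj : forall a b : rd_roots, coroot a =1 coroot b -> a = b;
  rd_coroot2 : forall a : rd_roots, coroot a (val a) = 2;
  rd_refl_root : forall a b : rd_roots,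
    val b - val a *~ coroot a (val b) \in rd_roots;
  rd_refl_coroot : forall a b : rd_roots, exists c : rd_roots,
    forall l, coroot c l = coroot b l - coroot b (val a) * coroot a l;
  rd_reduced : forall a : rd_roots, val a *+ 2 \notin rd_roots;
  rd_semisimple : forall l, exists2 k : nat, (0 < k)%N &
    exists c : rd_roots -> int, l *+ k = \sum_(a : rd_roots) val a *~ c a }.

Section WeylGroup.
Variables (L : zmodType) (rd : rootDatum L).
Notation roots := (rd_roots rd).

Definition rd_refl (a : roots) (l : L) : L := l - val a *~ coroot a l.

Lemma refl_zmod a : zmod_morphism (rd_refl a).
Proof.
move=> l m; rewrite /rd_refl raddfB mulrzBr.
by rewrite opprD opprK addrACA opprD opprK.
Qed.

Lemma reflK a : involutive (rd_refl a).
Proof.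
move=> l; rewrite /rd_refl raddfB /= raddfMz rd_coroot2 mulrzBr.
have -> : (2 : int) *~ coroot a l = coroot a l + coroot a l.
  by rewrite mulrzz; ring.
by rewrite mulrzDr opprB addrK subrK.
Qed.

Definition refl_word (s : seq roots) : L -> L :=
  foldr (fun a f => rd_refl a \o f) id s.

Definition in_weyl (w : L -> L) : bool :=
  `[< exists s : seq roots, w = refl_word s >].

(* The Weyl group as a group of automorphisms of [L], with composition. *)
Definition weyl := {w : L -> L | in_weyl w}.
Definition weyl_fun (w : weyl) : L -> L := sval w.
Coercion weyl_fun : weyl >-> Funclass.

HB.instance Definition _ := Choice.on weyl.

Lemma weyl_ext (v w : weyl) : v =1 w -> v = w.
Proof. by move=> /funext e; apply: val_inj. Qed.

Lemma weyl_wordP (w : weyl) : exists s, weyl_fun w = refl_word s.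
Proof. by have /asboolP := svalP w. Qed.

Lemma weyl_zmod (w : weyl) : zmod_morphism w.
Proof.
have [s ->] := weyl_wordP w; elim: s => [|a s IH] //= l m.
by rewrite -[LHS]/(rd_refl a (refl_word s (l - m))) IH refl_zmod.
Qed.
HB.instance Definition _ (w : weyl) :=
  GRing.isZmodMorphism.Build L L w (weyl_zmod w).

Lemma weyl_root (w : weyl) (a : roots) : w (val a) \in roots.
Proof.
have [s ->] := weyl_wordP w; elim: s => [|b s IH] /=; first exact: valP.
exact: (rd_refl_root b [` IH]%fset).
Qed.

Definition weyl_act_root (w : weyl) (a : roots) : roots := [` weyl_root w a]%fset.

Lemma rd_torsion_free (l : L) k : (0 < k)%N -> l *+ k = 0 -> l = 0.
Proof.
move=> k0 lk; have [r [b hb]] := rd_lattice rd.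
have [c [ec _]] := hb l; have [c0 [_ uc0]] := hb 0.
have e1 : c0 = [ffun=> 0].
  by apply: uc0; rewrite big1 // => i _; rewrite ffunE mulr0z.
have e2 : c0 = [ffun i => c i *+ k].
  apply: uc0; rewrite -[LHS]lk ec -sumrMnl; apply: eq_bigr => i _.
  by rewrite ffunE -mulr_natr mulrzA natz -pmulrn.
rewrite ec big1 // => i _; have /ffunP/(_ i) := etrans (esym e2) e1.
rewrite !ffunE -mulr_natr natz => /eqP; rewrite mulf_eq0 => /orP[/eqP->|].
  exact: mulr0z.
by rewrite eqz_nat => /eqP k_eq0; rewrite k_eq0 in k0.
Qed.

Lemma weyl_act_root_inj (v w : weyl) :
  weyl_act_root v =1 weyl_act_root w -> v = w.
Proof.
move=> e; apply: weyl_ext => l; apply/eqP; rewrite -subr_eq0; apply/eqP.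
have [k k0 [c ec]] := rd_semisimple rd l.
have E (u : weyl) : u l *+ k = \sum_(a : roots) u (val a) *~ c a.
  rewrite -[LHS](raddfMn u) ec (raddf_sum u).
  by apply: eq_bigr => a _; rewrite (raddfMz u).
apply: (rd_torsion_free k0); rewrite mulrnBl !E -sumrB big1 // => a _.
by have /(congr1 val) /= -> := e a; rewrite subrr.
Qed.

Definition weyl_ffun (w : weyl) : {ffun roots -> roots} :=
  [ffun a => weyl_act_root w a].
Definition weyl_unffun (f : {ffun roots -> roots}) : option weyl :=
  if pselect (exists w, weyl_ffun w == f) is left h then Some (xchoose h)
  else None.

Lemma weyl_ffunK : pcancel weyl_ffun weyl_unffun.
Proof.
move=> w; rewrite /weyl_unffun; case: pselect => [h|[]]; last by exists w.
congr Some; apply: weyl_act_root_inj => a.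
by have /eqP/ffunP/(_ a) := xchooseP h; rewrite !ffunE.
Qed.

HB.instance Definition _ : isCountable weyl := PCanIsCountable weyl_ffunK.
HB.instance Definition _ : isFinite weyl := PCanIsFinite weyl_ffunK.

Lemma refl_word_cat s t : refl_word (s ++ t) = refl_word s \o refl_word t.
Proof. by elim: s => //= a s ->. Qed.

Lemma refl_word_revK s : refl_word (rev s) \o refl_word s = id.
Proof.
elim: s => //= a s IH; rewrite rev_cons -cats1 refl_word_cat.
by apply/funext => l /=; rewrite reflK -[RHS](congr1 (fun f => f l) IH).
Qed.

Lemma in_weyl_id : in_weyl id.
Proof. by apply/asboolP; exists [::]. Qed.
Definition weyl_one : weyl := exist in_weyl id in_weyl_id.

Lemma in_weyl_comp (v w : weyl) : in_weyl (v \o w).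
Proof.
have [s es] := weyl_wordP v; have [t et] := weyl_wordP w.
by apply/asboolP; exists (s ++ t); rewrite es et refl_word_cat.
Qed.
Definition weyl_mul (v w : weyl) : weyl := exist in_weyl (v \o w) (in_weyl_comp v w).

Lemma weyl_inv_subproof (w : weyl) : exists v, weyl_mul v w == weyl_one.
Proof.
have [s es] := weyl_wordP w.
have h : in_weyl (refl_word (rev s)) by apply/asboolP; exists (rev s).
exists (exist in_weyl _ h); apply/eqP/weyl_ext => l /=.
by rewrite es -[RHS](congr1 (fun f => f l) (refl_word_revK s)).
Qed.
Definition weyl_inv (w : weyl) : weyl := xchoose (weyl_inv_subproof w).

Lemma weyl_mulA : associative weyl_mul.
Proof. by move=> u v w; apply: weyl_ext. Qed.
Lemma weyl_mul1 : left_id weyl_one weyl_mul.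
Proof. by move=> w; apply: weyl_ext. Qed.
Lemma weyl_mulV : left_inverse weyl_one weyl_inv weyl_mul.
Proof. by move=> w; apply/eqP/(xchooseP (weyl_inv_subproof w)). Qed.

HB.instance Definition _ :=
  Finite_isGroup.Build weyl weyl_mulA weyl_mul1 weyl_mulV.

Lemma weyl1E : weyl_fun 1%g = id. Proof. by []. Qed.
Lemma weylME (v w : weyl) : weyl_fun (v * w)%g = v \o w. Proof. by []. Qed.

Lemma in_weyl_refl a : in_weyl (rd_refl a).
Proof. by apply/asboolP; exists [:: a]. Qed.
Definition weyl_refl (a : roots) : weyl := exist in_weyl (rd_refl a) (in_weyl_refl a).

End WeylGroup.

Record simple_system (L : zmodType) (rd : rootDatum L) (n : nat)
    (alpha : 'I_n -> rd_roots rd) : Prop := SimpleSystem {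
  ss_indep : forall c : 'I_n -> int,
    \sum_i val (alpha i) *~ c i = 0 -> forall i, c i = 0;
  ss_sign : forall a : rd_roots rd, exists c : 'I_n -> nat,
    val a = \sum_i val (alpha i) *+ c i \/
    val a = - \sum_i val (alpha i) *+ c i }.

Section SimpleRoots.
Variables (L : zmodType) (rd : rootDatum L) (n : nat) (alpha : 'I_n -> rd_roots rd).

Definition neg_root (a : rd_roots rd) : bool :=
  `[< exists c : 'I_n -> nat, val a = - \sum_i val (alpha i) *+ c i >].

Definition simple_refl (i : 'I_n) : weyl rd := weyl_refl (alpha i).

Definition wword (I : seq 'I_n) : weyl rd := (\prod_(i <- I) simple_refl i)%g.

(* The least [m] such that [w] is a product of [m] simple reflections; such an
   [m] is smaller than the order of the Weyl group. *)
Definition wlen (w : weyl rd) : nat :=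
  find (fun m => [exists I : m.-tuple 'I_n, wword I == w]) (iota 0 #|{: weyl rd}|).

Definition is_reduced (I : seq 'I_n) (w : weyl rd) : Prop :=
  wword I = w /\ size I = wlen w.

Variable Xi : {set 'I_n}.

Definition parabolic : {group weyl rd} := <<[set simple_refl i | i in Xi]>>%G.

Definition min_coset_reps : {set weyl rd} :=
  [set w | [forall i in Xi, wlen w < wlen (w * simple_refl i)%g]%N].

End SimpleRoots.

Section TwistedAlgebra.
Variables (R : comNzRingType) (F : fgl R) (L : zmodType) (rd : rootDatum L).
Notation W := (weyl rd).
Notation roots := (rd_roots rd).
Notation S := (fga F L).

Definition x_root (a : roots) : S := fga_x F (val a).

(* This is [x_(-a)], where [-a] is again a root (see [x_opp_xprod]). *)
Definition x_opp (a : roots) : S := fga_x F (- val a).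

Definition actS (w : W) : S -> S := fga_map w.
HB.instance Definition _ w :=
  GRing.isZmodMorphism.Build S S (actS w) (@fga_map_zmod R F L w).
HB.instance Definition _ w :=
  GRing.isMonoidMorphism.Build S S (actS w) (@fga_map_monoid R F L w).

Lemma actS1 s : actS 1%g s = s.
Proof. exact: fga_map_id. Qed.
Lemma actSM v w s : actS (v * w)%g s = actS v (actS w s).
Proof. by rewrite /actS weylME fga_map_comp. Qed.
Lemma actS_x w l : actS w (fga_x F l) = fga_x F (w l).
Proof. exact: fga_map_x. Qed.

(* The multiplicative set generated by the [x_root a]; localizing at it inverts
   exactly the [x_root a]. *)
Definition xprod (d : S) : bool :=
  `[< exists s : seq roots, d = \prod_(a <- s) x_root a >].

Lemma xprod_closed : mulr_closed xprod.
Proof.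
split; first by apply/asboolP; exists [::]; rewrite big_nil.
move=> _ _ /asboolP[s ->] /asboolP[t ->]; apply/asboolP.
by exists (s ++ t); rewrite big_cat.
Qed.
HB.instance Definition _ := GRing.isMulClosed.Build S xprod xprod_closed.

Lemma actS_xprod w d : d \in xprod -> actS w d \in xprod.
Proof.
move=> /asboolP[s ->]; apply/asboolP; exists [seq weyl_act_root w a | a <- s].
by rewrite rmorph_prod big_map; apply: eq_bigr => a _; rewrite [LHS]actS_x.
Qed.

Definition QF := loc (GRing.MulClosed.clone _ xprod _).
HB.instance Definition _ := GRing.ComPzRing.on QF.

Definition Q_frac (s d : S) : QF := loc_frac _ s d.
Definition S_incl (s : S) : QF := loc_inj _ s.

Lemma x_opp_xprod a : x_opp a \in xprod.
Proof.
have ra : - val a \in roots.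
  have := rd_refl_root a a; rewrite rd_coroot2.
  by rewrite (mulrzDr (val a) 1 1) mulr1z opprD addrA subrr add0r.
by apply/asboolP; exists [:: [` ra]%fset]; rewrite big_seq1.
Qed.

Lemma Q_fracK s d : d \in xprod -> Q_frac s d * S_incl d = S_incl s.
Proof. exact: loc_fracK. Qed.

Definition actQ (w : W) : QF -> QF := loc_map (@actS_xprod w).
HB.instance Definition _ w :=
  GRing.isZmodMorphism.Build QF QF (actQ w) (loc_map_zmod (@actS_xprod w)).
HB.instance Definition _ w :=
  GRing.isMonoidMorphism.Build QF QF (actQ w) (loc_map_monoid (@actS_xprod w)).

Lemma actQ1 q : actQ 1%g q = q.
Proof.
elim/loc_ind: q => p; rewrite /actQ loc_mapE; apply: loc_pi_eq1 => /=.
by rewrite [actS 1%g p.1]actS1 [actS 1%g _]actS1.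
Qed.
Lemma actQM v w q : actQ (v * w)%g q = actQ v (actQ w q).
Proof.
elim/loc_ind: q => p.
have E u r : actQ u (loc_pi r) = loc_pi (loc_map_pair (@actS_xprod u) r).
  exact: loc_mapE.
rewrite (E w p) !E; apply: loc_pi_eq1 => /=.
by rewrite [actS (v * w)%g p.1]actSM [actS (v * w)%g _]actSM.
Qed.

(* The element [\sum_w (p w) delta_w] of the twisted group algebra is
   represented by the function [p]. *)
Definition QW := {ffun W -> QF}.
HB.instance Definition _ := GRing.Zmodule.on QW.

Definition qscale (q : QF) (p : QW) : QW := [ffun w => q * p w].
Lemma qscaleA a b p : qscale a (qscale b p) = qscale (a * b) p.
Proof. by apply/ffunP => w; rewrite !ffunE mulrA. Qed.
Lemma qscale1 : left_id 1 qscale.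
Proof. by move=> p; apply/ffunP => w; rewrite !ffunE mul1r. Qed.
Lemma qscaleDr : right_distributive qscale +%R.
Proof. by move=> q p p'; apply/ffunP => w; rewrite !ffunE mulrDr. Qed.
Lemma qscaleDl p : {morph qscale^~ p : a b / a + b}.
Proof. by move=> a b; apply/ffunP => w; rewrite !ffunE mulrDl. Qed.
HB.instance Definition _ := GRing.Zmodule_isLmodule.Build QF QW
  qscaleA qscale1 qscaleDr qscaleDl.

Definition delta (w : W) : QW := [ffun v => (v == w)%:R].

(* The coefficient at [u] of
   [(\sum_v (p v) delta_v) * (\sum_w (q w) delta_w)
      = \sum_v \sum_w (p v) v(q w) delta_(v w)]; see [qmul_delta]. *)
Definition qmul (p q : QW) : QW :=
  [ffun u => \sum_(v : W) p v * actQ v (q (v^-1 * u)%g)].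

Lemma qmulA : associative qmul.
Proof.
move=> p q r; apply/ffunP => u; rewrite !ffunE.
under eq_bigr => v _ do rewrite ffunE raddf_sum mulr_sumr.
under [RHS]eq_bigr => v _ do rewrite ffunE mulr_suml.
rewrite [RHS]exchange_big /=; apply: eq_bigr => v _.
rewrite [RHS](reindex_inj (mulgI v)) /=; apply: eq_bigr => w _.
by rewrite rmorphM mulKg actQM invMg -mulgA mulrA.
Qed.
Lemma qmul1q : left_id (delta 1%g) qmul.
Proof.
move=> p; apply/ffunP => u; rewrite !ffunE (bigD1 1%g) //= big1.
  by rewrite ffunE eqxx mul1r addr0 actQ1 invg1 mul1g.
by move=> v /negPf v1; rewrite ffunE v1 mul0r.
Qed.
Lemma qmulq1 : right_id (delta 1%g) qmul.
Proof.
move=> p; apply/ffunP => u; rewrite !ffunE (bigD1 u) //= big1.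
  by rewrite ffunE mulVg eqxx rmorph1 mulr1 addr0.
move=> v vu; rewrite ffunE -eq_mulVg1 (negPf vu) rmorph0.
exact: mulr0.
Qed.
Lemma qmulDl : left_distributive qmul +%R.
Proof.
move=> p q r; apply/ffunP => u; rewrite !ffunE -big_split /=.
by apply: eq_bigr => v _; rewrite ffunE mulrDl.
Qed.
Lemma qmulDr : right_distributive qmul +%R.
Proof.
move=> p q r; apply/ffunP => u; rewrite !ffunE -big_split /=.
by apply: eq_bigr => v _; rewrite ffunE rmorphD mulrDr.
Qed.
HB.instance Definition _ := GRing.Zmodule_isPzRing.Build QW
  qmulA qmul1q qmulq1 qmulDl qmulDr.

Lemma qmul_delta (p q : QF) (v w : W) :
  (p *: delta v) * (q *: delta w) = (p * actQ v q) *: delta (v * w)%g.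
Proof.
apply/ffunP => u; rewrite !ffunE (bigD1 v) //= big1 ?addr0 => [|v' ne].
  rewrite !ffunE eqxx mulr1 rmorphM rmorph_nat mulrA.
  by rewrite -(inj_eq (mulgI v)) mulKVg.
by rewrite !ffunE (negPf ne) mulr0 mul0r.
Qed.

Lemma qscalerAl (q : QF) (p p' : QW) : q *: (p * p') = (q *: p) * p'.
Proof.
apply/ffunP => u; rewrite !ffunE mulr_sumr.
by apply: eq_bigr => v _; rewrite ffunE mulrA.
Qed.

Definition Q_incl (q : QF) : QW := q *: delta 1%g.

Definition QW_dual := {scalar QW}.

Definition bullet_fun (z : QW) (f : QW_dual) (z' : QW) : QF := f (z' * z).
Lemma bullet_scalar z f : scalar (bullet_fun z f).
Proof.
by move=> q p p'; rewrite /bullet_fun mulrDl -qscalerAl linearP.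
Qed.
HB.instance Definition _ z f :=
  GRing.isLinear.Build QF QW QF *%R (bullet_fun z f) (bullet_scalar z f).
Definition bullet (z : QW) (f : QW_dual) : QW_dual := bullet_fun z f.

(* The basis [(f_w)] dual to [(delta_w)]. *)
Definition dbasis_fun (w : W) (z : QW) : QF := z w.
Lemma dbasis_scalar w : scalar (dbasis_fun w).
Proof. by move=> q p p'; rewrite /dbasis_fun !ffunE. Qed.
HB.instance Definition _ w :=
  GRing.isLinear.Build QF QW QF *%R (dbasis_fun w) (dbasis_scalar w).
Definition dbasis (w : W) : QW_dual := dbasis_fun w.

(* [b] is an [S]-basis of the [S]-submodule [M] of the dual of [Q_W]; the module
   structure is [(s f)(z) = s f(z)]. *)
Definition is_basis (J : finType) (b : J -> QW_dual) (M : QW_dual -> Prop) : Prop :=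
  (forall j, M (b j)) /\
  forall f, M f -> exists! c : {ffun J -> S},
    forall z, f z = \sum_j S_incl (c j) * b j z.

Variables (n : nat) (alpha : 'I_n -> roots).

Definition X_elt (i : 'I_n) : QW :=
  Q_incl (Q_frac 1 (x_root (alpha i))) * (1 - delta (simple_refl alpha i)).

Definition Y_elt (i : 'I_n) : QW :=
  Q_incl (Q_frac 1 (x_opp (alpha i))) +
  Q_incl (Q_frac 1 (x_root (alpha i))) * delta (simple_refl alpha i).

(* The [R]-subalgebra generated by [S] and the [X_elt i]; closure under opposites
   and scalars from [R] follows from the other clauses since [S] is an
   [R]-algebra. *)
Inductive DF : QW -> Prop :=
| DF_scal s : DF (Q_incl (S_incl s))
| DF_X i : DF (X_elt i)
| DF_add z z' : DF z -> DF z' -> DF (z + z')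
| DF_mul z z' : DF z -> DF z' -> DF (z * z').

(* [Hom_S(DF, S)], identified with the set of the forms on [Q_W] that map [DF]
   into [S]. *)
Definition DF_dual (f : QW_dual) : Prop :=
  forall z, DF z -> exists s, f z = S_incl s.

Definition A_op (i : 'I_n) : QW_dual -> QW_dual := bullet (Y_elt i).
Definition B_op (i : 'I_n) : QW_dual -> QW_dual := bullet (X_elt i).
Definition A_seq (I : seq 'I_n) (f : QW_dual) : QW_dual := foldr A_op f I.
Definition B_seq (I : seq 'I_n) (f : QW_dual) : QW_dual := foldr B_op f I.

Definition x_Pi : S := \prod_(a : roots | neg_root alpha a) x_root a.
Definition fe_tilde : QW_dual := bullet (Q_incl (S_incl x_Pi)) (dbasis 1%g).

Variable Xi : {set 'I_n}.
Notation WXi := (parabolic alpha Xi).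

Definition x_Xi : S :=
  \prod_(a : roots | neg_root alpha a && (weyl_refl a \in WXi)) x_root a.
Lemma x_Xi_xprod : x_Xi \in xprod.
Proof.
apply: rpred_prod => a _; apply/asboolP; exists [:: a].
by rewrite big_seq1.
Qed.

Definition Y_Xi : QW := (\sum_(w in WXi) delta w) * Q_incl (Q_frac 1 x_Xi).
Definition A_Xi : QW_dual -> QW_dual := bullet Y_Xi.

Definition DF_dual_inv (f : QW_dual) : Prop :=
  DF_dual f /\ forall w, w \in WXi -> forall z, bullet (delta w) f z = f z.

End TwistedAlgebra.

(* Main.v *)
(* For either family and u in W^Xi, let h_u be the member indexed by u. By the
   leading terms of products of the X_i or Y_i, h_u(delta_v) = 0 for v in W^Xi with
   l(v) >= l(u), v <> u, while h_u(delta_u) is, up to sign, the product P_u of the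
   x_(-b) over the positive roots b with (u w_Xi)^-1 b positive (w_Xi and w_0 are
   the longest elements of W_Xi and W).  If f in the dual of D_F is
   W_Xi-invariant and f(delta_v) = 0 for the longer v in W^Xi, then P_u divides
   f(delta_u): evaluate f at X_J delta_(w_0) for a reduced word J of u w_Xi w_0.
   Hence f is a unique combination of the h_u, by descending induction on length.

   It remains to see that h_u is in the dual, i.e. that Y_Xi is in D_F and
   x_Pi f_e maps D_F to S.  Both follow once the coefficients of every product of
   X_i, i in Xi, are in S up to the denominator x_Xi.  By induction on length
   (Matsumoto's theorem) only Xi of size two matters.  There one exhibits a
   function on W_Xi whose value at 1 divides x_Xi and which is 0 elsewhere, in a ring
   of functions stable under f |-> (f - s_i f) / x_i: it is a product of functions
   v |-> x_((v mu - mu') / N), times an extra factor in type G_2. *)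

Require Import Defs.
From HB Require Import structures.
From mathcomp Require Import all_boot all_order all_fingroup all_algebra.
From mathcomp Require Import finmap boolp monalg ring zify.

Set Implicit Arguments.
Unset Strict Implicit.
Unset Printing Implicit Defensive.

Import Order.TTheory GRing.Theory Num.Theory.
Local Open Scope ring_scope.

(** The obstacle is torsion. In [S] the x_a of different roots need not be coprime: for the additive
    law over the integers and the weight lattice of type A_1 x A_1, with fundamental weights p and
    q, the simple roots give 2p and 2q, and 2pq is divisible by each of them but not by their
    product. So denominators cannot be bounded one root at a time. A function supported at 1 avoids
    this: paired with a product of [X_i] it returns its value at 1 times a single coefficient, and
    this lies in [S] because each [X_i] can be moved onto the function as a divided difference. The
    denominators N come from fundamental weights. For w, w' in one orbit, x_(v w - w') vanishes
    where v w = w', and its value at 1 can be the x of a root. Roots in place of w would give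
    multiples such as x_(2a) in type A_1, which need not divide x_a. The weights may lie outside the
    lattice; the differences do not. In type G_2 the product used is made to vanish only on
    nontrivial elements of the long-root subgroup of type A_2, so the extra factor is one supported
    on that subgroup. *)

(** * Orders of series and convergent infinite sums *)

Section MpsOrder.
Variables (R : comNzRingType) (I : choiceType).
Implicit Types f g h : mps R I.

Definition mps_ord n f := forall d, (d < n)%N -> f d = 0.

Lemma mps_ord_le m n f : (m <= n)%N -> mps_ord n f -> mps_ord m f.
Proof. by move=> mn hf d dm; apply: hf; apply: leq_trans mn. Qed.

Lemma mps_ordD n f g : mps_ord n f -> mps_ord n g -> mps_ord n (f + g).
Proof. by move=> hf hg d dn; rewrite mps_addE hf // hg // addr0. Qed.

Lemma mps_ordN n f : mps_ord n f -> mps_ord n (- f).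
Proof. by move=> hf d dn; rewrite [LHS](_ : _ = - f d) // hf // oppr0. Qed.

Lemma mps_ordM m n f g : mps_ord m f -> mps_ord n g -> mps_ord (m + n) (f * g).
Proof.
move=> hf hg d dmn; rewrite mps_mulE /mps_conv big1 // => i _.
have [im|mi] := ltnP i m; first by rewrite hf // mul0r.
rewrite hg ?mulr0 //; have := ltn_ord i; lia.
Qed.

Lemma mps_ordX n f k : mps_ord n f -> mps_ord (k * n) (f ^+ k).
Proof.
move=> hf; elim: k => [//|k IH]; rewrite exprS mulSn; exact: mps_ordM.
Qed.

Lemma mpsX_ord i : mps_ord 1 (mpsX R i).
Proof. by case. Qed.

Lemma mps_sumE (J : Type) (r : seq J) (P : pred J) (G : J -> mps R I) d :
  (\sum_(j <- r | P j) G j : mps R I) d = \sum_(j <- r | P j) G j d.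
Proof. by elim/big_rec2: _ => // j p f _ <-. Qed.

Lemma mpsXM i f d : (mpsX R i * f) d = if d is e.+1 then mkmalgU (ucm i) 1 * f e else 0.
Proof.
rewrite mps_mulE /mps_conv; case: d => [|d]; first by rewrite big_ord1 mul0r.
rewrite big_ord_recl mul0r add0r big_ord_recl big1 => [|k _]; last by rewrite mul0r.
by rewrite addr0 subSS subn0.
Qed.

(* Meant for [t k] of order at least [k - 1], so that no term is cut off. *)
Lemma mps_series_subproof (t : nat -> mps R I) d :
  homog d (\sum_(k < d.+2) t k d).
Proof. by apply: homog_sum => k _; exact: mcomp_homog. Qed.
Definition mps_series t : mps R I := Mps (@mps_series_subproof t).

(** Order [k.-1] is what remains when a term of order [k] is divided by some x_a. The term of index
    [d.+1] can then still contribute in degree [d], whence [d.+1 < n]. *)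
Lemma mps_seriesE t n d : (forall k, mps_ord k.-1 (t k)) -> (d.+1 < n)%N ->
  mps_series t d = \sum_(k < n) t k d.
Proof.
move=> ot dn /=; rewrite -(big_mkord predT (fun k => t k d)).
rewrite [RHS](_ : _ = \sum_(0 <= k < n) t k d); last by rewrite big_mkord.
rewrite [RHS](big_cat_nat (n := d.+2)) //= -[LHS]addr0; congr (_ + _).
rewrite big_nat big1 // => k /andP[dk _]; apply: (ot k); lia.
Qed.

Definition mpsC_fun (c : R) d : {malg R[{cmonom I}]} := if d == 0%N then c *: 1 else 0.
Lemma mpsC_subproof c d : homog d (mpsC_fun c d).
Proof.
rewrite /mpsC_fun; case: d => [|d]; last exact: homog0.
by apply: homogZ; exact: homog1.
Qed.
Definition mpsC c : mps R I := Mps (@mpsC_subproof c).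

Lemma mpsCM c f d : (mpsC c * f) d = c *: f d.
Proof.
rewrite mps_mulE /mps_conv big_ord_recl big1 => [|k _]; last by rewrite mul0r.
by rewrite addr0 subn0 /= /mpsC_fun -scalerAl mul1r.
Qed.

End MpsOrder.

(** * Substitution into the formal group law *)

Section Subst2.
Variables (R : comNzRingType) (I : choiceType).
Implicit Types (C : nat -> nat -> R) (g h : mps R I).

Lemma subst2E C g h n d : mps_ord 1 g -> mps_ord 1 h -> (d < n)%N ->
  subst2 C g h d = \sum_(i < n) \sum_(j < n) C i j *: (g ^+ i * h ^+ j) d.
Proof.
move=> og oh dn.
have z i j : (d < i)%N || (d < j)%N -> mps_conv (g ^+ i) (h ^+ j) d = 0.
  move=> ij; apply: (mps_ordM (mps_ordX (k := i) og) (mps_ordX (k := j) oh)).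
  by rewrite !muln1; lia.
rewrite /= (big_ord_widen n (fun i => \sum_(j < d.+1) C i j *: (g ^+ i * h ^+ j) d)) //.
rewrite [RHS](bigID (fun i : 'I_n => (i < d.+1)%N)) /= [X in _ = _ + X]big1 ?addr0.
  apply: eq_bigr => i id.
  rewrite (big_ord_widen n (fun j => C i j *: (g ^+ i * h ^+ j) d)) //.
  rewrite [RHS](bigID (fun i : 'I_n => (i < d.+1)%N)) /= [X in _ = _ + X]big1 ?addr0 //.
  by move=> j jd; rewrite z ?scaler0 //; lia.
by move=> i id; rewrite big1 // => j jd; rewrite z ?scaler0 //; lia.
Qed.

Lemma subst2_eq C C' g h : (forall i j, C i j = C' i j) -> subst2 C g h = subst2 C' g h.
Proof.
move=> e; apply: mps_ext => d /=; apply: eq_bigr => i _; apply: eq_bigr => j _.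
by rewrite e.
Qed.

Lemma subst2_swap C g h : subst2 C g h = subst2 (fun i j => C j i) h g.
Proof.
apply: mps_ext => d; rewrite [LHS]exchange_big; apply: eq_bigr => i _.
apply: eq_bigr => j _.
exact: (congr1 (fun f : mps R I => C j i *: f d) (mulrC (g ^+ j) (h ^+ i))).
Qed.

Lemma subst2_shift C g h : mps_ord 1 g -> mps_ord 1 h ->
  subst2 C g h = subst2 (fun i j => if j == 0%N then C i 0%N else 0) g h +
    h * subst2 (fun i j => C i j.+1) g h.
Proof.
move=> og oh; apply: mps_ext => d.
rewrite mps_addE !(@subst2E _ _ _ d.+2) // mps_mulE /mps_conv.
under [X in _ + X]eq_bigr => k _.
  rewrite (@subst2E _ _ _ d.+1) // ?ltnS ?leq_subr // mulr_sumr.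
  under eq_bigr => i _ do rewrite mulr_sumr.
  over.
rewrite [X in _ = _ + X]exchange_big /=.
have -> : \sum_(i < d.+1) \sum_(k < d.+1) \sum_(j < d.+1)
      h k * (C i j.+1 *: (g ^+ i * h ^+ j) (d - k)%N) =
    \sum_(i < d.+2) \sum_(j < d.+1) C i j.+1 *: (g ^+ i * h ^+ j.+1) d.
  rewrite [RHS]big_ord_recr /= [X in _ = _ + X]big1 ?addr0 => [|j _].
    apply: eq_bigr => i _; rewrite [LHS]exchange_big; apply: eq_bigr => j _.
    rewrite [X in _ = _ *: X](_ : _ = (h * (g ^+ i * h ^+ j)) d); last first.
      by rewrite mulrCA -exprS.
    rewrite mps_mulE /mps_conv scaler_sumr; apply: eq_bigr => k _.
    by rewrite scalerAr.
  have dlt : (d < d.+1 * 1 + j.+1 * 1)%N by rewrite !muln1; lia.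
  have := mps_ordM (mps_ordX (k := d.+1) og) (mps_ordX (k := j.+1) oh) dlt.
  by rewrite mps_mulE => ->; rewrite scaler0.
rewrite -big_split /=; apply: eq_bigr => i _.
rewrite [LHS]big_ord_recl [X in _ = X + _]big_ord_recl [X in _ = _ + X + _]big1 ?addr0 // => j _.
by rewrite scale0r.
Qed.

Lemma subst2_1 g h :
  subst2 (fun i j => if j == 0%N then if i == 0%N then 1 else 0 else 0) g h = 1.
Proof.
apply: mps_ext => d; rewrite [LHS]big_ord_recl [X in X + _]big_ord_recl.
rewrite [X in _ + X + _]big1 => [|j _]; last by rewrite scale0r.
rewrite [X in _ + X]big1 => [|i _]; last first.
  by rewrite big1 // => j _; case: ifP; rewrite scale0r.
by rewrite scale1r !addr0 expr0 expr0 mulr1.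
Qed.

Lemma subst2_0 g h : subst2 (fun _ _ => 0) g h = 0.
Proof. by apply: mps_ext => d /=; rewrite big1 // => i _; rewrite big1 // => j _; rewrite scale0r. Qed.

Lemma subst2_lin (c : nat -> R) g h : mps_ord 1 g -> mps_ord 1 h ->
  subst2 (fun i j => if j == 0%N then c i else 0) g h =
  subst2 (fun i j => if j == 0%N then if i == 0%N then c 0 else 0 else 0) g h +
  g * subst2 (fun i j => if j == 0%N then c i.+1 else 0) g h.
Proof.
move=> og oh; rewrite [LHS]subst2_swap (subst2_shift _ oh og).
rewrite [X in X + _ = _]subst2_swap [X in _ + g * X = _]subst2_swap.
by apply: (congr2 (fun a b => a + g * b)); apply: subst2_eq; case=> [|i] [|j].
Qed.

Variable F : fgl R.

(** Since F(x, 0) = x, every term other than [g] contains a factor [h]. The cofactor is kept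
    explicit so that its constant term can be read off. *)
Lemma subst2_fgl g h : mps_ord 1 g -> mps_ord 1 h ->
  subst2 F g h = g + h * subst2 (fun i j => F i j.+1) g h.
Proof.
move=> og oh; rewrite (subst2_shift _ og oh).
apply: (congr1 (fun a => a + h * subst2 (fun i j => F i j.+1) g h)).
rewrite (subst2_lin (F^~ 0%N) og oh).
rewrite [X in X + _](@subst2_eq _ (fun _ _ => 0)) => [|i j]; last first.
  by case: i j => [|i] [|j]; rewrite ?fgl_x0.
rewrite subst2_0 add0r -[RHS]mulr1 -(subst2_1 g h).
by apply: (congr1 (fun a => g * a)); apply: subst2_eq; case=> [|i] [|j]; rewrite ?fgl_x0.
Qed.

(** The constant term of the cofactor is the coefficient of y in F(0, y) = y. *)
Lemma subst2_fgl1 g h : mps_ord 1 g -> mps_ord 1 h -> exists k k',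
  subst2 (fun i j => F i j.+1) g h = 1 + g * k + h * k'.
Proof.
move=> og oh; rewrite (subst2_shift _ og oh) (subst2_lin (F^~ 1%N) og oh).
have -> : subst2 (fun i j => if j == 0%N then if i == 0%N then F 0%N 1%N else 0 else 0) g h = 1.
  rewrite -(subst2_1 g h); apply: subst2_eq; case=> [|i] [|j];
  by rewrite ?fgl_0x.
by do 2!eexists.
Qed.

End Subst2.

(** * Functoriality of the formal group algebra in the lattice *)

Section FgaHom.
Variables (R : comNzRingType) (F : fgl R) (M L : zmodType).

(** Source and target lattice may differ because universal elements will live over the auxiliary
    lattices [int] and [L * int] and be specialised to [L]. *)
Definition fga_hom (phi : M -> L) (s : fga F M) : fga F L :=
  fga_pi F (mps_ren phi (generic_quotient.repr s)).

Variable phi : {additive M -> L}.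

Lemma fga_ideal_ren_hom f : fga_ideal F f -> fga_ideal F (mps_ren phi f).
Proof.
move=> /asboolP hf; apply/asboolP => n; have [g Jg eg] := hf n.
exists (mps_ren phi g); last by move=> d dn /=; rewrite eg.
elim: Jg => [|a k f' Gk _ IH]; first by rewrite rmorph0; constructor.
rewrite rmorphD rmorphM; constructor => //.
case: Gk => [->|[l [m ->]]]; first by left; rewrite [LHS]mps_renX raddf0.
right; exists (phi l), (phi m).
by rewrite rmorphB [X in _ - X]mps_ren_subst2 !mps_renX [X in X - _]mps_renX raddfD.
Qed.

Lemma fga_homE f : fga_hom phi (fga_pi F f) = fga_pi F (mps_ren phi f).
Proof.
apply/fga_pi_eq; rewrite -rmorphB; apply: fga_ideal_ren_hom.
by apply/fga_pi_eq; rewrite /fga_pi reprK.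
Qed.

Lemma fga_hom_x l : fga_hom phi (fga_x F l) = fga_x F (phi l).
Proof. by rewrite /fga_x fga_homE mps_renX. Qed.

Lemma fga_hom_zmod : zmod_morphism (fga_hom phi).
Proof.
move=> s t; have [f ->] := fga_pi_surj s; have [g ->] := fga_pi_surj t.
by rewrite -rmorphB !fga_homE !rmorphB.
Qed.
Lemma fga_hom_monoid : monoid_morphism (fga_hom phi).
Proof.
split=> [|s t]; first by rewrite -(rmorph1 (@fga_pi R F M)) fga_homE !rmorph1.
have [f ->] := fga_pi_surj s; have [g ->] := fga_pi_surj t.
by rewrite -rmorphM !fga_homE !rmorphM.
Qed.
HB.instance Definition _ :=
  GRing.isZmodMorphism.Build (fga F M) (fga F L) (fga_hom phi) fga_hom_zmod.
HB.instance Definition _ :=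
  GRing.isMonoidMorphism.Build (fga F M) (fga F L) (fga_hom phi) fga_hom_monoid.

Lemma fga_homM s t : fga_hom phi (s * t) = fga_hom phi s * fga_hom phi t.
Proof. exact: rmorphM. Qed.
Lemma fga_homB s t : fga_hom phi (s - t) = fga_hom phi s - fga_hom phi t.
Proof. exact: rmorphB. Qed.

End FgaHom.

Lemma fga_hom_comp (R : comNzRingType) (F : fgl R) (M L N : zmodType)
    (psi : {additive L -> N}) (phi : {additive M -> L}) (s : fga F M) :
  fga_hom (psi \o phi) s = fga_hom psi (fga_hom phi s).
Proof.
have [f ->] := fga_pi_surj s.
rewrite -[LHS]/(fga_hom (psi \o phi : {additive M -> N}) _) !fga_homE.
by rewrite mps_ren_comp.
Qed.

Lemma eq_fga_hom (R : comNzRingType) (F : fgl R) (M L : zmodType)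
    (phi psi : M -> L) (s : fga F M) : phi =1 psi -> fga_hom phi s = fga_hom psi s.
Proof. by move=> /funext ->. Qed.

Lemma fga_hom_id (R : comNzRingType) (F : fgl R) (L : zmodType) (s : fga F L) :
  fga_hom id s = s.
Proof. exact: fga_map_id. Qed.

(** * Infinite sums in the defining ideal, and the relation for x_(l + a) *)

Section FgaSeries.
Variables (R : comNzRingType) (F : fgl R) (L : zmodType).
Implicit Types f g : mps R L.

Lemma fga_pi0 f : fga_pi F f = 0 <-> fga_ideal F f.
Proof. by rewrite -(rmorph0 (@fga_pi R F L)) fga_pi_eq subr0. Qed.

(** The ideal is closed, and in a bounded range of degrees the sum agrees with a finite partial
    sum. *)
Lemma fga_ideal_series (t : nat -> mps R L) :
  (forall k, mps_ord k.-1 (t k)) -> (forall k, fga_ideal F (t k)) ->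
  fga_ideal F (mps_series t).
Proof.
move=> ot it; apply/asboolP => n.
have : fga_ideal F (\sum_(k < n.+1) t k).
  by apply/fga_pi0; rewrite rmorph_sum big1 // => k _; apply/fga_pi0.
move=> /asboolP/(_ n) [g Jg eg]; exists g => // d dn.
by rewrite -eg // mps_sumE (mps_seriesE (n := n.+1)).
Qed.

Lemma fga_x0 : fga_x F 0 = 0 :> fga F L.
Proof.
apply/fga_pi0; apply/asboolP => n; eexists => //.
rewrite -[X in ideal_gen _ X]mul1r -[X in ideal_gen _ X]addr0.
by constructor; [left|constructor].
Qed.

(** The shape of the cofactor matters for l = -a, where it makes x_(-a) / x_a congruent to -1 modulo
    x_a. *)
Lemma fga_x_step l a : exists (g : mps R L) k k',
  fga_pi F g = 1 + fga_x F l * k + fga_x F a * k' /\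
  fga_x F (l + a) - fga_x F l = fga_x F a * fga_pi F g.
Proof.
have [ol oa] := (mpsX_ord R l, mpsX_ord R a).
exists (subst2 (fun i j => F i j.+1) (mpsX R l) (mpsX R a)).
have [k [k' e]] := subst2_fgl1 F ol oa.
exists (fga_pi F k), (fga_pi F k'); split.
  by rewrite e !rmorphD !rmorphM rmorph1.
rewrite -[RHS]rmorphM -[LHS]rmorphB; apply/fga_pi_eq.
rewrite -addrA -opprD -(subst2_fgl F ol oa).
apply/asboolP => n; eexists => //; rewrite -[X in ideal_gen _ X]mul1r -[X in ideal_gen _ X]addr0.
by constructor; [right; exists l, a|constructor].
Qed.

End FgaSeries.

(** * Expansion of a series into monomials *)

Section Monomials.
Variables (R : comNzRingType) (M L : choiceType) (r : M -> L).

Definition mps_pure d (p : {malg R[{cmonom L}]}) (f : mps R L) :=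
  forall e, f e = if e == d then p else 0.

Lemma mps_pure_ord d p f : mps_pure d p f -> mps_ord d f.
Proof. by move=> h e ed; rewrite h; case: eqP => // ee; rewrite ee ltnn in ed. Qed.

Lemma mps_pure1 : mps_pure 0 1 1. Proof. by []. Qed.

Lemma mps_pureX i : mps_pure 1 (mkmalgU (ucm i) 1) (mpsX R i).
Proof. by []. Qed.

Lemma mps_pureM d e p q f g :
  mps_pure d p f -> mps_pure e q g -> mps_pure (d + e) (p * q) (f * g).
Proof.
move=> hf hg k; rewrite mps_mulE /mps_conv.
have [kd|dk] := ltnP k d.
  rewrite big1 => [|i _]; first by case: eqP => // ek; lia.
  rewrite hf; case: eqP => [ei|_]; last by rewrite mul0r.
  by have := ltn_ord i; rewrite ei; lia.
have dk1 : (d < k.+1)%N by [].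
rewrite (bigD1 (Ordinal dk1)) //= big1 ?addr0 => [|i /negP ni].
  have ke : (k - d == e)%N = (k == d + e)%N by lia.
  by rewrite hf eqxx hg ke; case: ifP => _; rewrite ?mulr0.
rewrite hf; case: eqP => [ei|_]; last by rewrite mul0r.
by case: ni; apply/eqP/val_inj.
Qed.

Lemma mps_pureXn i k : mps_pure k (mkmalgU (ucm i) 1 ^+ k) (mpsX R i ^+ k).
Proof.
elim: k => [|k IH]; first exact: mps_pure1.
rewrite !exprS; have := mps_pureM (mps_pureX i) IH; exact.
Qed.

Definition mps_monom (m : {cmonom M}) : mps R L :=
  \prod_(i <- finsupp m) mpsX R (r i) ^+ m i.

Lemma mps_monom_pure m : mps_pure (mdeg m) (cm_ren R r m) (mps_monom m).
Proof.
rewrite /mps_monom /cm_ren mdegE; elim/big_rec3: _ => [|i p d f _ h].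
  exact: mps_pure1.
exact: mps_pureM (mps_pureXn (r i) (m i)) h.
Qed.

End Monomials.

Section MonomialExpansion.
Variables (R : comNzRingType) (M : choiceType).

(** The degree [d] part of the image of [f], kept as a polynomial in the series [mpsX R (r i)]: in
    this form the images under two renamings can be compared one variable at a time. *)
Definition mps_part (L : choiceType) (r : M -> L) (f : mps R M) d : mps R L :=
  \sum_(m <- msupp (f d)) mpsC L (mcoeff m (f d)) * mps_monom R r m.

Lemma mps_part_ord (L : choiceType) (r : M -> L) f d : mps_ord d (mps_part r f d).
Proof.
move=> e ed; rewrite /mps_part mps_sumE big_seq big1 // => m mf.
rewrite mpsCM (mps_pure_ord (@mps_monom_pure R _ _ r m)) ?scaler0 //.
by rewrite (mcomp_homog f d m mf).
Qed.

Lemma mps_partE (L : choiceType) (r : M -> L) f d :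
  mps_part r f d d = \sum_(m <- msupp (f d)) mcoeff m (f d) *: cm_ren R r m.
Proof.
rewrite /mps_part mps_sumE big_seq [RHS]big_seq; apply: eq_bigr => m mf.
by rewrite mpsCM mps_monom_pure (mcomp_homog f d m mf) eqxx.
Qed.

Lemma mps_part_ne (L : choiceType) (r : M -> L) f d e : e != d ->
  mps_part r f d e = 0.
Proof.
move=> /negPf ed; rewrite /mps_part mps_sumE big_seq big1 // => m mf.
by rewrite mpsCM mps_monom_pure (mcomp_homog f d m mf) ed scaler0.
Qed.

Lemma mps_ren_series (L : choiceType) (r : M -> L) f :
  mps_ren r f = mps_series (mps_part r f).
Proof.
apply: mps_ext => d.
rewrite (mps_seriesE (n := d.+2)) //; last first.
  by move=> k; apply: mps_ord_le (@mps_part_ord _ r f k); apply: leq_pred.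
have dn : (d < d.+2)%N by [].
rewrite [RHS](bigD1 (Ordinal dn)) //=  [X in _ = _ + X]big1 ?addr0 => [|k /negP kd].
  rewrite mps_partE /= /poly_ren mmapE; apply: eq_bigr => m _.
  by rewrite mul_malgC.
by apply: mps_part_ne; apply/eqP => e; case: kd; apply/eqP/val_inj.
Qed.

End MonomialExpansion.

(** * Divisibility of differences by x_a *)

Section Divisibility.
Variables (R : comNzRingType) (F : fgl R) (L : zmodType).
Notation x := (fga_x F).

Lemma fga_x_addn (l a : L) k : exists t, x (l + a *+ k) - x l = x a * t.
Proof.
elim: k => [|k [t IH]]; first by exists 0; rewrite mulr0n addr0 subrr mulr0.
have [g [_ [_ [_ h]]]] := fga_x_step F (l + a *+ k) a.
exists (fga_pi F g + t); rewrite mulrDr -IH -[fga_x F a * _]h mulrSr addrA.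
by rewrite [RHS]addrA subrK.
Qed.

Lemma fga_x_addz (l a : L) (k : int) : exists t, x (l + a *~ k) - x l = x a * t.
Proof.
case: (intP k) => [|n|n]; first by have [t] := fga_x_addn l a 0; exists t.
  by have [t] := fga_x_addn l a n.+1; exists t.
have [t h] := fga_x_addn (l + a *~ - n.+1%:Z) a n.+1; exists (- t).
by rewrite mulrN -h opprB mulrNz -pmulrn subrK.
Qed.

Variables (M : zmodType) (phi psi : {additive M -> L}) (a : L).
Hypothesis phi_psi : forall m, exists k : int, psi m = phi m + a *~ k.

(** The orders are carried along because the quotients found in the various degrees must be summed
    to one series at the end. *)
Let fdiv n (f1 f2 : mps R L) := [/\ mps_ord n f1, mps_ord n f2 &
  exists2 g, mps_ord n.-1 g & fga_pi F f1 - fga_pi F f2 = x a * fga_pi F g].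

Let fdivM n m f1 f2 g1 g2 : fdiv n f1 f2 -> fdiv m g1 g2 ->
  fdiv (n + m) (f1 * g1) (f2 * g2).
Proof.
move=> [of1 of2 [gf ogf ef]] [og1 og2 [gg ogg eg]].
split; [exact: mps_ordM|exact: mps_ordM|].
(* f1 g1 - f2 g2 = (f1 - f2) g1 + f2 (g1 - g2). *)
exists (gf * g1 + f2 * gg).
  apply: mps_ordD; first by apply: mps_ord_le (mps_ordM ogf og1); lia.
  by apply: mps_ord_le (mps_ordM of2 ogg); lia.
rewrite rmorphD !rmorphM mulrDr mulrA -ef mulrCA -eg.
by rewrite mulrBl mulrBr addrA subrK.
Qed.

Let fdivX m : fdiv 1 (mpsX R (psi m)) (mpsX R (phi m)).
Proof.
split; [exact: mpsX_ord|exact: mpsX_ord|].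
have [k ->] := phi_psi m; have [t h] := fga_x_addz (phi m) a k.
by have [g e] := fga_pi_surj t; exists g => //; rewrite -e -h.
Qed.

Let fdivXn m k : fdiv k (mpsX R (psi m) ^+ k) (mpsX R (phi m) ^+ k).
Proof.
elim: k => [|k IH]; last by rewrite !exprS -add1n; apply: fdivM.
by split=> //; exists 0 => //; rewrite !expr0 subrr rmorph0 mulr0.
Qed.

Let fdiv_monom m : fdiv (mdeg m) (mps_monom R psi m) (mps_monom R phi m).
Proof.
rewrite /mps_monom mdegE; elim/big_rec3: _ => [|i f d g _ h]; last exact: fdivM.
by split=> //; exists 0 => //; rewrite subrr rmorph0 mulr0.
Qed.

Let fdiv_part f d : fdiv d (mps_part psi f d) (mps_part phi f d).
Proof.
split; [exact: mps_part_ord|exact: mps_part_ord|].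
rewrite /mps_part big_seq_cond [X in _ - fga_pi F X]big_seq_cond.
elim/big_rec2: _ => [|m f1 f2 /andP[mf _] [g og eg]].
  by exists 0 => //; rewrite subrr rmorph0 mulr0.
have := fdiv_monom m; rewrite (mcomp_homog f d m mf) => -[_ _ [h oh eh]].
exists (mpsC L (mcoeff m (f d)) * h + g).
  by apply: mps_ordD => // e ed; rewrite mpsCM oh // scaler0.
rewrite !rmorphD !rmorphM /= mulrDr -eg mulrCA -eh.
by rewrite mulrBr opprD addrACA.
Qed.

(** Modulo [x a] the generators [x (psi m)] and [x (phi m)] agree, hence so do all monomials. With
    [psi] the identity and [phi] a reflection this is the integrality of the Demazure operators. *)
Lemma fga_hom_div (s : fga F M) : exists t, fga_hom psi s - fga_hom phi s = x a * t.
Proof.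
have [f ->] := fga_pi_surj s; rewrite !fga_homE.
have /choice[g gP] : forall d, exists g, mps_ord d.-1 g /\
    fga_pi F (mps_part psi f d) - fga_pi F (mps_part phi f d) = x a * fga_pi F g.
  by move=> d; have [_ _ [g og eg]] := fdiv_part f d; exists g.
exists (fga_pi F (mps_series g)); apply/eqP; rewrite -subr_eq0; apply/eqP.
transitivity (fga_pi F (mps_ren psi f - mps_ren phi f - mpsX R a * mps_series g)).
  by rewrite [RHS]rmorphB [X in _ = X - _]rmorphB [X in _ = _ - X]rmorphM.
apply/fga_pi0.
(* The quotient algebra has no infinite sums, so the identity is lifted to series: the error in each
   degree lies in the ideal, and so does the sum of the errors. *)
pose t d := mps_part psi f d - mps_part phi f d - mpsX R a * g d.
have ot k : mps_ord k.-1 (t k).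
  have k1 : (k.-1 <= k)%N by apply: leq_pred.
  apply: mps_ordD; first apply: mps_ordD.
  - exact: mps_ord_le (@mps_part_ord _ _ _ psi f k).
  - by apply: mps_ordN; exact: mps_ord_le (@mps_part_ord _ _ _ phi f k).
  - apply: mps_ordN; apply: mps_ord_le (mps_ordM (mpsX_ord _ a) (gP k).1).
    by rewrite add1n.
have -> : mps_ren psi f - mps_ren phi f - mpsX R a * mps_series g = mps_series t.
  rewrite !mps_ren_series; apply: mps_ext => d.
  rewrite -[LHS]/(mps_series (mps_part psi f) d - mps_series (mps_part phi f) d -
    (mpsX R a * mps_series g) d).
  have -> : (mpsX R a * mps_series g) d = \sum_(k < d.+2) (mpsX R a * g k) d.
    case: d => [|d]; first by rewrite mpsXM big1 // => k _; rewrite mpsXM.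
    rewrite mpsXM (mps_seriesE (n := d.+3)) //; last by move=> k; exact: (gP k).1.
    by rewrite mulr_sumr; apply: eq_bigr => k _; rewrite mpsXM.
  by rewrite -!sumrB.
apply: fga_ideal_series => // k; apply/fga_pi0.
by rewrite !rmorphB rmorphM (gP k).2 subrr.
Qed.

End Divisibility.

(** * The ratio of x_(-a) to x_a *)

Section OppositeUnit.
Variables (R : comNzRingType) (F : fgl R) (L : zmodType).
Notation x := (fga_x F).

Definition zmultiple (a : L) (k : int) : L := a *~ k.
Lemma zmultiple_zmod a : zmod_morphism (zmultiple a).
Proof. by move=> k l; rewrite /zmultiple mulrzBr. Qed.
HB.instance Definition _ a :=
  GRing.isZmodMorphism.Build int L (zmultiple a) (zmultiple_zmod a).

Lemma fga_xN_div (M : zmodType) (a : M) : exists u, x (- a) = x a * u.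
Proof.
by have [u] := fga_x_addz F 0 a (-1); rewrite add0r mulrN1z fga_x0 subr0; exists u.
Qed.

(* The power series [[-1]_F(t) / t] evaluated at [x a]. *)
Definition xN_ratio (a : L) : fga F L :=
  fga_hom (zmultiple a) (sval (cid (fga_xN_div (1 : int)))).

Lemma xN_ratioE a : x (- a) = x a * xN_ratio a.
Proof.
rewrite /xN_ratio; case: (cid _) => u /= e.
have := congr1 (fga_hom (zmultiple a)) e.
have E k : fga_hom (zmultiple a) (x k) = x (a *~ k) by exact: fga_hom_x.
by rewrite fga_homM !E mulrNz mulr1z.
Qed.

(** All ratios are images of one element over the lattice [int], and its specialisations at [l + a]
    and at [l] differ by multiples of [a]. *)
Lemma xN_ratioD l a : exists t, xN_ratio (l + a) = xN_ratio l + x a * t.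
Proof.
have [k|t e] := @fga_hom_div R F L int (zmultiple l) (zmultiple (l + a)) a _
  (sval (cid (fga_xN_div (1 : int)))).
  by exists k; rewrite /= /zmultiple mulrzDl.
by exists t; rewrite -e [RHS]addrC subrK.
Qed.

Definition x_regular (a : L) := forall s : fga F L, x a * s = 0 -> s = 0.

Lemma x_regularP a s t : x_regular a -> x a * s = x a * t -> s = t.
Proof.
by move=> ra e; apply/eqP; rewrite -subr_eq0; apply/eqP/ra; rewrite mulrBr e subrr.
Qed.

Variable a : L.
Hypothesis ra : x_regular a.

Lemma xN_ratioN : xN_ratio a * xN_ratio (- a) = 1.
Proof.
apply: (x_regularP ra); rewrite mulrA -xN_ratioE -xN_ratioE.
by rewrite opprK mulr1.
Qed.

(** The relation for -a + a = 0 reads 0 = x_(-a) + x_a g with g congruent to 1 modulo x_a.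
    Cancelling x_a shows that the ratio is -g. *)
Lemma xN_ratio_div : exists t, xN_ratio a = x a * t - 1.
Proof.
have [g [k [k' [eg]]]] := fga_x_step F (- a) a.
rewrite addNr fga_x0 sub0r eg !xN_ratioE -mulrN => /(x_regularP ra) h.
exists (- (xN_ratio a * k + k')); rewrite -[LHS]opprK h.
by ring.
Qed.

(** Modulo [x a] the first ratio is -1, and c agrees with -b up to [a], so the other two ratios are
    inverse to each other. The identity serves the extra factor in type G_2. *)
Lemma xN_ratio3 b c : x_regular b -> a + b + c = 0 ->
  exists t, 1 + xN_ratio a * xN_ratio b * xN_ratio c = x a * t.
Proof.
move=> rb abc; have [t et] := xN_ratioD (- b) (- a).
have -> : c = - b - a by apply: (addrI (a + b)); rewrite abc addrA addrK subrr.
have [p ep] := xN_ratio_div.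
rewrite et xN_ratioE; exists (p * (1 + xN_ratio b * (x a * xN_ratio a * t)) -
  xN_ratio b * (xN_ratio a * t)).
have : xN_ratio b * xN_ratio (- b) = 1.
  apply: (x_regularP rb); rewrite mulrA -xN_ratioE -xN_ratioE.
  by rewrite opprK mulr1.
rewrite -mulrA mulrDr => ->; rewrite {1}ep; ring.
Qed.

End OppositeUnit.

(** * The Weyl group action and the invariant form *)

Section InvariantForm.
Variables (L : zmodType) (rd : rootDatum L).
Notation W := (weyl rd).
Notation roots := (rd_roots rd).
Notation act := (@weyl_act_root L rd).

Lemma weyl_act_rootE (w : W) (a : roots) : val (act w a) = w (val a).
Proof. by []. Qed.

Lemma weylMx (v w : W) l : weyl_fun (v * w)%g l = v (w l). Proof. by []. Qed.

Lemma act1 a : act 1%g a = a. Proof. exact: val_inj. Qed.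
Lemma actM v w a : act (v * w)%g a = act v (act w a). Proof. exact: val_inj. Qed.
Lemma actK w : cancel (act w) (act w^-1%g).
Proof. by move=> a; rewrite -actM mulVg act1. Qed.
Lemma actVK w : cancel (act w^-1%g) (act w).
Proof. by move=> a; rewrite -actM mulgV act1. Qed.
Lemma act_inj w : injective (act w). Proof. exact: can_inj (actK w). Qed.

Lemma weyl_reflE (a : roots) l : weyl_refl a l = l - val a *~ coroot a l.
Proof. by []. Qed.

Lemma weyl_refl_root (a : roots) : weyl_refl a (val a) = - val a.
Proof.
by rewrite weyl_reflE rd_coroot2 (mulrzDr (val a) 1 1) mulr1z opprD addrA subrr add0r.
Qed.

Lemma weyl_refl2 (a : roots) l : weyl_refl a (weyl_refl a l) = l.
Proof. exact: reflK. Qed.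

Lemma weyl_reflK (a : roots) : (weyl_refl a * weyl_refl a = 1)%g.
Proof. by apply: weyl_ext => l; rewrite weylMx; exact: reflK. Qed.

Lemma weyl_reflV (a : roots) : ((weyl_refl a)^-1 = weyl_refl a)%g.
Proof. by apply/eqP; rewrite eq_invg_mul weyl_reflK. Qed.

Lemma weyl_refl_ind (P : W -> Prop) :
  P 1%g -> (forall a w, P w -> P (weyl_refl a * w)%g) -> forall w, P w.
Proof.
move=> P1 PM w; have [s es] := weyl_wordP w.
elim: s w es => [|a s IH] w es.
  by have -> : w = 1%g; [apply: weyl_ext => l; rewrite es|].
have h : in_weyl rd (refl_word s) by apply/asboolP; exists s.
have -> : w = (weyl_refl a * (exist (in_weyl rd) _ h : W))%g.
  by apply: weyl_ext => l; rewrite es.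
by apply: PM; apply: IH.
Qed.

Definition opp_root (a : roots) : roots := act (weyl_refl a) a.
Lemma opp_rootE a : val (opp_root a) = - val a.
Proof. exact: weyl_refl_root. Qed.
Lemma opp_rootK : involutive opp_root.
Proof. by move=> a; apply: val_inj; rewrite !opp_rootE opprK. Qed.
Lemma act_opp w a : act w (opp_root a) = opp_root (act w a).
Proof. by apply: val_inj; rewrite weyl_act_rootE !opp_rootE raddfN. Qed.

(** The canonical Weyl-invariant form of the root datum, kept integral. *)
Definition root_form (x y : L) : int := \sum_(a : roots) coroot a x * coroot a y.
Notation frm := root_form.

Lemma root_formC x y : frm x y = frm y x.
Proof. by apply: eq_bigr => a _; rewrite mulrC. Qed.
Lemma root_formDl x y z : frm (x + y) z = frm x z + frm y z.
Proof. by rewrite -big_split; apply: eq_bigr => a _; rewrite raddfD mulrDl. Qed.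
Lemma root_formBl x y z : frm (x - y) z = frm x z - frm y z.
Proof. by rewrite -sumrB; apply: eq_bigr => a _; rewrite raddfB mulrBl. Qed.
Lemma root_formMzl x y k : frm (x *~ k) y = k * frm x y.
Proof.
rewrite mulr_sumr; apply: eq_bigr => a _.
by rewrite raddfMz mulrzz [_ * k]mulrC mulrA.
Qed.
Lemma root_form_suml (I : Type) (r : seq I) (P : pred I) (G : I -> L) y :
  frm (\sum_(i <- r | P i) G i) y = \sum_(i <- r | P i) frm (G i) y.
Proof.
elim/big_rec2: _ => [|i z x _ <-]; last exact: root_formDl.
by rewrite /frm big1 // => a _; rewrite raddf0 mul0r.
Qed.

(** By [rd_refl_coroot] a reflection carries coroots to coroots; being an involution, it permutes
    the summands. *)
Lemma root_form_refl (b : roots) x y :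
  frm (weyl_refl b x) (weyl_refl b y) = frm x y.
Proof.
have /choice[tau tauP] : forall a : roots, exists c : roots,
    forall l, coroot c l = coroot a (weyl_refl b l).
  move=> a; have [c hc] := rd_refl_coroot b a; exists c => l.
  by rewrite hc weyl_reflE raddfB raddfMz mulrzz.
have tauK : involutive tau.
  by move=> a; apply: rd_coroot_inj => l; rewrite !tauP weyl_refl2.
rewrite [RHS](reindex_inj (inv_inj tauK)).
by apply: eq_bigr => a _; rewrite !tauP.
Qed.

Lemma root_form_ge0 x : 0 <= frm x x.
Proof. by apply: sumr_ge0 => a _; exact: sqr_ge0. Qed.

Lemma root_form_gt0 (b : roots) : 0 < frm (val b) (val b).
Proof.
rewrite /frm (bigD1 b) //=; apply: ltr_wpDr; last by rewrite rd_coroot2.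
by apply: sumr_ge0 => a _; exact: sqr_ge0.
Qed.

Lemma root_form_coroot (b : roots) x :
  frm (val b) (val b) * coroot b x = 2 * frm x (val b).
Proof.
have := root_form_refl b x (val b); rewrite weyl_refl_root.
rewrite root_formC -mulrN1z root_formMzl mulN1r root_formC weyl_reflE.
rewrite root_formBl root_formMzl opprB => /eqP; rewrite subr_eq => /eqP.
by rewrite mulrC => ->; rewrite mulrDl mul1r.
Qed.

(** The axiom on reflected coroots does not name the root to which the new coroot belongs. The form
    does, since [root_form_coroot] expresses a coroot through its root. *)
Lemma coroot_act_refl (a b : roots) x :
  coroot (act (weyl_refl a) b) x = coroot b (weyl_refl a x).
Proof.
have n0 : frm (val b) (val b) != 0 by rewrite gt_eqF ?root_form_gt0.
apply: (mulfI n0); rewrite root_form_coroot -(root_form_refl a).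
rewrite -weyl_act_rootE root_form_coroot -(root_form_refl a (weyl_refl a x)).
by rewrite weyl_refl2.
Qed.

Lemma coroot_act (w : W) (b : roots) x : coroot (act w b) (w x) = coroot b x.
Proof.
elim/weyl_refl_ind: w => [|a w IH]; first by rewrite act1.
rewrite actM coroot_act_refl weylMx.
by rewrite weyl_refl2.
Qed.

Lemma weyl_refl_act (w : W) (b : roots) :
  weyl_refl (act w b) = (w * weyl_refl b * w^-1)%g.
Proof.
apply: (mulIg w); rewrite mulgKV; apply: weyl_ext => l; rewrite !weylMx.
by rewrite !weyl_reflE coroot_act weyl_act_rootE raddfB raddfMz.
Qed.

Lemma weyl_refl_opp (a : roots) : weyl_refl (opp_root a) = weyl_refl a.
Proof. by rewrite /opp_root weyl_refl_act mulgK. Qed.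

(** Such an [x] is killed by every coroot, hence fixed by W. A positive multiple of it is a
    combination of roots, and the sum over W kills each root a, because replacing w by w s_a changes
    the sign. The lattice is torsion free. *)
Lemma root_form_eq0 x : frm x x = 0 -> x = 0.
Proof.
move=> /eqP; rewrite psumr_eq0 => [/allP h|a _]; last exact: sqr_ge0.
have {h} h (a : roots) : coroot a x = 0.
  by have := h a (mem_index_enum _); rewrite mulf_eq0 orbb => /eqP.
have fx (w : W) : w x = x.
  elim/weyl_refl_ind: w => [|a w IH] //; rewrite weylMx IH weyl_reflE h.
  by rewrite mulr0z subr0.
have s0 (a : roots) : \sum_(w : W) w (val a) = 0.
  have e : \sum_(w : W) w (val a) = - \sum_(w : W) w (val a).
    rewrite {1}(reindex_inj (mulIg (weyl_refl a))) -sumrN; apply: eq_bigr => w _.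
    by rewrite weylMx weyl_refl_root raddfN.
  by apply: (@rd_torsion_free _ rd _ 2) => //; rewrite mulr2n {1}e addNr.
have [k k0 [c e]] := rd_semisimple rd x.
have kW0 : (0 < k * #|{: W}|)%N by rewrite muln_gt0 k0; apply/card_gt0P; exists 1%g.
apply: (rd_torsion_free rd kW0); rewrite mulrnA.
have -> : x *+ k *+ #|{: W}| = \sum_(w : W) w (x *+ k).
  by rewrite -sumr_const; apply: eq_bigr => w _; rewrite raddfMn /= fx.
rewrite e; under eq_bigr => w _ do rewrite raddf_sum.
rewrite exchange_big big1 // => a _.
under eq_bigr => w _ do rewrite raddfMz.
by rewrite -mulrz_suml s0 mul0rz.
Qed.

End InvariantForm.

(** * Simple roots, inversions, lengths and the exchange condition *)

Section SimpleSystem.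
Variables (L : zmodType) (rd : rootDatum L).
Notation W := (weyl rd).
Notation roots := (rd_roots rd).
Notation act := (@weyl_act_root L rd).
Variables (n : nat) (alpha : 'I_n -> roots).
Hypothesis Halpha : simple_system alpha.
Notation neg := (neg_root alpha).
Notation s := (simple_refl alpha).
Notation word := (wword alpha).

Implicit Types (u v w : W) (I J : seq 'I_n).

Lemma root_coord_subproof (a : roots) :
  exists c : 'I_n -> int, val a = \sum_i val (alpha i) *~ c i.
Proof.
have [c [->|->]] := ss_sign Halpha a; first by exists (fun i => (c i)%:Z).
exists (fun i => - (c i)%:Z); rewrite -sumrN; apply: eq_bigr => i _.
by rewrite mulrNz.
Qed.
Definition root_coord (a : roots) : 'I_n -> int := sval (cid (root_coord_subproof a)).
Notation co := root_coord.

Lemma root_coordE a : val a = \sum_i val (alpha i) *~ co a i.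
Proof. exact: svalP (cid (root_coord_subproof a)). Qed.

Lemma root_coord_uniq a (c : 'I_n -> int) :
  val a = \sum_i val (alpha i) *~ c i -> forall i, co a i = c i.
Proof.
move=> e i; apply/eqP; rewrite -subr_eq0; apply/eqP.
apply: (ss_indep Halpha (c := fun i => co a i - c i)).
under eq_bigr => j _ do rewrite mulrzBr.
by rewrite sumrB -root_coordE -e subrr.
Qed.

Lemma root_coord_neq0 (a : roots) : exists i, co a i != 0.
Proof.
apply/existsP; rewrite -[X in is_true X]negbK negb_exists; apply/negP => /forallP h.
have := root_form_gt0 a; rewrite {1}root_coordE root_form_suml big1 ?ltxx // => i _.
by have := h i; rewrite negbK => /eqP ->; rewrite root_formMzl mul0r.
Qed.

Lemma root_coord_sign a : (forall i, 0 <= co a i) \/ (forall i, co a i <= 0).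
Proof.
have [c [e|e]] := ss_sign Halpha a; [left|right] => i.
  by rewrite (root_coord_uniq (c := fun i => (c i)%:Z)).
rewrite (root_coord_uniq (c := fun i => - (c i)%:Z)) ?oppr_le0 //.
by rewrite e -sumrN; apply: eq_bigr => j _; rewrite mulrNz.
Qed.

Lemma neg_rootP a : reflect (forall i, co a i <= 0) (neg a).
Proof.
rewrite /neg_root; apply: (iffP (asboolP _)) => [[c e] i|h].
  rewrite (root_coord_uniq (c := fun i => - (c i)%:Z)) ?oppr_le0 //.
  by rewrite e -sumrN; apply: eq_bigr => j _; rewrite mulrNz.
exists (fun i => `|co a i|%N); rewrite {1}root_coordE -sumrN; apply: eq_bigr => i _.
by rewrite pmulrn abszE ler0_norm // mulrNz opprK.
Qed.

Lemma pos_root_gt a i : 0 < co a i -> ~~ neg a.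
Proof. by move=> h; apply/negP => /neg_rootP/(_ i); rewrite leNgt h. Qed.

Lemma pos_rootP a : reflect (forall i, 0 <= co a i) (~~ neg a).
Proof.
apply: (iffP idP) => [na|h].
  by have [//|h] := root_coord_sign a; case/neg_rootP: na.
have [i ni] := root_coord_neq0 a.
by apply: (@pos_root_gt a i); rewrite lt_def ni h.
Qed.

Lemma root_coord_alpha i j : co (alpha i) j = (i == j)%:R.
Proof.
apply: (root_coord_uniq (c := fun j => (i == j)%:R)).
rewrite (bigD1 i) //= eqxx mulr1z big1 ?addr0 // => k /negPf ki.
by rewrite eq_sym ki mulr0z.
Qed.

Lemma pos_alpha i : ~~ neg (alpha i).
Proof. by apply: (@pos_root_gt _ i); rewrite root_coord_alpha eqxx. Qed.

Lemma root_coord_opp a i : co (opp_root a) i = - co a i.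
Proof.
apply: (root_coord_uniq (c := fun i => - co a i)).
rewrite opp_rootE {1}root_coordE -sumrN; apply: eq_bigr => j _.
by rewrite mulrNz.
Qed.

Lemma neg_opp a : neg (opp_root a) = ~~ neg a.
Proof.
apply/neg_rootP/pos_rootP => h i; have := h i; rewrite root_coord_opp ?oppr_le0 //.
Qed.

Lemma root_coord_refl i a j :
  co (act (s i) a) j = co a j - (i == j)%:R * coroot (alpha i) (val a).
Proof.
apply: (root_coord_uniq (c := fun j => co a j - (i == j)%:R * coroot (alpha i) (val a))).
rewrite weyl_act_rootE weyl_reflE {1}root_coordE.
under [RHS]eq_bigr => k _ do rewrite mulrzBr.
rewrite sumrB; congr (_ - _).
rewrite (bigD1 i) //= eqxx mul1r big1 ?addr0 // => k /negPf ki.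
by rewrite eq_sym ki mul0r mulr0z.
Qed.

Lemma pos_simple_refl i a : ~~ neg a -> a != alpha i -> ~~ neg (act (s i) a).
Proof.
move=> pa ai; have [j /andP[/= ji cj]|h] := pickP [pred j | (j != i) && (0 < co a j)].
  apply: (@pos_root_gt _ j); rewrite root_coord_refl eq_sym (negPf ji) mul0r subr0.
  exact: cj.
have {}h j : j != i -> co a j = 0.
  move=> ji; have := h j; rewrite /= ji /= lt_def => /negbT.
  by rewrite negb_and negbK ((pos_rootP a) pa j) orbF => /eqP.
(* The coefficient divides [coroot a (val a)], which is 2, so it is 1 or 2; the value 2 is excluded
   because the datum is reduced. *)
have e : val a = val (alpha i) *~ co a i.
  by rewrite {1}root_coordE (bigD1 i) //= big1 ?addr0 // => j /h ->; rewrite mulr0z.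
have h2 := rd_coroot2 a; rewrite [X in coroot a X]e raddfMz mulrzz in h2.
have c0 : 0 <= co a i by exact: (pos_rootP a).
have [c ec] : exists c : nat, co a i = c by exists `|co a i|%N; rewrite gez0_abs.
have : (c %| 2)%N.
  rewrite -[(c %| 2)%N]/(c%:Z %| 2%:Z)%Z -[X in (_ %| X)%Z]h2 ec.
  by apply/dvdzP; exists (coroot a (val (alpha i))).
have [c1|c2] : c = 1%N \/ c = 2%N \/ (2 < c)%N \/ c = 0%N by lia.
- by case/eqP: ai; apply: val_inj; rewrite e ec c1.
- case: c2 => [c2|[c3|->]]; last by rewrite dvd0n.
    have := rd_reduced (alpha i); rewrite -[val (alpha i) *+ 2]/(val (alpha i) *~ 2%:Z).
    by rewrite -c2 -ec -e (valP a).
  by move=> /dvdn_leq; lia.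
Qed.

Lemma wword_cons i I : word (i :: I) = (s i * word I)%g.
Proof. by rewrite /wword big_cons. Qed.
Lemma wword_cat I J : word (I ++ J) = (word I * word J)%g.
Proof. by rewrite /wword big_cat. Qed.
Lemma wword_nil : word [::] = 1%g. Proof. by rewrite /wword big_nil. Qed.
Lemma simple_reflK i : (s i * s i = 1)%g. Proof. exact: weyl_reflK. Qed.
Lemma simple_reflV i : ((s i)^-1 = s i)%g. Proof. exact: weyl_reflV. Qed.
Lemma simple_reflKl i w : (s i * (s i * w) = w)%g.
Proof. by rewrite mulgA simple_reflK mul1g. Qed.
Lemma wword_rev I : word (rev I) = ((word I)^-1)%g.
Proof.
elim: I => [|j I IH]; first by rewrite wword_nil invg1.
by rewrite rev_cons -cats1 wword_cat IH !wword_cons wword_nil mulg1 invMg simple_reflV.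
Qed.
Lemma act_simpleK i a : act (s i) (act (s i) a) = a.
Proof. by rewrite -actM simple_reflK act1. Qed.
Lemma act_alpha i : act (s i) (alpha i) = opp_root (alpha i). Proof. by []. Qed.

(** These are the inversions of [w^-1]. They index the denominator of the leading coefficient of a
    product along a reduced word of [w]. *)
Definition Phi w : {set roots} := [set b | ~~ neg b && neg (act w^-1%g b)].

Lemma in_Phi w b : (b \in Phi w) = ~~ neg b && neg (act w^-1%g b).
Proof. by rewrite inE. Qed.

Definition inv_count w := #|Phi w|.
Notation len := inv_count.

Lemma act_cons_inv i w b : act (s i * w)^-1%g b = act w^-1%g (act (s i) b).
Proof. by rewrite invMg simple_reflV actM. Qed.

Section PhiCons.
Variables (i : 'I_n) (w : W).
Hypothesis pi : ~~ neg (act w^-1%g (alpha i)).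

Lemma alpha_notin_Phi : alpha i \notin [set act (s i) b | b in Phi w].
Proof.
apply/imsetP => -[b]; rewrite in_Phi => /andP[pb _] e.
have eb : b = opp_root (alpha i) by rewrite -act_alpha e act_simpleK.
by move: pb; rewrite eb neg_opp pos_alpha.
Qed.

Lemma Phi_cons : Phi (s i * w)%g = alpha i |: [set act (s i) b | b in Phi w].
Proof.
apply/setP => b; rewrite in_Phi in_setU1 act_cons_inv.
have -> : (b \in [set act (s i) b | b in Phi w]) = (act (s i) b \in Phi w).
  apply/imsetP/idP => [[c hc ->]|h]; first by rewrite act_simpleK.
  by exists (act (s i) b) => //; rewrite act_simpleK.
rewrite in_Phi; case: eqP => [->|/eqP bi] /=.
  by rewrite pos_alpha act_alpha act_opp neg_opp pi.
have [->|bi'] := eqVneq b (opp_root (alpha i)).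
  by rewrite neg_opp pos_alpha -act_alpha act_simpleK pos_alpha /= (negPf pi).
case nb: (neg b); last by rewrite pos_simple_refl ?nb.
suff -> : neg (act (s i) b) by [].
rewrite -[b]opp_rootK act_opp neg_opp pos_simple_refl ?neg_opp ?nb //.
by apply: contra bi' => /eqP <-; rewrite opp_rootK.
Qed.

Lemma len_cons : len (s i * w)%g = (len w).+1.
Proof. by rewrite /inv_count Phi_cons cardsU1 alpha_notin_Phi card_imset //; exact: act_inj. Qed.

End PhiCons.

Lemma len_desc i w : neg (act w^-1%g (alpha i)) -> (len (s i * w)%g).+1 = len w.
Proof.
move=> h; rewrite -(@len_cons i) ?simple_reflKl // act_cons_inv act_alpha.
by rewrite act_opp neg_opp negbK.
Qed.

Lemma len1 : len 1%g = 0%N.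
Proof.
apply/eqP; rewrite cards_eq0; apply/eqP/setP => b.
by rewrite in_Phi invg1 act1 inE; case: (neg b).
Qed.

Lemma len_cons_le i w : (len (s i * w)%g <= (len w).+1)%N.
Proof.
case h : (neg (act w^-1%g (alpha i))); last by rewrite len_cons ?h.
by rewrite -(len_desc h) ltnW.
Qed.

Lemma len_cons_ge i w : (len w <= (len (s i * w)%g).+1)%N.
Proof. by rewrite -{1}[w](simple_reflKl i); exact: len_cons_le. Qed.

Lemma len_word I : (len (word I) <= size I)%N.
Proof.
elim: I => [|i I IH]; first by rewrite wword_nil len1.
by rewrite wword_cons (leq_trans (len_cons_le _ _)).
Qed.

(** The strong exchange condition. Peeling off letters reflects [b] each time; once it has become
    the simple root of the current letter, that letter is deleted. *)
Lemma exchange I b : b \in Phi (word I) ->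
  exists J, [/\ subseq J I, (size J).+1 = size I & word J = (weyl_refl b * word I)%g].
Proof.
elim: I b => [|i I IH] b.
  by rewrite wword_nil in_Phi invg1 act1; case: (neg b).
rewrite in_Phi wword_cons act_cons_inv => /andP[pb nb].
have [e|bi] := eqVneq b (alpha i).
  by exists I; split; rewrite ?subseq_cons // e mulgA weyl_reflK mul1g.
have [|J [sJ zJ eJ]] := IH (act (s i) b).
  by rewrite in_Phi nb pos_simple_refl.
exists (i :: J); split; rewrite ?wword_cons /= ?eqxx ?zJ // eJ.
by rewrite weyl_refl_act simple_reflV !mulgA simple_reflK mul1g.
Qed.

Lemma reduced_subword I : exists J,
  [/\ subseq J I, size J = len (word I) & word J = word I].
Proof.
elim: I => [|i I [J [sJ zJ eJ]]]; first by exists [::]; rewrite wword_nil len1.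
rewrite wword_cons; case h : (neg (act (word I)^-1%g (alpha i))); last first.
  by exists (i :: J); rewrite len_cons ?h // wword_cons eJ /= eqxx zJ.
have [|K [sK zK eK]] := @exchange J (alpha i); first by rewrite in_Phi pos_alpha eJ h.
exists K; split; last by rewrite eK eJ.
  by apply: subseq_trans (subseq_trans sK sJ) _; exact: subseq_cons.
by apply/succn_inj; rewrite len_desc // zK.
Qed.

Lemma root_simple_conj a : ~~ neg a -> exists I i, a = act (word I) (alpha i).
Proof.
pose ht (b : roots) := `|(\sum_i co b i)%R|%N.
have [k] := ubnP (ht a); elim: k a => // k IH a hk pa.
have [i e|ns] := pickP [pred i | a == alpha i].
  by exists [::], i; rewrite wword_nil act1; apply/eqP.
(* Otherwise [a], a nonnegative combination of simple roots, would have norm at most 0. Reflecting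
   in this simple root lowers the height. *)
have [i ci] : exists i, 0 < coroot (alpha i) (val a).
  apply/existsP; rewrite -[X in is_true X]negbK negb_exists; apply/negP => /forallP h.
  have := root_form_gt0 a; rewrite {1}root_coordE root_form_suml ltNge.
  move=> /negP[]; apply: sumr_le0 => i _; rewrite root_formMzl.
  apply: mulr_ge0_le0; first exact: (pos_rootP a).
  have := h i; rewrite -leNgt => hi.
  rewrite -(pmulr_rle0 _ (ltr0Sn _ 1)) root_formC -root_form_coroot.
  by rewrite pmulr_rle0 ?root_form_gt0.
have pa' : ~~ neg (act (s i) a) by rewrite pos_simple_refl //; have /= -> := ns i.
have [|I [j e]] := IH (act (s i) a) _ pa'; last first.
  by exists (i :: I), j; rewrite wword_cons actM -e act_simpleK.
rewrite ltnS in hk; apply: leq_trans hk; rewrite /ht -ltz_nat !gez0_abs.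
- have -> : \sum_j co (act (s i) a) j = \sum_j co a j - coroot (alpha i) (val a).
    under eq_bigr => j _ do rewrite root_coord_refl.
    rewrite sumrB; congr (_ - _).
    rewrite (bigD1 i) //= eqxx mul1r big1 ?addr0 // => k0 /negPf ki.
    by rewrite eq_sym ki mul0r.
  by rewrite ltrBlDr ltrDl.
- by apply: sumr_ge0 => j _; exact: (pos_rootP a).
- by apply: sumr_ge0 => j _; exact: (pos_rootP _ pa').
Qed.

Lemma word_surj w : exists I, word I = w.
Proof.
elim/weyl_refl_ind: w => [|a w [J <-]]; first by exists [::]; rewrite wword_nil.
wlog pa : a / ~~ neg a.
  move=> H; case h : (neg a); last by apply: H; rewrite h.
  by rewrite -weyl_refl_opp; apply: H; rewrite neg_opp h.
have [I [i ->]] := root_simple_conj pa.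
rewrite weyl_refl_act; exists (I ++ i :: rev I ++ J).
by rewrite wword_cat wword_cons wword_cat wword_rev !mulgA.
Qed.

Lemma reduced_word w : exists2 I, word I = w & size I = len w.
Proof.
have [I <-] := word_surj w; have [J [_ zJ eJ]] := reduced_subword I.
by exists J.
Qed.

Lemma wlenE w : wlen alpha w = len w.
Proof.
have [I eI zI] := reduced_word w.
pose N := #|{: W}|; pose p m := [exists I : m.-tuple 'I_n, word I == w].
have pP m : reflect (exists2 J, word J = w & size J = m) (p m).
  apply: (iffP existsP) => [[t /eqP e]|[J e z]]; first by exists t; rewrite ?size_tuple.
  by exists (tcast z (in_tuple J)); rewrite val_tcast e.
(* [wlen] searches only below the order of the group. The suffixes of a reduced word have distinct
   lengths, which gives [size I + 1] distinct elements. *)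
have lN : (len w < N)%N.
  have wI : (size I < N)%N.
    pose f (k : 'I_(size I).+1) := word (drop k I).
    suff fi : injective f by have := leq_card f fi; rewrite card_ord.
    have lf k : (k <= size I)%N -> len (word (drop k I)) = (size I - k)%N.
      move=> kI; apply/eqP; rewrite eqn_leq; apply/andP; split.
        by rewrite -size_drop; exact: len_word.
      rewrite leq_subLR zI -eI -{1}[I](cat_take_drop k) wword_cat.
      rewrite -[X in (_ <= X + _)%N](size_takel kI).
      elim: (take k I) => [|i J IH]; first by rewrite wword_nil mul1g.
      by rewrite wword_cons -mulgA /= addSn (leq_trans (len_cons_le _ _)).
    move=> k l /(congr1 len); rewrite !lf -1?ltnS // => e; apply: val_inj => /=.
    by have := ltn_ord k; have := ltn_ord l; lia.
  by rewrite -zI.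
have pw : p (len w) by apply/pP; exists I.
have hp : has p (iota 0 N) by apply/hasP; exists (len w); rewrite // mem_iota.
have fN : (find p (iota 0 N) < N)%N by rewrite -[N in (_ < N)%N](size_iota 0) -has_find.
rewrite -[wlen _ _]/(find p (iota 0 N)); apply/eqP; rewrite eqn_leq leqNgt; apply/andP; split.
  by apply/negP => /(before_find 0%N); rewrite nth_iota // pw.
have := nth_find 0%N hp; rewrite nth_iota // add0n => /pP[J <- <-].
exact: len_word.
Qed.

End SimpleSystem.

(** * Parabolic subgroups, their longest elements and minimal coset representatives *)

Section Parabolic.
Variables (L : zmodType) (rd : rootDatum L).
Notation W := (weyl rd).
Notation roots := (rd_roots rd).
Notation act := (@weyl_act_root L rd).
Variables (n : nat) (alpha : 'I_n -> roots).
Hypothesis Halpha : simple_system alpha.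
Notation neg := (neg_root alpha).
Notation s := (simple_refl alpha).
Notation word := (wword alpha).
Notation co := (root_coord Halpha).
Notation Phi := (Phi alpha).
Notation len := (inv_count alpha).

Implicit Types (u v w p y : W) (I J : seq 'I_n).

Lemma lenV w : len w^-1%g = len w.
Proof.
have le v : (len v^-1%g <= len v)%N.
  have [I <- <-] := reduced_word Halpha v.
  by rewrite -wword_rev -[X in (_ <= X)%N]size_rev; exact: len_word.
by apply/eqP; rewrite eqn_leq le /=; have := le w^-1%g; rewrite invgK.
Qed.

Lemma len_eq0 w : len w = 0%N -> w = 1%g.
Proof.
by have [I <- <-] := reduced_word Halpha w => /size0nil ->; rewrite wword_nil.
Qed.

Lemma len_mul_simple w i : ~~ neg (act w (alpha i)) -> len (w * s i)%g = (len w).+1.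
Proof.
move=> h; rewrite -lenV invMg simple_reflV -[RHS]/(len w).+1 -(lenV w).
by apply: len_cons; rewrite // invgK.
Qed.

Lemma len_mul_simple_desc w i : neg (act w (alpha i)) -> (len (w * s i)%g).+1 = len w.
Proof.
move=> h; rewrite -lenV invMg simple_reflV -(lenV w).
by apply: len_desc; rewrite // invgK.
Qed.

Lemma root_coord_act w a k :
  co (act w a) k = \sum_i co a i * co (act w (alpha i)) k.
Proof.
apply: (@root_coord_uniq _ _ _ _ Halpha _ (fun k => \sum_i co a i * co (act w (alpha i)) k)).
rewrite weyl_act_rootE {1}(root_coordE Halpha a) raddf_sum.
transitivity (\sum_i \sum_j val (alpha j) *~ co (act w (alpha i)) j *~ co a i).
  apply: eq_bigr => i _; rewrite raddfMz -mulrz_suml; congr (_ *~ _).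
  exact: root_coordE Halpha (act w (alpha i)).
rewrite exchange_big; apply: eq_bigr => j _; rewrite [RHS]mulrz_sumr.
by apply: eq_bigr => i _; rewrite -mulrzA mulrC.
Qed.

Variable Xi : {set 'I_n}.
Notation WXi := (parabolic alpha Xi).
Notation inXi a := (weyl_refl a \in WXi).

Lemma simple_refl_parabolic i : i \in Xi -> s i \in WXi.
Proof. by move=> iX; apply: mem_gen; apply: imset_f. Qed.

Lemma word_parabolic I : all (mem Xi) I -> word I \in WXi.
Proof.
elim: I => [|i I IH] /=; first by rewrite wword_nil group1.
by move=> /andP[iX /IH h]; rewrite wword_cons groupM // simple_refl_parabolic.
Qed.

Lemma all_subseq (I J : seq 'I_n) : subseq J I -> all (mem Xi) I -> all (mem Xi) J.
Proof. by move=> /mem_subseq sJ /allP h; apply/allP => i /sJ /h. Qed.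

Lemma parabolic_word w : w \in WXi -> exists I,
  [/\ all (mem Xi) I, word I = w & size I = len w].
Proof.
move=> wX; suff [I aI <-] : exists2 I, all (mem Xi) I & word I = w.
  have [J [sJ zJ eJ]] := reduced_subword Halpha I.
  by exists J; split; rewrite ?eJ //; exact: all_subseq aI.
have /gen_prodgP[m [c cX ->]] := wX.
have /choice[j jP] : forall i, exists j, j \in Xi /\ c i = s j.
  by move=> i; have /imsetP[j jX ->] := cX i; exists j.
exists [seq j i | i <- index_enum 'I_m].
  by apply/allP => _ /mapP[i _ ->]; exact: (jP i).1.
by rewrite /wword big_map; apply: eq_bigr => i _; rewrite (jP i).2.
Qed.

Lemma root_coord_parabolic w a k : w \in WXi -> k \notin Xi -> co (act w a) k = co a k.
Proof.
move=> /parabolic_word[I [aI <- _]] kX; elim: I aI => [|i I IH] /=.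
  by rewrite wword_nil act1.
move=> /andP[iX /IH e]; rewrite wword_cons actM root_coord_refl e.
by case: eqP => [ik|_]; [rewrite -ik iX in kX|rewrite mul0r subr0].
Qed.

(** Elements of [WXi] leave the coordinates outside [Xi] unchanged, while the reflection in [a]
    negates all coordinates of [a]. *)
Lemma root_coord_inXi a k : inXi a -> k \notin Xi -> co a k = 0.
Proof.
move=> aX kX; have := root_coord_parabolic a aX kX.
rewrite -[act _ a]/(opp_root a) root_coord_opp; lia.
Qed.

Lemma inXi_alpha i : i \in Xi -> inXi (alpha i).
Proof. exact: simple_refl_parabolic. Qed.

Lemma inXi_act w a : w \in WXi -> inXi (act w a) = inXi a.
Proof. by move=> wX; rewrite weyl_refl_act -{2}[w]invgK groupMr ?groupV // groupMl. Qed.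

Lemma inXi_opp a : inXi (opp_root a) = inXi a.
Proof. by rewrite weyl_refl_opp. Qed.

Definition pos_par : {set roots} := [set a | ~~ neg a && inXi a].
Notation PXi := pos_par.

Lemma in_pos_par a : (a \in PXi) = ~~ neg a && inXi a. Proof. by rewrite inE. Qed.

Lemma alpha_pos_par i : i \in Xi -> alpha i \in PXi.
Proof. by move=> iX; rewrite in_pos_par (pos_alpha Halpha) inXi_alpha. Qed.

Lemma pos_par_neg v a : (forall i, i \in Xi -> neg (act v (alpha i))) ->
  a \in PXi -> neg (act v a).
Proof.
move=> h; rewrite in_pos_par => /andP[/(pos_rootP Halpha) pa aX].
apply/(neg_rootP Halpha) => k; rewrite root_coord_act; apply: sumr_le0 => i _.
have [iX|iX] := boolP (i \in Xi); last by rewrite (root_coord_inXi aX iX) mul0r.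
by apply: mulr_ge0_le0 => //; apply/(neg_rootP Halpha)/h.
Qed.

Lemma pos_par_pos v a : (forall i, i \in Xi -> ~~ neg (act v (alpha i))) ->
  a \in PXi -> ~~ neg (act v a).
Proof.
move=> h; rewrite in_pos_par => /andP[/(pos_rootP Halpha) pa aX].
apply/(pos_rootP Halpha) => k; rewrite root_coord_act; apply: sumr_ge0 => i _.
have [iX|iX] := boolP (i \in Xi); last by rewrite (root_coord_inXi aX iX) mul0r.
by apply: mulr_ge0 => //; apply/(pos_rootP Halpha)/h.
Qed.

(** The exchange condition writes the reflection in an inversion as a quotient of two words with
    letters in [Xi]. *)
Lemma Phi_par w : w \in WXi -> Phi w \subset PXi.
Proof.
move=> wX; apply/subsetP => b bP; rewrite in_pos_par.
move: (bP); rewrite in_Phi => /andP[-> _] /=.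
have [I [aI eI _]] := parabolic_word wX; rewrite -eI in bP.
have [J [sJ _ eJ]] := exchange Halpha bP.
have -> : weyl_refl b = (word J * (word I)^-1)%g by rewrite eJ mulgK.
by rewrite groupM ?groupV ?word_parabolic // (all_subseq sJ).
Qed.

Definition wlong : W := [arg max_(w > 1%g in WXi) len w].

Lemma wlong_par : wlong \in WXi.
Proof. by rewrite /wlong; case: arg_maxnP; rewrite ?group1. Qed.

Lemma wlong_max w : w \in WXi -> (len w <= len wlong)%N.
Proof. by rewrite /wlong; case: arg_maxnP; rewrite ?group1 // => v _ h /h. Qed.

Lemma wlongV_neg i : i \in Xi -> neg (act wlong^-1%g (alpha i)).
Proof.
move=> iX; apply/negPn/negP => h.
have := wlong_max (groupM (simple_refl_parabolic iX) wlong_par).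
by rewrite len_cons // ltnn.
Qed.

Lemma wlong_neg i : i \in Xi -> neg (act wlong (alpha i)).
Proof.
move=> iX; apply/negPn/negP => h.
have := wlong_max (groupM wlong_par (simple_refl_parabolic iX)).
by rewrite len_mul_simple // ltnn.
Qed.

Lemma neg_wlong a : inXi a -> neg (act wlong a) = ~~ neg a.
Proof.
move=> aX; case na : (neg a); last first.
  by apply: (pos_par_neg wlong_neg); rewrite in_pos_par na.
have /= := pos_par_neg wlong_neg (a := opp_root a).
rewrite in_pos_par inXi_opp aX (neg_opp Halpha) na act_opp (neg_opp Halpha).
by move=> /(_ isT) /negPf.
Qed.

Lemma neg_wlongV a : inXi a -> neg (act wlong^-1%g a) = ~~ neg a.
Proof.
move=> aX; rewrite -{2}[a](actVK wlong) neg_wlong ?negbK //.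
by rewrite inXi_act ?groupV ?wlong_par.
Qed.

Lemma Phi_longest p : p \in WXi -> (forall i, i \in Xi -> neg (act p^-1%g (alpha i))) ->
  Phi p = PXi.
Proof.
move=> pX h; apply/eqP; rewrite eqEsubset Phi_par //=; apply/subsetP => a aP.
by rewrite in_Phi (pos_par_neg h aP) andbT; move: aP; rewrite in_pos_par => /andP[].
Qed.

Lemma Phi_wlong : Phi wlong = PXi.
Proof. exact: Phi_longest wlong_par wlongV_neg. Qed.

Lemma len_wlong : len wlong = #|PXi|. Proof. by rewrite /inv_count Phi_wlong. Qed.

(** [wlong] exchanges the signs of the roots of [WXi]. As a result the leading denominators of [w]
    and of its complement [w^-1 * wlong], the latter moved by [w], multiply to the full product over
    [PXi]. *)
Lemma Phi_wlong_compl w : w \in WXi ->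
  [set act w b | b in Phi (w^-1 * wlong)%g] = PXi :\: Phi w.
Proof.
move=> wX; have yX : (w^-1 * wlong)%g \in WXi by rewrite groupM ?groupV ?wlong_par.
apply/setP => c; rewrite in_setD.
have -> : (c \in [set act w b | b in Phi (w^-1 * wlong)%g]) =
    (act w^-1%g c \in Phi (w^-1 * wlong)%g).
  apply/imsetP/idP => [[b hb ->]|h]; first by rewrite actK.
  by exists (act w^-1%g c); rewrite ?actVK.
have [cX|cX] := boolP (inXi c); last first.
  rewrite in_pos_par (negPf cX) !andbF; apply/negP => /(subsetP (Phi_par yX)).
  by rewrite in_pos_par inXi_act ?groupV // (negPf cX) andbF.
rewrite in_pos_par !in_Phi cX andbT invMg invgK actM actVK neg_wlongV //.
by case: (neg c); rewrite ?andbT ?andbF.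
Qed.

Lemma len_wlong_compl w : w \in WXi -> (len (w^-1 * wlong)%g + len w = len wlong)%N.
Proof.
move=> wX; rewrite len_wlong -(cardsID (Phi w) PXi) addnC; congr (_ + _)%N.
  by rewrite setIC (setIidPl (Phi_par wX)).
by rewrite -Phi_wlong_compl // card_imset //; exact: act_inj.
Qed.

Lemma wlong_uniq p : p \in WXi -> (forall i, i \in Xi -> neg (act p^-1%g (alpha i))) ->
  p = wlong.
Proof.
move=> pX h; have := len_wlong_compl pX.
rewrite len_wlong -[len p]/(#|Phi p|) (Phi_longest pX h) => /eqP.
rewrite -[X in _ == X]add0n eqn_add2r => /eqP/len_eq0 e.
by rewrite -[LHS]mulg1 -e mulKVg.
Qed.

Lemma act_simple_pos_par i : i \in Xi ->
  [set act (s i) b | b in PXi :\ alpha i] = PXi :\ alpha i.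
Proof.
move=> iX.
have st b : b \in PXi :\ alpha i -> act (s i) b \in PXi :\ alpha i.
  rewrite !in_setD1 !in_pos_par inXi_act ?simple_refl_parabolic //.
  move=> /and3P[bi pb ->]; rewrite (pos_simple_refl Halpha pb bi) !andbT.
  apply: contraNneq pb => e; rewrite -[b](act_simpleK alpha i) e act_alpha.
  by rewrite (neg_opp Halpha) (pos_alpha Halpha).
apply/setP => c; apply/imsetP/idP => [[b hb ->]|hc]; first exact: st.
by exists (act (s i) c); rewrite ?act_simpleK ?st.
Qed.

Lemma act_wlong_pos_par : [set act wlong (opp_root b) | b in PXi] = PXi.
Proof.
apply/eqP; rewrite eqEcard card_imset ?leqnn ?andbT; last first.
  by move=> b c /act_inj /(can_inj (@opp_rootK _ _)).
apply/subsetP => _ /imsetP[b + ->]; rewrite !in_pos_par => /andP[pb bX].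
rewrite inXi_act ?wlong_par // inXi_opp bX neg_wlong ?inXi_opp //.
by rewrite (neg_opp Halpha) negbK pb.
Qed.

Notation WmXi := (min_coset_reps alpha Xi).

Lemma min_cosetP u : reflect (forall i, i \in Xi -> ~~ neg (act u (alpha i))) (u \in WmXi).
Proof.
rewrite inE; apply: (iffP forall_inP) => h i iX; last first.
  by rewrite !(wlenE Halpha) len_mul_simple ?h.
apply/negP => ne; have := h i iX; rewrite !(wlenE Halpha) -(len_mul_simple_desc ne).
by rewrite ltnNge leqnSn.
Qed.

Section Coset.
Variables (u w : W).
Hypotheses (uX : u \in WmXi) (wX : w \in WXi).

Lemma min_coset_pos b : inXi b -> neg (act u b) = neg b.
Proof.
move=> bX; have hu := elimT (min_cosetP u) uX.
case nb : (neg b); last first.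
  by apply: negbTE; apply: (pos_par_pos hu); rewrite in_pos_par nb.
have := pos_par_pos hu (a := opp_root b).
by rewrite in_pos_par inXi_opp bX (neg_opp Halpha) nb act_opp (neg_opp Halpha) !negbK => /(_ isT).
Qed.

Lemma Phi_coset_disjoint : [disjoint Phi u & [set act u b | b in Phi w]].
Proof.
rewrite -setI_eq0; apply/eqP/setP => c; rewrite in_setI in_set0.
apply/andP => -[cu /imsetP[b bw e]]; move: cu; rewrite in_Phi e actK => /andP[_].
by move: bw; rewrite in_Phi => /andP[/negPf -> _].
Qed.

(** On the roots of [WXi] it is [u] that preserves signs; on all other roots it is [w^-1]. *)
Lemma Phi_coset : Phi (u * w)%g = Phi u :|: [set act u b | b in Phi w].
Proof.
apply/setP => c; rewrite in_setU.
have -> : (c \in [set act u b | b in Phi w]) = (act u^-1%g c \in Phi w).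
  apply/imsetP/idP => [[b hb ->]|h]; first by rewrite actK.
  by exists (act u^-1%g c); rewrite ?actVK.
rewrite !in_Phi invMg actM; have [bX|bX] := boolP (inXi (act u^-1%g c)).
  have := min_coset_pos bX; rewrite actVK => ->.
  by case: (neg (act u^-1%g c)); rewrite ?andbF.
have e b : inXi b = false -> ~~ neg b -> neg (act w^-1%g b) = false.
  move=> bX' pb; apply/negP => nb; have : b \in Phi w by rewrite in_Phi pb nb.
  by move=> /(subsetP (Phi_par wX)); rewrite in_pos_par bX' andbF.
case nb : (neg (act u^-1%g c)); last by rewrite /= andbF orFb e ?nb ?andbF // (negPf bX).
rewrite /= andbT orbF; have := e (opp_root (act u^-1%g c)).
rewrite inXi_opp (negPf bX) (neg_opp Halpha) nb act_opp (neg_opp Halpha) => /(_ erefl isT).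
by move=> /negbFE ->; rewrite andbT.
Qed.

Lemma len_coset : len (u * w)%g = (len u + len w)%N.
Proof.
have := cardsUI (Phi u) [set act u b | b in Phi w].
have := Phi_coset_disjoint; rewrite -setI_eq0 => /eqP ->; rewrite cards0 addn0.
by rewrite -Phi_coset card_imset //; exact: act_inj.
Qed.

End Coset.

Lemma coset_decomp y : exists u w, [/\ u \in WmXi, w \in WXi & y = (u * w)%g].
Proof.
have [k] := ubnP (len y); elim: k y => // k IH y yk.
have [yX|] := boolP (y \in WmXi); first by exists y, 1%g; rewrite group1 mulg1.
move=> /min_cosetP h.
have [i iX ni] : exists2 i, i \in Xi & neg (act y (alpha i)).
  apply/exists_inP; apply: contrapT => /negP; rewrite negb_exists_in => /forall_inP h'.
  exact: h.
have [|u [w [uX wX e]]] := IH (y * s i)%g.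
  by rewrite -ltnS (len_mul_simple_desc ni).
exists u, (w * s i)%g; split => //; first by rewrite groupM ?simple_refl_parabolic.
by rewrite mulgA -e -mulgA simple_reflK mulg1.
Qed.

Lemma coset_uniq u v w : u \in WmXi -> v \in WmXi -> w \in WXi ->
  v = (u * w)%g -> v = u /\ w = 1%g.
Proof.
move=> uX vX wX e; have eu : u = (v * w^-1)%g by rewrite e mulgK.
have := len_coset uX wX; have := len_coset vX (groupVr wX).
rewrite -e -eu lenV => e1 e2; have w1 : w = 1%g by apply: len_eq0; lia.
by split=> //; rewrite e w1 mulg1.
Qed.

End Parabolic.

(** * The longest element of W and the splitting off of dihedral factors *)

Section WholeGroup.
Variables (L : zmodType) (rd : rootDatum L).
Notation W := (weyl rd).
Notation roots := (rd_roots rd).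
Notation act := (@weyl_act_root L rd).
Variables (n : nat) (alpha : 'I_n -> roots).
Hypothesis Halpha : simple_system alpha.
Notation neg := (neg_root alpha).
Notation Phi := (Phi alpha).
Notation len := (inv_count alpha).

Implicit Types (u v w p y : W).

Lemma parabolicT w : w \in parabolic alpha setT.
Proof.
have [I <-] := word_surj Halpha w; apply: word_parabolic.
by apply/allP => i _; rewrite /= inE.
Qed.

Lemma pos_parT a : (a \in pos_par alpha setT) = ~~ neg a.
Proof. by rewrite in_pos_par parabolicT andbT. Qed.

Lemma Phi_mul_wlong w :
  Phi (w * wlong alpha setT)%g = pos_par alpha setT :\: Phi w.
Proof.
apply/setP => c; rewrite in_setD pos_parT !in_Phi invMg actM.
rewrite (neg_wlongV Halpha) ?parabolicT //.
by case: (neg c); rewrite ?andbF ?andbT.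
Qed.

Lemma len_mul_wlong w : (len (w * wlong alpha setT)%g + len w = #|pos_par alpha setT|)%N.
Proof.
rewrite /inv_count Phi_mul_wlong -(cardsID (Phi w) (pos_par alpha setT)) addnC.
by rewrite setIC (setIidPl (Phi_par Halpha (parabolicT w))).
Qed.

(* The inductive step of Matsumoto's theorem. *)
Lemma dihedral_split w i j :
  neg (act w^-1%g (alpha i)) -> neg (act w^-1%g (alpha j)) ->
  exists v, w = (wlong alpha [set i; j] * v)%g /\
    len w = (len (wlong alpha [set i; j]) + len v)%N.
Proof.
set Y := [set i; j] => ni nj.
have [u [p [uY pY e]]] := coset_decomp Halpha Y w^-1%g.
have ep : p^-1%g = wlong alpha Y.
  apply: (wlong_uniq Halpha); first by rewrite groupV.
  move=> k; rewrite invgK => kY.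
  have : neg (act w^-1%g (alpha k)) by move: kY; rewrite !inE => /orP[]/eqP->.
  rewrite e actM (min_coset_pos Halpha uY) //.
  by rewrite inXi_act // inXi_alpha.
exists u^-1%g; split; first by rewrite -ep -invMg -e invgK.
by rewrite -ep !(lenV Halpha) -(lenV Halpha w) e (len_coset Halpha uY pY) addnC.
Qed.

End WholeGroup.

(** * The ring [S] inside its localization *)

Section LocalizedRing.
Variables (R : comNzRingType) (F : fgl R) (L : zmodType) (rd : rootDatum L).
Notation roots := (rd_roots rd).
Notation act := (@weyl_act_root L rd).
Notation S := (fga F L).
Notation Q := (QF F rd).
Notation xr := (@x_root R F L rd).

Definition toQ (s : S) : Q := S_incl rd s.

Lemma toQ_E s : toQ s = loc_pi (s, den1 _).
Proof.
rewrite /toQ /S_incl /loc_inj /loc_frac; congr (loc_pi (s, _)).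
by apply: val_inj; rewrite val_insubd rpred1.
Qed.

Lemma toQ_nmod : nmod_morphism toQ.
Proof.
split=> [|s t]; rewrite !toQ_E //.
by rewrite -[RHS]/(loc_add _ _) loc_pi_add; apply: loc_pi_eq1 => /=; ring.
Qed.
Lemma toQ_monoid : monoid_morphism toQ.
Proof.
split=> [|s t]; rewrite !toQ_E //.
rewrite -[RHS]/(loc_mul _ _) loc_pi_mul.
by apply: loc_pi_eq1 => /=; ring.
Qed.
HB.instance Definition _ := GRing.isNmodMorphism.Build S Q toQ toQ_nmod.
HB.instance Definition _ := GRing.isMonoidMorphism.Build S Q toQ toQ_monoid.

Lemma toQM s t : toQ (s * t) = toQ s * toQ t. Proof. exact: rmorphM. Qed.
Lemma toQB s t : toQ (s - t) = toQ s - toQ t. Proof. exact: rmorphB. Qed.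
Lemma toQD s t : toQ (s + t) = toQ s + toQ t. Proof. exact: rmorphD. Qed.
Lemma toQ1 : toQ 1 = 1. Proof. exact: rmorph1. Qed.

Lemma toQ_sign k : toQ ((-1) ^+ k) = (-1) ^+ k.
Proof. by rewrite [LHS](rmorphXn toQ) rmorphN1. Qed.

Definition xinv (a : roots) : Q := Q_frac rd 1 (xr a).

Lemma xinvK a : xinv a * toQ (xr a) = 1.
Proof.
rewrite [LHS]Q_fracK; first exact: (rmorph1 toQ).
by apply/asboolP; exists [:: a]; rewrite big_seq1.
Qed.

Lemma xinvE a (q : Q) : q * toQ (xr a) = 1 -> q = xinv a.
Proof. by move=> h; rewrite -[q]mulr1 -(xinvK a) mulrCA h mulr1. Qed.

Lemma x_opp_root a : x_opp F a = xr (opp_root a).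
Proof. by rewrite /x_opp /x_root opp_rootE. Qed.

Lemma actQ_toQ w s : actQ w (toQ s) = toQ (actS w s).
Proof.
rewrite !toQ_E [LHS]loc_mapE; apply: loc_pi_eq1 => /=.
by rewrite [X in _ = _ * X]rmorph1.
Qed.

Lemma actQ_mul w (p q : Q) : actQ w (p * q) = actQ w p * actQ w q.
Proof. exact: rmorphM. Qed.

Lemma actQ_sub w (p q : Q) : actQ w (p - q) = actQ w p - actQ w q.
Proof. exact: rmorphB. Qed.

Lemma actQ_sign w k : actQ w ((-1) ^+ k) = (-1) ^+ k :> Q.
Proof. by rewrite [LHS](rmorphXn (actQ w)) rmorphN1. Qed.

Lemma actS_xr w a : actS w (xr a) = xr (act w a).
Proof. exact: actS_x. Qed.

Lemma actQ_xinv w a : actQ w (xinv a) = xinv (act w a).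
Proof.
apply: xinvE; rewrite -actS_xr -actQ_toQ -[LHS](rmorphM (actQ w)) xinvK.
exact: rmorph1.
Qed.

Definition inS (q : Q) := exists s, q = toQ s.

Lemma inS_toQ s : inS (toQ s). Proof. by exists s. Qed.
Lemma inSD p q : inS p -> inS q -> inS (p + q).
Proof. by move=> [s ->] [t ->]; exists (s + t); rewrite rmorphD. Qed.
Lemma inSM p q : inS p -> inS q -> inS (p * q).
Proof. by move=> [s ->] [t ->]; exists (s * t); rewrite rmorphM. Qed.
Lemma inSN p : inS p -> inS (- p).
Proof. by move=> [s ->]; exists (- s); rewrite rmorphN. Qed.
Lemma inS0 : inS 0. Proof. by exists 0; rewrite rmorph0. Qed.
Lemma inS1 : inS 1. Proof. by exists 1; rewrite rmorph1. Qed.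
Lemma inS_sum (I : Type) (r : seq I) (P : pred I) (G : I -> Q) :
  (forall i, P i -> inS (G i)) -> inS (\sum_(i <- r | P i) G i).
Proof.
move=> h; elim/big_rec: _ => [|i q Pi hq]; first exact: inS0.
by apply: inSD => //; exact: h.
Qed.
Lemma inS_sign k : inS ((-1) ^+ k).
Proof. by exists ((-1) ^+ k); rewrite rmorphXn rmorphN1. Qed.

Lemma xinvN_div a : inS (toQ (xr (opp_root a)) * xinv a).
Proof.
have [u e] := fga_xN_div F (val a); exists u.
have -> : xr (opp_root a) = xr a * u by rewrite -e /x_root opp_rootE.
by rewrite rmorphM mulrC mulrA xinvK mul1r.
Qed.

Lemma demazure_div a (s : S) : exists t, s - actS (weyl_refl a) s = xr a * t.
Proof.
have h (m : L) : exists k : int, m = weyl_refl a m + val a *~ k.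
  by exists (coroot a m); rewrite weyl_reflE subrK.
have [t e] := fga_hom_div (phi := weyl_refl a) (psi := idfun) h s.
by exists t; rewrite -[RHS]e; congr (_ - _); rewrite -[LHS]fga_hom_id.
Qed.

Lemma demazure_inS a s : inS (xinv a * (toQ s - toQ (actS (weyl_refl a) s))).
Proof.
have [t e] := demazure_div a s; exists t.
by rewrite -toQB e toQM mulrA xinvK mul1r.
Qed.

Hypothesis Hreg : forall (a : roots) (s : S), xr a * s = 0 -> s = 0.

Lemma x_rootI a (s t : S) : xr a * s = xr a * t -> s = t.
Proof.
move=> e; apply/eqP; rewrite -subr_eq0; apply/eqP/(Hreg (a := a)).
by rewrite mulrBr e subrr.
Qed.

Lemma toQ_inj : injective toQ.
Proof.
move=> s t; rewrite !toQ_E => /loc_piP[c /asboolP[r ->]] /=.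
rewrite !mulr1; elim: r => [|a r IH]; first by rewrite big_nil !mul1r.
by rewrite big_cons -!mulrA => /x_rootI /IH.
Qed.

(** With r the ratio at a and r' the ratio at -a, the sum is (1 + r') / x_a = (1 + r) r' / x_a, and
    x_a divides 1 + r. This is the element kappa in X_i^2 = kappa X_i and Y_i = kappa - X_i. *)
Lemma xinv_opp_sum a : inS (xinv a + xinv (opp_root a)).
Proof.
have ra : x_regular F (val a) by move=> s; exact: (Hreg (a := a)).
have [t et] := xN_ratio_div ra; have uu := xN_ratioN ra.
have eo : xr (opp_root a) = xr a * xN_ratio F (val a).
  by rewrite /x_root opp_rootE xN_ratioE.
have -> : xinv (opp_root a) = xinv a * toQ (xN_ratio F (- val a)).
  by apply/esym/xinvE; rewrite eo toQM mulrACA xinvK mul1r -toQM [X in toQ X]mulrC uu toQ1.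
exists (t * xN_ratio F (- val a)).
have -> : xinv a + xinv a * toQ (xN_ratio F (- val a)) =
    xinv a * toQ (xN_ratio F (val a) * xN_ratio F (- val a) + xN_ratio F (- val a)).
  by rewrite uu toQD toQ1 mulrDr mulr1.
rewrite -{2}[xN_ratio F (- val a)]mul1r -mulrDl et subrK.
by rewrite -[X in toQ X]mulrA toQM mulrA xinvK mul1r.
Qed.

End LocalizedRing.

(** * Coefficients and leading terms in the twisted group algebra *)

Section TwistedCoefficients.
Variables (R : comNzRingType) (F : fgl R) (L : zmodType) (rd : rootDatum L).
Notation W := (weyl rd).
Notation roots := (rd_roots rd).
Notation act := (@weyl_act_root L rd).
Notation Q := (QF F rd).
Notation QW := (QW F rd).
Notation xinv := (@xinv R F L rd).
Implicit Types (z p q : QW) (u v w : W).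

Lemma QWmulE p q u : (p * q) u = \sum_(v : W) p v * actQ v (q (v^-1 * u)%g).
Proof. by rewrite -[p * q]/(qmul p q) ffunE. Qed.

Lemma QWaddE p q u : (p + q) u = p u + q u.
Proof. by rewrite -[p + q]/([ffun u => p u + q u]) ffunE. Qed.
Lemma QWoppE p u : (- p) u = - p u.
Proof. by rewrite -[- p]/([ffun u => - p u]) ffunE. Qed.
Lemma QWsubE p q u : (p - q) u = p u - q u.
Proof. by rewrite QWaddE QWoppE. Qed.
Lemma QW0E u : (0 : QW) u = 0.
Proof. by rewrite -[0 : QW]/([ffun _ => 0]) ffunE. Qed.
Lemma QWscaleE (a : Q) p u : (a *: p) u = a * p u.
Proof. by rewrite -[a *: p]/(qscale a p) ffunE. Qed.
Lemma deltaE w u : delta F w u = (u == w)%:R. Proof. by rewrite ffunE. Qed.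
Lemma QW1E u : (1 : QW) u = (u == 1%g)%:R. Proof. exact: deltaE. Qed.

Lemma QWsumE (J : Type) (r : seq J) (P : pred J) (G : J -> QW) u :
  (\sum_(j <- r | P j) G j) u = \sum_(j <- r | P j) G j u.
Proof.
elim/big_rec2: _ => [|j a b _ <-]; first by rewrite QW0E.
by rewrite QWaddE.
Qed.

Lemma delta_mulE w z u : (delta F w * z) u = actQ w (z (w^-1 * u)%g).
Proof.
rewrite QWmulE (bigD1 w) //= big1 ?addr0 => [|v /negPf vw].
  by rewrite deltaE eqxx mul1r.
by rewrite deltaE vw mul0r.
Qed.

Lemma mul_deltaE w z u : (z * delta F w) u = z (u * w^-1)%g.
Proof.
rewrite QWmulE (bigD1 (u * w^-1)%g) //= big1 ?addr0 => [|v vw].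
  by rewrite deltaE invMg invgK mulgKV eqxx rmorph1 mulr1.
rewrite deltaE; case: eqP => [e|_]; last by rewrite rmorph0 mulr0.
by case/eqP: vw; rewrite -e invMg invgK mulKVg.
Qed.

Lemma delta_mul v w : delta F (v * w)%g = delta F v * delta F w.
Proof. by apply/ffunP => u; rewrite mul_deltaE !deltaE (canF_eq (mulgKV _)). Qed.

Lemma Q_incl_mul (a : Q) z : Q_incl a * z = a *: z.
Proof. by rewrite /Q_incl -qscalerAl mul1r. Qed.

Lemma mul_Q_inclE (a : Q) z u : (z * Q_incl a) u = z u * actQ u a.
Proof.
rewrite QWmulE (bigD1 u) //= big1 ?addr0 => [|v vu].
  by rewrite QWscaleE deltaE mulVg eqxx mulr1.
rewrite QWscaleE deltaE; case: eqP => [e|_]; last by rewrite mulr0 rmorph0 mulr0.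
by case/eqP: vu; rewrite -[u](mulKVg v) e mulg1.
Qed.

Lemma scaler_mulr (a : Q) p q : a *: (p * q) = (a *: p) * q.
Proof. exact: qscalerAl. Qed.

Variables (n : nat) (alpha : 'I_n -> roots).
Hypothesis Halpha : simple_system alpha.
Notation s := (simple_refl alpha).
Notation word := (wword alpha).
Notation Phi := (Phi alpha).
Notation len := (inv_count alpha).
Notation X := (X_elt F alpha).
Notation Y := (Y_elt F alpha).

Lemma X_mulE i z u :
  (X i * z) u = xinv (alpha i) * (z u - actQ (s i) (z (s i * u)%g)).
Proof.
rewrite /X_elt -mulrA Q_incl_mul QWscaleE mulrBl mul1r QWsubE delta_mulE.
by rewrite simple_reflV.
Qed.

Lemma Y_mulE i z u :
  (Y i * z) u = xinv (opp_root (alpha i)) * z u +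
    xinv (alpha i) * actQ (s i) (z (s i * u)%g).
Proof.
rewrite /Y_elt mulrDl -mulrA !Q_incl_mul QWaddE !QWscaleE delta_mulE.
by rewrite simple_reflV x_opp_root.
Qed.

Definition Xword I : QW := \prod_(i <- I) X i.

Lemma Xword_cons i I : Xword (i :: I) = X i * Xword I.
Proof. by rewrite /Xword big_cons. Qed.
Lemma Xword_nil : Xword [::] = 1. Proof. by rewrite /Xword big_nil. Qed.
Lemma Xword_cat I J : Xword (I ++ J) = Xword I * Xword J.
Proof. by rewrite /Xword big_cat. Qed.

Section LeadingTerm.
Variables (T : 'I_n -> QW) (c : 'I_n -> Q) (e : bool).
(** Common shape of the [X_i] ([e = true]) and of the [Y_i] ([e = false]). *)
Hypothesis TE : forall i z u, (T i * z) u = c i * z u +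
  (-1) ^+ e * xinv (alpha i) * actQ (s i) (z (s i * u)%g).

Let Tw I := \prod_(i <- I) T i.
Let Tw_cons i I : Tw (i :: I) = T i * Tw I. Proof. by rewrite /Tw big_cons. Qed.
Let Tw_nil : Tw [::] = 1. Proof. by rewrite /Tw big_nil. Qed.

(** Expanding the product gives terms at the values of subwords, and only the full word can reach
    length [size I]. *)
Lemma prod_eq0 I u : (size I <= len u)%N -> u != word I -> Tw I u = 0.
Proof.
elim: I u => [|i I IH] u /=.
  by rewrite wword_nil Tw_nil QW1E => _ /negPf ->.
move=> Iu; rewrite wword_cons => ne; rewrite Tw_cons TE.
rewrite IH ?mulr0 ?add0r; first last.
- apply: contraTneq Iu => ->; rewrite -leqNgt; exact: len_word.
- exact: ltnW.
rewrite IH ?rmorph0 ?mulr0 //.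
- by rewrite -ltnS (leq_trans Iu) // len_cons_ge.
- by apply: contra ne => /eqP <-; rewrite simple_reflKl.
Qed.

(** Only the reflection terms contribute. Each new letter adds its simple root and reflects the
    roots already present, which is how [Phi] grows in [Phi_cons]. *)
Lemma prod_lead I : size I = len (word I) ->
  Tw I (word I) = (-1) ^+ (e * size I) * \prod_(b in Phi (word I)) xinv b.
Proof.
elim: I => [|i I IH].
  rewrite wword_nil Tw_nil QW1E eqxx muln0 mul1r big1 // => b.
  by rewrite in_Phi invg1 act1; case: neg_root.
rewrite wword_cons /= => zI.
have zI' : size I = len (word I).
  apply/eqP; rewrite eqn_leq len_word //= andbT -ltnS zI.
  exact: len_cons_le.
have pi : ~~ neg_root alpha (act (word I)^-1%g (alpha i)).
  by apply/negP => h; have := len_desc Halpha h; lia.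
rewrite Tw_cons TE prod_eq0 ?mulr0 ?add0r; first last.
- by apply/eqP => e'; have := zI; rewrite e'; lia.
- lia.
rewrite simple_reflKl IH // rmorphM rmorph_sign (Phi_cons Halpha pi).
rewrite big_setU1 ?alpha_notin_Phi //= big_imset /=; last by move=> b b' _ _ /act_inj.
rewrite rmorph_prod mulrACA mulnS exprD.
by congr (_ * (_ * _)); apply: eq_bigr => b _; exact: actQ_xinv.
Qed.

Variable Xi : {set 'I_n}.

Lemma prod_parabolic I u : all (mem Xi) I -> u \notin parabolic alpha Xi -> Tw I u = 0.
Proof.
elim: I u => [|i I IH] u /=.
  move=> _ uX; rewrite Tw_nil QW1E; case: eqP => // e1.
  by rewrite e1 group1 in uX.
move=> /andP[iX aI] uX; rewrite Tw_cons TE !IH ?rmorph0 ?mulr0 ?addr0 //.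
by rewrite groupMl // simple_refl_parabolic.
Qed.

End LeadingTerm.

Lemma X_mul_signE i z u : (X i * z) u = xinv (alpha i) * z u +
  (-1) ^+ true * xinv (alpha i) * actQ (s i) (z (s i * u)%g).
Proof. by rewrite X_mulE mulrBr expr1 mulN1r mulNr. Qed.

Lemma Y_mul_signE i z u : (Y i * z) u = xinv (opp_root (alpha i)) * z u +
  (-1) ^+ false * xinv (alpha i) * actQ (s i) (z (s i * u)%g).
Proof. by rewrite Y_mulE expr0 mul1r. Qed.

Lemma Xword_eq0 I u : (size I <= len u)%N -> u != word I -> Xword I u = 0.
Proof. exact: (prod_eq0 X_mul_signE). Qed.

Lemma Xword_lead I : size I = len (word I) ->
  Xword I (word I) = (-1) ^+ size I * \prod_(b in Phi (word I)) xinv b.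
Proof. by move=> /(prod_lead X_mul_signE); rewrite mul1n. Qed.

Lemma Xword_parabolic (Xi : {set 'I_n}) I u : all (mem Xi) I ->
  u \notin parabolic alpha Xi -> Xword I u = 0.
Proof. exact: (prod_parabolic X_mul_signE). Qed.

End TwistedCoefficients.

Lemma clear_denominators (A : comPzRingType) (a a' b b' e f z q : A) :
  a' * a = 1 -> b' * b = 1 -> e * e = 1 -> f * f = 1 ->
  a * b * (z * (e * b')) = q -> z = e * f * q * (f * a').
Proof.
move=> ea eb ee ef <-.
transitivity ((a' * a) * (b' * b) * (e * e) * (f * f) * z); last by ring.
by rewrite ea eb ee ef !mul1r.
Qed.

(** * The filtration by word length and the integrality of coefficients *)

Section WordSpan.
Variables (R : comNzRingType) (F : fgl R) (L : zmodType) (rd : rootDatum L).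
Notation W := (weyl rd).
Notation roots := (rd_roots rd).
Notation S := (fga F L).
Notation Q := (QF F rd).
Notation QW := (QW F rd).
Notation toQ := (@toQ R F L rd).
Notation xinv := (@xinv R F L rd).
Notation inS := (@inS R F L rd).
Notation xr := (@x_root R F L rd).
Variables (n : nat) (alpha : 'I_n -> roots).
Hypothesis Halpha : simple_system alpha.
Notation s := (simple_refl alpha).
Notation word := (wword alpha).
Notation Phi := (Phi alpha).
Notation len := (inv_count alpha).
Notation X := (X_elt F alpha).
Notation Xword := (Xword F alpha).
Implicit Types (z p q : QW) (u v w : W) (I J : seq 'I_n) (Xi : {set 'I_n}).

(** Words need not be reduced. The strict bound makes level 0 trivial and matches the support: an
    element of level [k] has coefficients only at lengths below [k]. *)
Inductive word_span Xi k : QW -> Prop :=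
| word_span0 : word_span Xi k 0
| word_span_cons t I z : all (mem Xi) I -> (size I < k)%N -> word_span Xi k z ->
    word_span Xi k (toQ t *: Xword I + z).
Notation ws := word_span.

Lemma word_spanD Xi k z z' : ws Xi k z -> ws Xi k z' -> ws Xi k (z + z').
Proof.
move=> hz hz'; elim: hz => [|t I y aI sI _ IH]; first by rewrite add0r.
by rewrite -addrA; constructor.
Qed.

Lemma word_spanZ Xi k t z : ws Xi k z -> ws Xi k (toQ t *: z).
Proof.
elim=> [|t' I y aI sI _ IH]; first by rewrite scaler0; constructor.
by rewrite scalerDr scalerA -toQM; constructor.
Qed.

Lemma word_spanN Xi k z : ws Xi k z -> ws Xi k (- z).
Proof.
move=> /(word_spanZ (- 1)); rewrite [X in X *: _](_ : _ = -1) ?scaleN1r //.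
by rewrite [LHS]rmorphN1.
Qed.

Lemma word_spanB Xi k z z' : ws Xi k z -> ws Xi k z' -> ws Xi k (z - z').
Proof. by move=> hz /word_spanN; apply: word_spanD. Qed.

Lemma word_span_sum Xi k (J : Type) (r : seq J) (P : pred J) (G : J -> QW) :
  (forall j, P j -> ws Xi k (G j)) -> ws Xi k (\sum_(j <- r | P j) G j).
Proof.
move=> h; elim/big_rec: _ => [|j y Pj hy]; first by constructor.
by apply: word_spanD => //; exact: h.
Qed.

Lemma word_span_word Xi k I : all (mem Xi) I -> (size I < k)%N -> ws Xi k (Xword I).
Proof.
move=> aI sI; rewrite -[Xword I]addr0 -[Xword I]scale1r -[1](@toQ1 R F L rd).
by constructor => //; constructor.
Qed.

Lemma word_span_le Xi Xi' k k' z : (k <= k')%N -> Xi \subset Xi' ->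
  ws Xi k z -> ws Xi' k' z.
Proof.
move=> kk XX; elim=> [|t I y aI sI _ IH]; constructor => //.
  by apply/allP => i /(allP aI) /(subsetP XX).
exact: leq_trans sI kk.
Qed.

(** The twisted Leibniz rule. The second coefficient is the Demazure operator applied to [t], hence
    lies in [S]. *)
Lemma X_mulZ i t z : X i * (toQ t *: z) = toQ (actS (s i) t) *: (X i * z) +
  (xinv (alpha i) * (toQ t - toQ (actS (s i) t))) *: z.
Proof.
apply/ffunP => u; rewrite X_mulE QWaddE !QWscaleE X_mulE actQ_mul actQ_toQ.
ring.
Qed.

Lemma word_span_X Xi k i z : i \in Xi -> ws Xi k z -> ws Xi k.+1 (X i * z).
Proof.
move=> iX; elim=> [|t I y aI sI _ IH]; first by rewrite mulr0; constructor.
rewrite mulrDr X_mulZ; apply: word_spanD IH; apply: word_spanD.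
  apply: word_spanZ; rewrite -Xword_cons; apply: word_span_word => //=.
  by rewrite aI andbT.
have [t' ->] := demazure_inS (alpha i) t.
by apply/word_spanZ/word_span_word => //; rewrite ltnW.
Qed.

Lemma word_span_Xword Xi k I z : all (mem Xi) I -> ws Xi k z ->
  ws Xi (size I + k) (Xword I * z).
Proof.
move=> + hz; elim: I => [|i I IH] /=; first by rewrite Xword_nil mul1r.
by move=> /andP[iX /IH h]; rewrite Xword_cons -mulrA addSn; exact: word_span_X.
Qed.

Lemma word_span_mul Xi k k' z z' : ws Xi k z -> ws Xi k' z' -> ws Xi (k + k') (z * z').
Proof.
move=> hz hz'; elim: hz => [|t I y aI sI _ IH]; first by rewrite mul0r; constructor.
rewrite mulrDl; apply: word_spanD IH; rewrite -scaler_mulr; apply: word_spanZ.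
apply: word_span_le (word_span_Xword aI hz') => //.
by rewrite leq_add2r ltnW.
Qed.

Lemma word_span_mulXword Xi k J z : all (mem Xi) J -> ws Xi k z ->
  ws Xi (k + size J) (z * Xword J).
Proof.
move=> aJ; elim=> [|t I y aI sI _ IH]; first by rewrite mul0r; constructor.
rewrite mulrDl; apply: word_spanD IH; rewrite -scaler_mulr -Xword_cat.
apply/word_spanZ/word_span_word; first by rewrite all_cat aI.
by rewrite size_cat ltn_add2r.
Qed.

Lemma word_span_parabolic Xi k z u :
  ws Xi k z -> u \notin parabolic alpha Xi -> z u = 0.
Proof.
move=> hz uX; elim: hz => [|t I y aI sI _ IH]; first exact: QW0E.
by rewrite QWaddE QWscaleE IH (Xword_parabolic F aI uX) // mulr0 addr0.
Qed.

Lemma DF1 : DF alpha (1 : QW).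
Proof.
by have := DF_scal alpha (1 : S); rewrite [S_incl _ _]toQ1 /Q_incl scale1r.
Qed.

Lemma word_span_DF Xi k z : ws Xi k z -> DF alpha z.
Proof.
have hs t y : DF alpha y -> DF alpha (toQ t *: y).
  by move=> hy; rewrite -Q_incl_mul; apply: DF_mul => //; exact: DF_scal.
elim=> [|t I y aI sI _ IH].
  by rewrite -(scale0r (1 : QW)) -[0 : Q](rmorph0 toQ); apply/hs/DF1.
apply: DF_add => //; apply: hs; elim: I {aI sI} => [|i I IHI].
  by rewrite Xword_nil; exact: DF1.
by rewrite Xword_cons; apply: DF_mul => //; constructor.
Qed.

Lemma DF_word_span z : DF alpha z -> exists k, ws setT k z.
Proof.
elim=> [t|i|y y' _ [k hk] _ [k' hk']|y y' _ [k hk] _ [k' hk']].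
- exists 1%N; rewrite -[Q_incl _]mulr1 Q_incl_mul; apply: word_spanZ.
  by rewrite -(Xword_nil F alpha); apply: word_span_word.
- exists 2%N; rewrite -[X i]mulr1 -(Xword_nil F alpha) -Xword_cons.
  by apply: word_span_word => //=; rewrite inE.
- exists (k + k')%N; apply: word_spanD.
    by apply: word_span_le hk; rewrite ?leq_addr.
  by apply: word_span_le hk'; rewrite ?leq_addl.
- by exists (k + k')%N; exact: word_span_mul.
Qed.

Lemma word_span_delta Xi w : w \in parabolic alpha Xi -> exists k, ws Xi k (delta F w).
Proof.
move=> /(parabolic_word Halpha)[I [aI <- _]]; elim: I aI => [|i I IH] /=.
  exists 1%N; rewrite wword_nil -[delta F 1%g]/(1 : QW) -(Xword_nil F alpha).
  exact: word_span_word.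
move=> /andP[iX /IH[k hk]]; exists (2 + k)%N; rewrite wword_cons.
rewrite delta_mul; apply: word_span_mul hk.
have -> : delta F (s i) = 1 - toQ (xr (alpha i)) *: Xword [:: i].
  rewrite Xword_cons Xword_nil mulr1; apply/ffunP => u.
  rewrite QWsubE QWscaleE -[X i]mulr1 X_mulE mulrA [toQ _ * _]mulrC xinvK mul1r.
  rewrite opprB addrC subrK deltaE QW1E -(inj_eq (mulgI (s i)) u) simple_reflK.
  by rewrite [RHS]rmorph_nat.
apply: word_spanB; first by rewrite -(Xword_nil F alpha); apply: word_span_word.
by apply/word_spanZ/word_span_word => //=; rewrite iX.
Qed.

Lemma prod_xinvK (A : {set roots}) :
  (\prod_(b in A) xinv b) * toQ (\prod_(b in A) xr b) = 1.
Proof.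
rewrite [X in _ * X]rmorph_prod -big_split big1 // => b _; exact: xinvK.
Qed.

(** This is [x_Xi] up to a unit, taken over positive roots because these occur in the leading
    terms. *)
Definition pos_prod Xi : S := \prod_(b in pos_par alpha Xi) xr b.
Notation pp := pos_prod.

Definition integral Xi := forall k z w,
  ws Xi k z -> w \in parabolic alpha Xi -> inS (toQ (pp Xi) * z w).

(** Right multiplication by a [delta] of the subgroup moves any coefficient to [u] and stays within
    the span of words. *)
Lemma integral_from Xi u : u \in parabolic alpha Xi ->
  (forall I, all (mem Xi) I -> inS (toQ (pp Xi) * Xword I u)) -> integral Xi.
Proof.
move=> uX h k z w hz wX.
have [k' hd] := word_span_delta (groupM (groupVr wX) uX).
have -> : z w = (z * delta F (w^-1 * u)%g) u.
  by rewrite mul_deltaE invMg invgK mulKVg.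
elim: (word_span_mul hz hd) => [|t I y aI sI _ IH].
  by rewrite QW0E mulr0; exact: inS0.
rewrite QWaddE QWscaleE mulrDr mulrCA; apply: inSD IH.
by apply: inSM; [exact: inS_toQ|exact: h].
Qed.

Section Spanning.
Variable Xi : {set 'I_n}.
Hypothesis HXi : integral Xi.
Notation WXi := (parabolic alpha Xi).
Notation wl := (wlong alpha Xi).

Let test z := forall J, all (mem Xi) J -> inS (toQ (pp Xi) * (z * Xword J) wl).

(* The product with a reduced word [J] for [w^-1 * wl] isolates the coefficient
   of [z] at [w]: all other terms vanish at [wl] for length reasons. *)
Let lead_coef z k w : (forall u, u \notin WXi -> z u = 0) ->
  (forall u, (k < len u)%N -> z u = 0) -> test z -> w \in WXi -> len w = k ->
  forall I, all (mem Xi) I -> word I = w -> size I = len w ->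
  exists t, z w = toQ t * Xword I w.
Proof.
move=> zX zk tz wX wk I aI eI zI.
have yX : (w^-1 * wl)%g \in WXi by rewrite groupM ?groupV ?wlong_par.
have [J [aJ eJ zJ]] := parabolic_word Halpha yX.
have := tz J aJ; rewrite QWmulE (bigD1 w) //= big1 ?addr0 => [|v vw]; last first.
  have [vX|/zX ->] := boolP (v \in WXi); last by rewrite mul0r.
  have [kv|vk] := ltnP k (len v); first by rewrite zk // mul0r.
  rewrite [Xword J _](Xword_eq0 F Halpha) ?rmorph0 ?mulr0 //.
    by have := len_wlong_compl Halpha wX; have := len_wlong_compl Halpha vX; lia.
  by rewrite eJ (inj_eq (mulIg _)) (inj_eq invg_inj).
have -> : Xword J (w^-1 * wl)%g = (-1) ^+ size J * \prod_(b in Phi (w^-1 * wl)%g) xinv b.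
  by rewrite -{1}eJ (Xword_lead F Halpha) ?eJ.
rewrite actQ_mul actQ_sign => -[q eq].
have eP : actQ w (\prod_(b in Phi (w^-1 * wl)%g) xinv b) =
    \prod_(b in pos_par alpha Xi :\: Phi w) xinv b.
  rewrite -(Phi_wlong_compl Halpha wX) big_imset /=; last by move=> b b' _ _ /act_inj.
  by rewrite [LHS]rmorph_prod; apply: eq_bigr => b _; exact: actQ_xinv.
have epp : toQ (pp Xi) = toQ (\prod_(b in Phi w) xr b) *
    toQ (\prod_(b in pos_par alpha Xi :\: Phi w) xr b).
  rewrite -toQM /pos_prod (big_setID (Phi w)) /=.
  by rewrite (setIidPr (Phi_par Halpha wX)).
have ss k' : (-1) ^+ k' * (-1) ^+ k' = 1 :> Q by rewrite -expr2 sqrr_sign.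
rewrite eP epp in eq.
exists ((-1) ^+ size J * (-1) ^+ size I * q); rewrite !toQM !toQ_sign.
have -> : Xword I w = (-1) ^+ size I * \prod_(b in Phi w) xinv b.
  by rewrite -{1}eI (Xword_lead F Halpha) ?eI.
exact: (clear_denominators (prod_xinvK _) (prod_xinvK _) (ss _) (ss _) eq).
Qed.

(** The test makes each coefficient of top length an [S]-multiple of the leading coefficient of a
    reduced word. Subtracting these multiples lowers [k], and [HXi] ensures that the difference
    still passes the test. *)
Lemma span_of_integral k z : (forall u, u \notin WXi -> z u = 0) ->
  (forall u, (k <= len u)%N -> z u = 0) ->
  (forall J, all (mem Xi) J -> inS (toQ (pp Xi) * (z * Xword J) wl)) -> ws Xi k z.
Proof.
elim: k z => [|k IH] z zX zk tz.
  have -> : z = 0 by apply/ffunP => u; rewrite zk // QW0E.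
  by constructor.
have /choice[rI rP] : forall w, exists I, w \in WXi ->
    [/\ all (mem Xi) I, word I = w & size I = len w].
  move=> w; case wX: (w \in WXi); last by exists [::].
  by have [I hI] := parabolic_word Halpha wX; exists I.
have /choice[c cP] : forall w, exists t, w \in WXi -> len w = k -> z w = toQ t * Xword (rI w) w.
  move=> w; case wX: (w \in WXi); last by exists 0.
  have [wk|wk] := eqVneq (len w) k; last first.
    by exists 0 => _ e; rewrite e eqxx in wk.
  have [aI eI sI] := rP w wX.
  by have [t ht] := lead_coef zX zk tz wX wk aI eI sI; exists t.
pose A := [set w in WXi | len w == k].
pose y := \sum_(w in A) toQ (c w) *: Xword (rI w).
have wy : ws Xi k.+1 y.
  apply: word_span_sum => w; rewrite inE => /andP[wX /eqP wk].
  by have [aI eI sI] := rP w wX; apply/word_spanZ/word_span_word; rewrite ?sI ?wk.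
rewrite -[z](subrK y); apply: word_spanD (wy).
apply: word_span_le (leqnSn k) (subxx _) _; apply: IH => [u uX|u ku|J aJ].
- by rewrite QWsubE zX // (word_span_parabolic wy) // subr0.
- have [uX|uX] := boolP (u \in WXi); last first.
    by rewrite QWsubE zX // (word_span_parabolic wy) // subr0.
  have h w : w \in A -> u != w -> Xword (rI w) u = 0.
    rewrite inE => /andP[wX /eqP wk] uw; have [aI eI sI] := rP w wX.
    by rewrite [LHS]Xword_eq0 // ?sI ?wk // eI.
  rewrite QWsubE /y QWsumE; have [uA|uA] := boolP (u \in A); last first.
    rewrite big1 ?subr0 => [|w wA]; last first.
      by rewrite QWscaleE h ?mulr0 //; apply: contraNneq uA => ->.
    apply: zk; rewrite ltn_neqAle ku andbT; apply: contra uA => /eqP e.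
    by rewrite inE uX e eqxx.
  rewrite (bigD1 u) //= big1 ?addr0 => [|w /andP[wA wu]]; last first.
    by rewrite QWscaleE h ?mulr0 // eq_sym.
  move: uA; rewrite inE => /andP[_ /eqP uk].
  by rewrite QWscaleE (cP u uX uk) subrr.
- rewrite mulrBl QWsubE mulrBr; apply: inSD; first exact: tz.
  apply: inSN; apply: (HXi (k := k.+1 + size J)); last exact: wlong_par.
  exact: word_span_mulXword.
Qed.

End Spanning.

End WordSpan.

(** * Functions on the parabolic subgroup that are stable under divided differences *)

Section IntegralFunctions.
Variables (R : comNzRingType) (F : fgl R) (L : zmodType) (rd : rootDatum L).
Notation W := (weyl rd).
Notation roots := (rd_roots rd).
Notation S := (fga F L).
Notation Q := (QF F rd).
Notation QW := (QW F rd).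
Notation toQ := (@toQ R F L rd).
Notation xinv := (@xinv R F L rd).
Notation inS := (@inS R F L rd).
Notation xr := (@x_root R F L rd).
Variables (n : nat) (alpha : 'I_n -> roots).
Notation s := (simple_refl alpha).
Notation X := (X_elt F alpha).
Notation Xword := (Xword F alpha).
Variable Xi : {set 'I_n}.
Notation WXi := (parabolic alpha Xi).
Implicit Types (f g h : W -> S) (c : W -> L) (u v w : W).

(* The functions [v |-> v mu - mu'] with [mu], [mu'] integral weights whose
   difference is in [L]; [mu] itself need not be in [L]. *)
Definition weight_fun c := exists k : 'I_n -> int, forall i v, i \in Xi -> v \in WXi ->
  s i (c (s i * v)%g) = c v - val (alpha i) *~ k i.

(* [x_(c v)] is the image of a fixed element of the formal group algebra of
   [L * int] under [eval_at (c v)]; [ext_refl] is the reflection upstairs. *)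
Definition eval_at (l : L) (m : L * int) : L := m.1 + l *~ m.2.
Lemma eval_at_nmod l : nmod_morphism (eval_at l).
Proof. by split=> [|a b]; rewrite /eval_at /= ?addr0 // mulrzDr addrACA. Qed.
HB.instance Definition _ l :=
  GRing.isNmodMorphism.Build (L * int)%type L (eval_at l) (eval_at_nmod l).

Definition ext_refl (i : 'I_n) (k : int) (m : L * int) : L * int :=
  (s i m.1 - val (alpha i) *~ (k * m.2), m.2).
Lemma ext_refl_nmod i k : nmod_morphism (ext_refl i k).
Proof.
split=> [|a b]; rewrite /ext_refl.
  by rewrite -[(0 : L * int).1]/(0 : L) -[(0 : L * int).2]/(0 : int) raddf0 mulr0 subr0.
rewrite -[(a + b).1]/(a.1 + b.1) -[(a + b).2]/(a.2 + b.2).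
by rewrite raddfD mulrDr mulrzDr -[RHS]/((_ + _, _ + _)) [in RHS]addrACA -opprD.
Qed.
HB.instance Definition _ i k :=
  GRing.isNmodMorphism.Build (L * int)%type (L * int)%type (ext_refl i k) (ext_refl_nmod i k).

Variable theta : W -> S.

(** The ring of functions of the overview. The parameter [theta] will be the constant 1 except in
    type G_2. *)
Inductive fun_gen : (W -> S) -> Prop :=
| gen_const t : fun_gen (fun _ => t)
| gen_weight c t : weight_fun c -> fun_gen (fun v => fga_hom (eval_at (c v)) t)
| gen_theta : fun_gen theta
| gen_add f g : fun_gen f -> fun_gen g -> fun_gen (fun v => f v + g v)
| gen_mul f g : fun_gen f -> fun_gen g -> fun_gen (fun v => f v * g v).

(** Here [h] is the divided difference (f - s_i f) / x_i for the action (s_i f)(v) = s_i (f (s_i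
    v)), stated without division. *)
Definition left_div i f h := forall v, v \in WXi ->
  f v - actS (s i) (f (s i * v)%g) = xr (alpha i) * h v.

Hypothesis theta_div : forall i, i \in Xi -> exists2 h, fun_gen h & left_div i theta h.

Lemma fun_gen_div f i : fun_gen f -> i \in Xi -> exists2 h, fun_gen h & left_div i f h.
Proof.
move=> + iX; elim=> [t|c t [k kP]||{}f g gf [h gh dh] gg [h' gh' dh']|{}f g gf [h gh dh] gg [h' gh' dh']].
- have [t' e] := demazure_div (alpha i) t.
  by exists (fun _ => t'); [constructor|move=> v _].
(* [ext_refl] moves every point by a multiple of (alpha i, 0), which [eval_at] sends to [alpha i].
   So the divided difference is taken upstairs, once for all [v]. *)
- have hm (m : L * int) : exists j : int,
      m = ext_refl i (k i) m + (val (alpha i), 0) *~ j.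
    exists (coroot (alpha i) m.1 + k i * m.2); case: m => m1 m2.
    have -> : (val (alpha i), 0 : int) *~ (coroot (alpha i) m1 + k i * m2) =
        (val (alpha i) *~ (coroot (alpha i) m1 + k i * m2), 0).
      by rewrite [LHS]surjective_pairing -[_.1]/(fst _) -[_.2]/(snd _) !raddfMz mul0rz.
    rewrite -[RHS]/((s i m1 - val (alpha i) *~ (k i * m2) + _, m2 + 0)) addr0.
    by rewrite weyl_reflE mulrzDr -addrA [- _ + _]addrC addrK subrK.
  have [t' e] := fga_hom_div (phi := ext_refl i (k i)) (psi := idfun) hm t.
  exists (fun v => fga_hom (eval_at (c v)) t'); first by constructor; exists k.
  move=> v vX; have := congr1 (fga_hom (eval_at (c v))) e.
  rewrite fga_homB fga_homM fga_hom_x fga_hom_id -!fga_hom_comp.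
  rewrite [X in fga_x F X](_ : _ = val (alpha i)); last exact: addr0.
  move=> <-; congr (_ - _).
  rewrite -[LHS](fga_hom_comp (s i) (eval_at (c (s i * v)%g))).
  apply: eq_fga_hom => -[m1 m2]; rewrite -[LHS]/(s i (m1 + c (s i * v)%g *~ m2)).
  rewrite -[RHS]/(s i m1 - val (alpha i) *~ (k i * m2) + c v *~ m2).
  have -> : s i (m1 + c (s i * v)%g *~ m2) = s i m1 + s i (c (s i * v)%g) *~ m2.
    by rewrite raddfD raddfMz.
  by rewrite kP // mulrzBl mulrzA addrA addrAC.
- exact: theta_div.
- exists (fun v => h v + h' v); first by constructor.
  move=> v vX; rewrite [actS _ _]rmorphD mulrDr -dh // -dh' //.
  by rewrite opprD addrACA.
(* Twisted Leibniz rule for f g, with s_i f written as f - x_i h to remain inside the ring. *)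
- exists (fun v => h v * g v + (f v + (- xr (alpha i)) * h v) * h' v).
    apply: gen_add; first exact: gen_mul.
    apply: gen_mul gh'; apply: gen_add gf _; apply: gen_mul gh; exact: gen_const.
  move=> v vX; rewrite [actS _ _]rmorphM.
  have e : f v + - xr (alpha i) * h v = actS (s i) (f (s i * v)%g).
    by rewrite mulNr -dh // opprB addrC subrK.
  have e' := dh' v vX; have {}dh := dh v vX.
  rewrite e mulrDr mulrA -dh mulrCA -e' mulrBl mulrBr.
  by rewrite addrA subrK.
Qed.

Definition fun_eval f (z : QW) : Q := \sum_(v in WXi) z v * toQ (f v).

Lemma fun_eval_X f i z : i \in Xi -> fun_eval f (X i * z) = xinv (alpha i) *
  (fun_eval f z - actQ (s i) (fun_eval (fun v => actS (s i) (f (s i * v)%g)) z)).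
Proof.
move=> iX; have -> : actQ (s i) (fun_eval (fun v => actS (s i) (f (s i * v)%g)) z) =
    \sum_(v in WXi) actQ (s i) (z (s i * v)%g) * toQ (f v).
  rewrite [LHS]rmorph_sum [RHS](reindex_inj (mulgI (s i))) /=.
  apply: eq_big => v; first by rewrite groupMl // simple_refl_parabolic.
  move=> _; rewrite [LHS]actQ_mul actQ_toQ simple_reflKl -actSM simple_reflK.
  by rewrite actS1.
rewrite /fun_eval -sumrB mulr_sumr; apply: eq_bigr => v _.
by rewrite X_mulE -mulrBl mulrA.
Qed.

(** Pairing [f] with X_i z gives the Demazure operator of the pairing of [f] with z, plus
    x_(-alpha_i) / x_(alpha_i) times the reflected pairing of the divided difference with z.
    Induction on the word then applies to both functions. *)
Lemma fun_gen_inS I f : all (mem Xi) I -> fun_gen f -> inS (fun_eval f (Xword I)).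
Proof.
elim: I f => [|i I IH] f /=.
  move=> _ _; rewrite /fun_eval Xword_nil (bigD1 1%g) //= big1 ?addr0.
    by rewrite QW1E eqxx mul1r; exact: inS_toQ.
  by move=> v /andP[_ /negPf v1]; rewrite QW1E v1 mul0r.
move=> /andP[iX aI] gf; rewrite Xword_cons fun_eval_X //.
have [h gh dh] := fun_gen_div gf iX.
have -> : fun_eval (fun v => actS (s i) (f (s i * v)%g)) (Xword I) =
    fun_eval f (Xword I) - toQ (xr (alpha i)) * fun_eval h (Xword I).
  rewrite /fun_eval mulr_sumr -sumrB; apply: eq_bigr => v vX.
  rewrite mulrCA -toQM -dh // -mulrBr -toQB; congr (_ * toQ _).
  by rewrite opprB addrC subrK.
have [e ->] := IH f aI gf; have [e' ->] := IH h aI gh.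
rewrite actQ_sub actQ_mul !actQ_toQ opprB addrCA mulrDr actS_xr act_alpha.
apply: inSD; last exact: demazure_inS.
rewrite mulrA [xinv _ * _]mulrC; apply: inSM; last exact: inS_toQ.
exact: xinvN_div.
Qed.

Lemma fun_gen_x c : weight_fun c -> fun_gen (fun v => fga_x F (c v)).
Proof.
move=> hc; have := gen_weight (fga_x F (0 : L, 1 : int)) hc.
have -> // : (fun v => fga_hom (eval_at (c v)) (fga_x F (0 : L, 1 : int))) =
  (fun v => fga_x F (c v)).
by apply/funext => v; rewrite fga_hom_x; congr (fga_x F _); exact: add0r.
Qed.

Lemma fun_gen_delta I f t : all (mem Xi) I -> fun_gen f ->
  f 1%g = t -> (forall v, v \in WXi -> v != 1%g -> f v = 0) ->
  inS (toQ t * Xword I 1%g).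
Proof.
move=> aI gf <- f0; have := fun_gen_inS aI gf.
rewrite /fun_eval (bigD1 1%g) //= big1 ?addr0 ?[_ * toQ _]mulrC //.
by move=> v /andP[vX v1]; rewrite f0 // [toQ 0](rmorph0 toQ) mulr0.
Qed.

Lemma fun_gen_prod (J : Type) (r : seq J) (G : J -> W -> S) :
  (forall j, fun_gen (G j)) -> fun_gen (fun v => \prod_(j <- r) G j v).
Proof.
move=> h; elim: r => [|j r IH].
  by rewrite (_ : (fun v => _) = (fun _ => 1)); [constructor|apply/funext => v; rewrite big_nil].
rewrite (_ : (fun v => _) = (fun v => G j v * \prod_(j <- r) G j v)).
  exact: gen_mul.
by apply/funext => v; rewrite big_cons.
Qed.

(** The weight mu / N may lie outside [L], but it pairs integrally with the simple coroots of [Xi].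
    Hence (s_i v mu - mu') / N equals s_i applied to (v mu - mu') / N up to an integral multiple of
    [alpha i], and all values lie in [L] once the one at 1 does. *)
Lemma weight_fun_exists (N : nat) (mu mu' l : L) : (0 < N)%N -> l *+ N = mu - mu' ->
  (forall i, i \in Xi -> exists k, coroot (alpha i) mu = k * N%:Z) ->
  exists c, [/\ weight_fun c, c 1%g = l &
    forall v, v \in WXi -> v mu = mu' -> c v = 0].
Proof.
move=> N0 el hk; have tf (a b : L) : a *+ N = b *+ N -> a = b.
  move=> e; apply/eqP; rewrite -subr_eq0; apply/eqP.
  by apply: (rd_torsion_free rd N0); rewrite mulrnBl e subrr.
have hmu' i k : coroot (alpha i) mu = k * N%:Z ->
    val (alpha i) *~ coroot (alpha i) mu' = val (alpha i) *~ (k - coroot (alpha i) l) *+ N.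
  move=> e; rewrite pmulrn -mulrzA; congr (_ *~ _).
  have := congr1 (coroot (alpha i)) el; rewrite raddfMn raddfB /= e -mulr_natr natz.
  by rewrite mulrBl => ->; rewrite opprB addrC subrK.
have hd (v : W) : v \in WXi -> exists d, d *+ N = v mu - mu'.
  rewrite /parabolic /= => /gen_prodgP[m [cc cX ->]].
  elim: m cc cX => [|m IH] cc cX; first by exists l; rewrite big_ord0 el.
  rewrite big_ord_recl; have [d ed] := IH (fun j => cc (lift ord0 j)) (fun j => cX _).
  have /imsetP[i iX ->] := cX ord0; have [k ek] := hk i iX.
  exists (s i d - val (alpha i) *~ (k - coroot (alpha i) l)).
  rewrite mulrnBl -(hmu' i k ek) -[_ *+ N](raddfMn (s i)) ed raddfB.
  by rewrite -addrA -opprD; congr (_ - _); exact: subrK.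
have /choice[c cP] : forall v : W, exists d, v \in WXi -> d *+ N = v mu - mu'.
  by move=> v; case vX: (v \in WXi); [have [d] := hd v vX; exists d|exists 0].
have c1 : c 1%g = l by apply: tf; rewrite cP ?group1 ?el.
have /choice[k kP] : forall i, exists k : int, i \in Xi -> coroot (alpha i) mu = k * N%:Z.
  by move=> i; case iX: (i \in Xi); [have [k] := hk i iX; exists k|exists 0].
exists c; split=> // [|v vX e]; last by apply: tf; rewrite cP // e subrr mul0rn.
(* This integer is minus the pairing of mu' / N with the coroot of [alpha i]. *)
exists (fun i => coroot (alpha i) l - k i) => i v iX vX; apply: tf.
have sX : (s i * v)%g \in WXi by rewrite groupMl // simple_refl_parabolic.
have lin a b : s i (a - b) = s i a - s i b by exact: raddfB.
have linMn a : s i a *+ N = s i (a *+ N) by rewrite raddfMn.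
rewrite mulrnBl cP // linMn cP // lin.
have -> : val (alpha i) *~ (coroot (alpha i) l - k i) *+ N = - (val (alpha i) *~ coroot (alpha i) mu').
  by rewrite (hmu' i _ (kP i iX)) -mulNrn -mulrNz opprB.
have -> : s i (weyl_fun (s i * v)%g mu) = v mu by exact: weyl_refl2.
by rewrite opprK -addrA weyl_reflE opprB [_ - mu']addrC.
Qed.

End IntegralFunctions.

(** * Cartan integers of a pair of simple roots *)

Section CartanIntegers.
Variables (L : zmodType) (rd : rootDatum L).
Notation roots := (rd_roots rd).
Notation act := (@weyl_act_root L rd).
Notation frm := (@root_form L rd).
Variables (n : nat) (alpha : 'I_n -> roots).
Hypothesis Halpha : simple_system alpha.
Variables (i j : 'I_n).
Hypothesis ij : i != j.
Notation a := (val (alpha i)).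
Notation b := (val (alpha j)).
Notation p := (coroot (alpha i) b).
Notation q := (coroot (alpha j) a).

Definition comb2 (m : int * int) : L := a *~ m.1 + b *~ m.2.

Lemma comb2_inj : injective comb2.
Proof.
move=> [x y] [x' y']; rewrite /comb2 /= => e.
have h := ss_indep Halpha (c := fun k => (k == i)%:R * (x - x') + (k == j)%:R * (y - y')).
have {}h k := h _ k; have {}h : forall k, (k == i)%:R * (x - x') + (k == j)%:R * (y - y') = 0 :> int.
  move=> k; apply: h; rewrite (bigD1 i) //= (bigD1 j) 1?eq_sym //= big1 ?addr0.
    rewrite !eqxx eq_sym (negPf ij) !mul0r !mul1r addr0 add0r !mulrzBr.
    by rewrite addrACA -opprD e subrr.
  by move=> l /andP[/negPf -> /negPf ->]; rewrite !mul0r addr0 mulr0z.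
have := h i; have := h j; rewrite !eqxx eq_sym (negPf ij) !mul0r !mul1r addr0 add0r.
by move=> /eqP; rewrite subr_eq0 => /eqP -> /eqP; rewrite subr_eq0 => /eqP ->.
Qed.

Lemma root_coord_comb2 (c : roots) m : val c = comb2 m ->
  root_coord Halpha c i = m.1 /\ root_coord Halpha c j = m.2.
Proof.
move=> e; have h := @root_coord_uniq _ _ _ _ Halpha c
  (fun k => (k == i)%:R * m.1 + (k == j)%:R * m.2).
split; rewrite h ?eqxx ?(negPf ij) 1?eq_sym ?(negPf ij) ?mul1r ?mul0r ?addr0 ?add0r //.
all: rewrite e (bigD1 i) //= (bigD1 j) 1?eq_sym //= big1 ?addr0;
  first by rewrite !eqxx eq_sym (negPf ij) !mul0r !mul1r addr0 add0r.
all: by move=> l /andP[/negPf -> /negPf ->]; rewrite !mul0r addr0 mulr0z.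
Qed.

(** The reflection of alpha_j in alpha_i has coefficient 1 at j, so it is a positive root, and its
    coefficient at i is -p. *)
Lemma cartan_le0 : p <= 0.
Proof.
have e : val (act (simple_refl alpha i) (alpha j)) = comb2 (- p, 1).
  by rewrite weyl_act_rootE weyl_reflE /comb2 /= mulrNz mulr1z addrC.
have [ci cj] := root_coord_comb2 e.
have : ~~ neg_root alpha (act (simple_refl alpha i) (alpha j)).
  by apply: (@pos_root_gt _ _ _ _ Halpha _ j); rewrite cj.
by move=> /(pos_rootP Halpha)/(_ i); rewrite ci oppr_ge0.
Qed.

Lemma cartan_prod_lt4 : p * q < 4.
Proof.
set A := frm a a; set B := frm b b; set C := frm a b.
have A0 : 0 < A by exact: root_form_gt0.
have B0 : 0 < B by exact: root_form_gt0.
have eC : frm b a = C by rewrite root_formC.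
have eA : A * p = 2 * C by rewrite -eC; exact: root_form_coroot.
have eB : B * q = 2 * C by exact: root_form_coroot.
(* A b - C a is A times the component of b orthogonal to a. Positivity of its norm is the strict
   Cauchy-Schwarz inequality. *)
have eX : frm (comb2 (- C, A)) (comb2 (- C, A)) = A * (A * B - C * C).
  have l y : frm (comb2 (- C, A)) y = - C * frm a y + A * frm b y.
    by rewrite /comb2 root_formDl !root_formMzl.
  rewrite l ![frm _ (comb2 _)]root_formC !l -/A -/B eC -/C; ring.
have : 0 < A * (A * B - C * C).
  rewrite -eX lt_def root_form_ge0 andbT; apply/eqP => /root_form_eq0 e0.
  have : comb2 (- C, A) = comb2 (0, 0) by rewrite e0 /comb2 /= !mulr0z addr0.
  by move=> /comb2_inj [_ A00]; rewrite A00 ltxx in A0.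
rewrite pmulr_rgt0 // subr_gt0 => CAB.
have AB : 0 < A * B by rewrite mulr_gt0.
rewrite -(ltr_pM2l AB); have -> : A * B * (p * q) = (A * p) * (B * q) by ring.
rewrite eA eB; lia.
Qed.

Lemma cartan_eq0 : p = 0 -> q = 0.
Proof.
move=> p0; have e1 := root_form_coroot (alpha i) b.
have e2 := root_form_coroot (alpha j) a.
rewrite root_formC -e1 p0 mulr0 in e2.
have B0 := root_form_gt0 (alpha j).
by move: e2 => /eqP; rewrite mulf_eq0 gt_eqF //= => /eqP.
Qed.

End CartanIntegers.

(** * Explicit data for the rank-two types *)

Section RankTwoComputation.
Let vec := (int * int)%type.

Definition refl1 (p : int) (m : vec) : vec := (- m.1 - p * m.2, m.2).
Definition refl2 (q : int) (m : vec) : vec := (m.1, - m.2 - q * m.1).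
Definition mat_app (t : vec * vec) (m : vec) : vec :=
  (m.1 * t.1.1 + m.2 * t.2.1, m.1 * t.1.2 + m.2 * t.2.2).
Definition mat_id : vec * vec := ((1, 0), (0, 1)).

(* [G] lists the dihedral group; [(mu, mu', l)] in [D] stands for the function
   [v |-> (v mu - mu') / N], with value [l] at 1: for every [v <> 1] in [G] one
   of them vanishes, or [ex v] holds. *)
Definition rank2_check (p q : int) (N : nat) (D : seq (vec * vec * vec))
    (G : seq (vec * vec)) (ex : vec * vec -> bool) : bool :=
  [&& (0 < N)%N, mat_id \in G,
    all (fun t => ((refl1 p t.1, refl1 p t.2) \in G) &&
      ((refl2 q t.1, refl2 q t.2) \in G)) G,
    all (fun d => [&& d.2.1 * N%:Z == d.1.1.1 - d.1.2.1,
      d.2.2 * N%:Z == d.1.1.2 - d.1.2.2,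
      (N %| 2 * d.1.1.1 + p * d.1.1.2)%Z & (N %| q * d.1.1.1 + 2 * d.1.1.2)%Z]) D
    & all (fun t => [|| t == mat_id, has (fun d => mat_app t d.1.1 == d.1.2) D | ex t]) G].

(** A root is named by a word applied to a simple root. This certifies that a vector of the data is
    a root of the dihedral subgroup, which bare coordinates would not do. *)
Definition word_vec (p q : int) (w : seq bool * bool) : vec :=
  foldr (fun c m => if c then refl1 p m else refl2 q m)
    (if w.2 then (1, 0) else (0, 1)) w.1.

Definition A1_group : seq (vec * vec) := [:: ((1, 0), (0, 1)); ((-1, 0), (0, 1)); ((1, 0), (0, -1)); ((-1, 0), (0, -1))].
Definition A2_group : seq (vec * vec) := [:: ((1, 0), (0, 1)); ((-1, 0), (1, 1)); ((1, 1), (0, -1)); ((-1, -1), (1, 0)); ((0, 1), (-1, -1)); ((0, -1), (-1, 0))].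
Definition B2_group : seq (vec * vec) := [:: ((1, 0), (0, 1)); ((-1, 0), (2, 1)); ((1, 1), (0, -1)); ((-1, -1), (2, 1)); ((1, 1), (-2, -1)); ((-1, -1), (0, 1)); ((1, 0), (-2, -1)); ((-1, 0), (0, -1))].
Definition G2_group : seq (vec * vec) := [:: ((1, 0), (0, 1)); ((-1, 0), (3, 1)); ((1, 1), (0, -1)); ((-1, -1), (3, 2)); ((2, 1), (-3, -1)); ((-2, -1), (3, 2)); ((2, 1), (-3, -2)); ((-2, -1), (3, 1)); ((1, 1), (-3, -2)); ((-1, -1), (0, 1)); ((1, 0), (-3, -1)); ((-1, 0), (0, -1))].

(** With N = 2, mu / N is half a simple root, that is, a fundamental weight. *)
Definition A1_data : seq (vec * vec * vec) :=
  [:: ((1, 0), (-1, 0), (1, 0)); ((0, 1), (0, -1), (0, 1))].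
(** Let e1, e2, e3 be the orbit of the fundamental weight (2a + b) / 3. The functions are v e1 - e2,
    v e1 - e3 and v e2 - e3, the linear factors of a double Schubert polynomial of the longest
    permutation. *)
Definition A2_data : seq (vec * vec * vec) :=
  [:: ((2, 1), (-1, 1), (1, 0)); ((2, 1), (-1, -2), (1, 1)); ((-1, 1), (-1, -2), (0, 1))].
(** Here a is short. The orbit of the spin weight y1 = (2a + b) / 2 consists of y1, y2 = b / 2 and
    their opposites. The first three functions compare v y1 with the points other than y1, the last
    one compares v y2 with -y2. *)
Definition B2_data : seq (vec * vec * vec) :=
  [:: ((2, 1), (-2, -1), (2, 1)); ((2, 1), (0, 1), (1, 0)); ((2, 1), (0, -1), (1, 1));
      ((0, 1), (0, -1), (0, 1))].
(** The pattern of [A2_data] for the subsystem of long roots, with the short roots 2a + b, -a, -a -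
    b as the orbit. They lie in the root lattice, hence N = 1. *)
Definition G2_data : seq (vec * vec * vec) :=
  [:: ((2, 1), (-1, 0), (3, 1)); ((2, 1), (-1, -1), (3, 2)); ((-1, 0), (-1, -1), (0, 1))].
Definition G2_short : seq vec := [:: (2, 1); (-1, 0); (-1, -1)].

Lemma A1_check : rank2_check 0 0 2 A1_data A1_group xpred0. Proof. by vm_compute. Qed.
Lemma A2_check : rank2_check (-1) (-1) 3 A2_data A2_group xpred0. Proof. by vm_compute. Qed.
Lemma B2_check : rank2_check (-2) (-1) 2 B2_data B2_group xpred0. Proof. by vm_compute. Qed.
(** The exceptions form the nontrivial coset of the long-root subgroup, where [G2_theta] will
    vanish. *)
Lemma G2_check : rank2_check (-3) (-1) 1 G2_data G2_group
  (fun t => mat_app t (2, 1) \notin G2_short). Proof. by vm_compute. Qed.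
Lemma G2_short_check : all (fun t => let m := mat_app t (2, 1) in
  ((refl1 (-3) m \in G2_short) == (m \notin G2_short)) &&
  ((refl2 (-1) m \in G2_short) == (m \in G2_short))) G2_group. Proof. by vm_compute. Qed.

End RankTwoComputation.

(** * From the numerical check to integrality in rank two *)

Section RankTwoIntegrality.
Variables (R : comNzRingType) (F : fgl R) (L : zmodType) (rd : rootDatum L).
Notation W := (weyl rd).
Notation roots := (rd_roots rd).
Notation act := (@weyl_act_root L rd).
Notation S := (fga F L).
Notation toQ := (@toQ R F L rd).
Notation inS := (@inS R F L rd).
Notation xr := (@x_root R F L rd).
Notation x := (fga_x F).
Hypothesis Hreg : forall (a : roots) (s : S), xr a * s = 0 -> s = 0.
Variables (n : nat) (alpha : 'I_n -> roots).
Hypothesis Halpha : simple_system alpha.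
Notation s := (simple_refl alpha).
Notation Xword := (Xword F alpha).
Variables (i j : 'I_n).
Hypothesis ij : i != j.
Notation a := (val (alpha i)).
Notation b := (val (alpha j)).
Notation Xi := ([set i; j]).
Notation WXi := (parabolic alpha Xi).
Notation comb := (comb2 alpha i j).
Notation pp := (pos_prod F alpha Xi).
Variables (p q : int).
Hypotheses (ep : coroot (alpha i) b = p) (eq : coroot (alpha j) a = q).
Implicit Types (v : W) (m : int * int).

Lemma in_pair k : k \in Xi -> k = i \/ k = j.
Proof. by rewrite !inE => /orP[]/eqP; [left|right]. Qed.

Lemma comb10 : comb (1, 0) = a.
Proof. by rewrite /comb2 mulr1z mulr0z addr0. Qed.
Lemma comb01 : comb (0, 1) = b.
Proof. by rewrite /comb2 mulr1z mulr0z add0r. Qed.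

Lemma act_comb v m : v (comb m) = v a *~ m.1 + v b *~ m.2.
Proof. by rewrite /comb2 raddfD !raddfMz. Qed.

Lemma simple_refl_comb1 m : s i (comb m) = comb (refl1 p m).
Proof.
rewrite act_comb weyl_refl_root weyl_reflE ep /comb2 /= mulrzBl -mulrzA mulNrz.
by rewrite mulrzBr mulrNz addrA addrAC.
Qed.

Lemma simple_refl_comb2 m : s j (comb m) = comb (refl2 q m).
Proof.
rewrite act_comb weyl_refl_root weyl_reflE eq /comb2 /= mulrzBl -mulrzA mulNrz.
by rewrite mulrzBr mulrNz -addrA [_ + - (b *~ _)]addrC.
Qed.

Lemma combB m m' : comb m - comb m' = comb (m.1 - m'.1, m.2 - m'.2).
Proof. by rewrite /comb2 /= !mulrzBr opprD addrACA. Qed.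

Lemma combMn m N : comb m *+ N = comb (m.1 * N%:Z, m.2 * N%:Z).
Proof. by rewrite /comb2 /= mulrnDl !pmulrn !mulrzA. Qed.

Lemma combN m : - comb m = comb (- m.1, - m.2).
Proof. by rewrite /comb2 /= !mulrNz opprD. Qed.

Lemma coroot_comb1 m : coroot (alpha i) (comb m) = 2 * m.1 + p * m.2.
Proof. by rewrite /comb2 raddfD !raddfMz /= rd_coroot2 ep !mulrzz. Qed.

Lemma coroot_comb2 m : coroot (alpha j) (comb m) = q * m.1 + 2 * m.2.
Proof. by rewrite /comb2 raddfD !raddfMz /= rd_coroot2 eq !mulrzz. Qed.

Definition root_of_word (w : seq bool * bool) : roots :=
  act (wword alpha [seq if c then i else j | c : bool <- w.1])
    (alpha (if w.2 then i else j)).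

Lemma root_of_wordE w : val (root_of_word w) = comb (word_vec p q w).
Proof.
case: w => K c; rewrite /root_of_word /word_vec weyl_act_rootE /=.
elim: K => [|d K IH] /=.
  by rewrite wword_nil; case: c; rewrite ?comb10 ?comb01.
rewrite wword_cons weylMx IH; case: d; [exact: simple_refl_comb1|exact: simple_refl_comb2].
Qed.

Lemma root_of_word_par w : weyl_refl (root_of_word w) \in WXi.
Proof.
have sel (c : bool) : (if c then i else j) \in Xi by case: c; rewrite !inE eqxx ?orbT.
rewrite inXi_act ?inXi_alpha //; apply: word_parabolic.
by apply/allP => _ /mapP[c _ ->]; exact: sel.
Qed.

(** Distinct vectors name distinct roots, and one positive coordinate already makes a root positive;
    so each named root is a separate factor of [pp]. *)
Lemma pos_prod_div (ws : seq (seq bool * bool)) :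
  all (fun m : int * int => (0 < m.1) || (0 < m.2)) [seq word_vec p q w | w <- ws] ->
  uniq [seq word_vec p q w | w <- ws] ->
  exists u, pp = (\prod_(m <- [seq word_vec p q w | w <- ws]) x (comb m)) * u.
Proof.
move=> aw uw; pose bs := [seq root_of_word w | w <- ws].
have ub : uniq bs.
  have h w : word_vec p q w = (root_coord Halpha (root_of_word w) i,
      root_coord Halpha (root_of_word w) j).
    have [-> ->] := root_coord_comb2 Halpha ij (root_of_wordE w).
    exact: surjective_pairing.
  by move: uw; rewrite (eq_map h) (map_comp (fun c => (root_coord Halpha c i, root_coord Halpha c j))
    root_of_word) => /map_uniq.
have bP c : c \in bs -> c \in pos_par alpha Xi.
  move=> /mapP[w wws ->]; rewrite in_pos_par root_of_word_par andbT.
  have [e1 e2] := root_coord_comb2 Halpha ij (root_of_wordE w).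
  have /orP[h|h] := allP aw _ (map_f _ wws).
    by apply: (@pos_root_gt _ _ _ _ Halpha _ i); rewrite e1.
  by apply: (@pos_root_gt _ _ _ _ Halpha _ j); rewrite e2.
exists (\prod_(c in pos_par alpha Xi | c \notin bs) xr c).
have -> : \prod_(m <- [seq word_vec p q w | w <- ws]) x (comb m) = \prod_(c <- bs) xr c.
  by rewrite !big_map; apply: eq_bigr => w _; rewrite -root_of_wordE.
rewrite /pos_prod (bigID (fun c => c \in bs)) /=; congr (_ * _).
rewrite big_uniq //=; apply: eq_bigl => c.
by case cb: (c \in bs); rewrite ?andbF ?andbT ?bP.
Qed.

Section Check.
Variables (N : nat) (D : seq ((int * int) * (int * int) * (int * int))).
Variables (G : seq ((int * int) * (int * int))) (ex : (int * int) * (int * int) -> bool).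
Hypothesis Hcheck : rank2_check p q N D G ex.

Lemma orbit_list v : v \in WXi -> exists2 t, t \in G & v a = comb t.1 /\ v b = comb t.2.
Proof.
have /and5P[_ idG /allP cG _ _] := Hcheck.
move=> /gen_prodgP[m [c cX ->]]; elim: m c cX => [|m IH] c cX.
  by exists mat_id => //; rewrite big_ord0 comb10 comb01.
rewrite big_ord_recl.
have [t tG [ta tb]] := IH (fun k => c (lift ord0 k)) (fun k => cX _).
have /andP[g1 g2] := cG t tG.
have /imsetP[k /in_pair[] -> ->] := cX ord0.
  by exists (refl1 p t.1, refl1 p t.2); rewrite ?g1 // !weylMx ta tb !simple_refl_comb1.
by exists (refl2 q t.1, refl2 q t.2); rewrite ?g2 // !weylMx ta tb !simple_refl_comb2.
Qed.

Lemma act_comb_mat v t m : v a = comb t.1 -> v b = comb t.2 ->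
  v (comb m) = comb (mat_app t m).
Proof.
move=> ta tb; rewrite act_comb ta tb /comb2 /mat_app /= !mulrzDl -!mulrzA addrACA -!mulrzDr.
by rewrite ![_ * m.1]mulrC ![_ * m.2]mulrC.
Qed.

(** Such a [v] keeps the simple roots of [Xi] positive, so it is a minimal coset representative
    lying in [WXi] itself. *)
Lemma parabolic_fixed v : v \in WXi -> v a = a -> v b = b -> v = 1%g.
Proof.
move=> vX va vb.
have fixed k : k \in Xi -> act v (alpha k) = alpha k.
  by move=> /in_pair[] ->; apply: val_inj.
have m1 : (1%g : W) \in min_coset_reps alpha Xi.
  by apply/(min_cosetP Halpha) => k _; rewrite act1 (pos_alpha Halpha).
have mv : v \in min_coset_reps alpha Xi.
  by apply/(min_cosetP Halpha) => k kX; rewrite fixed // (pos_alpha Halpha).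
by have [] := coset_uniq Halpha m1 mv vX (esym (mul1g v)).
Qed.

Variable theta : W -> S.
Hypothesis theta_div : forall k, k \in Xi ->
  exists2 h, fun_gen alpha Xi theta h & left_div alpha Xi k theta h.
Hypothesis theta_ex : forall v t, v \in WXi -> t \in G ->
  v a = comb t.1 -> v b = comb t.2 -> ex t -> theta v = 0.

(** At every element other than 1 the check makes a factor vanish: either some [x] is taken at
    weight 0, or [theta] is 0. *)
Lemma rank2_inS I : all (mem Xi) I ->
  inS (toQ (theta 1%g * \prod_(d <- D) x (comb d.2)) * Xword I 1%g).
Proof.
have /and5P[N0 idG _ /allP cD /allP cG] := Hcheck.
move=> aI.
have /choice[c cP] : forall d : (int * int) * (int * int) * (int * int),
    exists c : W -> L, d \in D -> [/\ weight_fun alpha Xi c, c 1%g = comb d.2 &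
      forall v, v \in WXi -> v (comb d.1.1) = comb d.1.2 -> c v = 0].
  move=> d; case dD: (d \in D); last by exists (fun _ => 0).
  have /and4P[/eqP e1 /eqP e2 d1 d2] := cD d dD.
  have [||c hc] := @weight_fun_exists L rd n alpha Xi N (comb d.1.1) (comb d.1.2) (comb d.2) N0.
  - by rewrite combMn combB e1 e2.
  - move=> k /in_pair[] ->; rewrite ?coroot_comb1 ?coroot_comb2.
      by have /dvdzP := d1.
    by have /dvdzP := d2.
  by exists c.
apply: (fun_gen_delta theta_div (f := fun v => theta v * \prod_(d <- D) x (c d v)) aI).
- apply: gen_mul; first exact: gen_theta.
  have -> : (fun v => \prod_(d <- D) x (c d v)) =
      (fun v => \prod_(d <- D) (if d \in D then x (c d v) else 1)).
    by apply/funext => v; rewrite big_seq [RHS]big_seq; apply: eq_bigr => d ->.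
  apply: fun_gen_prod => d; case dD: (d \in D); last exact: gen_const.
  by apply: fun_gen_x; have [] := cP d dD.
- by congr (_ * _); rewrite big_seq [RHS]big_seq; apply: eq_bigr => d dD; have [_ -> _] := cP d dD.
move=> v vX v1; have [t tG [ta tb]] := orbit_list vX.
have /or3P[/eqP e|/hasP[d dD /eqP e]|h] := cG t tG.
- case/eqP: v1; apply: parabolic_fixed => //; first by rewrite ta e comb10.
  by rewrite tb e comb01.
- have [_ _ h] := cP d dD; apply/eqP.
  rewrite (big_rem d) //= h ?fga_x0 ?mul0r ?mulr0 //.
  by rewrite (act_comb_mat _ ta tb) e.
- by rewrite (theta_ex vX tG ta tb h) mul0r.
Qed.

Lemma rank2_integral : (exists u, pp = theta 1%g * \prod_(d <- D) x (comb d.2) * u) ->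
  integral F alpha Xi.
Proof.
move=> [u e]; apply: (integral_from Halpha (group1 _)) => I aI.
rewrite e toQM mulrAC; apply: inSM; [exact: rank2_inS|exact: inS_toQ].
Qed.

End Check.

Lemma rank2_integral_const N D G (ws : seq (seq bool * bool)) :
  rank2_check p q N D G xpred0 ->
  [seq word_vec p q w | w <- ws] = [seq d.2 | d <- D] ->
  all (fun m : int * int => (0 < m.1) || (0 < m.2)) [seq d.2 | d <- D] ->
  uniq [seq d.2 | d <- D] -> integral F alpha Xi.
Proof.
move=> hc ew aw uw; apply: (rank2_integral hc (theta := fun _ => 1)) => // [k kX|].
  exists (fun _ => 0); first exact: gen_const.
  by move=> v _; rewrite [actS _ _]rmorph1 subrr mulr0.
rewrite -ew in aw uw; have [u eu] := pos_prod_div aw uw.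
by exists u; rewrite eu ew mul1r big_map.
Qed.

End RankTwoIntegrality.

(** * From rank two to arbitrary rank *)

Section RankTwoReduction.
Variables (R : comNzRingType) (F : fgl R) (L : zmodType) (rd : rootDatum L).
Notation W := (weyl rd).
Notation roots := (rd_roots rd).
Notation act := (@weyl_act_root L rd).
Notation S := (fga F L).
Notation QW := (QW F rd).
Notation toQ := (@toQ R F L rd).
Notation xinv := (@xinv R F L rd).
Notation inS := (@inS R F L rd).
Notation xr := (@x_root R F L rd).
Hypothesis Hreg : forall (a : roots) (s : S), xr a * s = 0 -> s = 0.
Variables (n : nat) (alpha : 'I_n -> roots).
Hypothesis Halpha : simple_system alpha.
Notation neg := (neg_root alpha).
Notation s := (simple_refl alpha).
Notation word := (wword alpha).
Notation len := (inv_count alpha).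
Notation X := (X_elt F alpha).
Notation Xword := (Xword F alpha).
Notation ws := (@word_span R F L rd n alpha).
Implicit Types (z p q : QW) (u v w : W) (I J K V : seq 'I_n) (Xi : {set 'I_n}).

Lemma X_square i z :
  X i * (X i * z) = (xinv (alpha i) + xinv (opp_root (alpha i))) *: (X i * z).
Proof.
apply/ffunP => u; rewrite X_mulE QWscaleE !X_mulE simple_reflKl actQ_mul.
rewrite actQ_xinv act_alpha actQ_sub -actQM simple_reflK actQ1.
ring.
Qed.

Lemma reduced_tail i I : size (i :: I) = len (word (i :: I)) -> size I = len (word I).
Proof.
rewrite wword_cons /= => e; apply/eqP; rewrite eqn_leq len_word // andbT.
by rewrite -ltnS e len_cons_le.
Qed.

Lemma reduced_head i I : size (i :: I) = len (word (i :: I)) ->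
  neg (act (word (i :: I))^-1%g (alpha i)).
Proof.
move=> e; have := reduced_tail e; rewrite wword_cons act_cons_inv act_alpha act_opp neg_opp //.
move=> e'; apply/negP => h; have := len_desc Halpha h.
by rewrite -e' -wword_cons -e /=; lia.
Qed.

(** The two leading terms cancel, and rank-two integrality supplies the test of [span_of_integral]:
    the braid relation holds up to shorter words. *)
Lemma dihedral_relation i j I J : integral F alpha [set i; j] ->
  all (mem [set i; j]) I -> all (mem [set i; j]) J ->
  word I = wlong alpha [set i; j] -> word J = wlong alpha [set i; j] ->
  size I = len (word I) -> size J = size I ->
  ws [set i; j] (size I) (Xword I - Xword J).
Proof.
set Y := [set i; j] => hY aI aJ eI eJ sI sJ.
apply: (span_of_integral Halpha hY) => [u uX|u Iu|K aK].
- by rewrite QWsubE (Xword_parabolic F aI uX) (Xword_parabolic F aJ uX) subr0.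
- rewrite QWsubE; have [->|ne] := eqVneq u (wlong alpha Y).
    have lead K : size K = size I -> word K = wlong alpha Y ->
        Xword K (wlong alpha Y) = (-1) ^+ size I * \prod_(b in Phi alpha (wlong alpha Y)) xinv b.
      by move=> sK eK; rewrite -{1}eK (Xword_lead F Halpha) ?eK ?sK // sI eI.
    by rewrite !lead ?subrr.
  by rewrite (Xword_eq0 F Halpha Iu) ?eI // (Xword_eq0 F Halpha) ?eJ ?sJ // subr0.
- have h M : all (mem Y) M -> inS (toQ (pos_prod F alpha Y) * Xword M (wlong alpha Y)).
    move=> aM; apply: (hY (size M).+1); last exact: wlong_par.
    exact: word_span_word.
  rewrite mulrBl -!Xword_cat QWsubE mulrBr; apply: inSD; first by apply: h; rewrite all_cat aI.
  by apply: inSN; apply: h; rewrite all_cat aJ.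
Qed.

Hypothesis rank2 : forall i j, i != j -> integral F alpha [set i; j].

Section Fixed.
Variable Xi : {set 'I_n}.

Lemma longest_reduced_word i j : exists K, [/\ all (mem [set i; j]) (i :: K),
  word (i :: K) = wlong alpha [set i; j] & size (i :: K) = len (word (i :: K))].
Proof.
have iY : i \in [set i; j] by rewrite !inE eqxx.
have [|K [aK eK sK]] := parabolic_word Halpha (Xi := [set i; j])
  (w := (s i * wlong alpha [set i; j])%g).
  by rewrite groupM ?wlong_par ?simple_refl_parabolic.
have e : word (i :: K) = wlong alpha [set i; j] by rewrite wword_cons eK simple_reflKl.
exists K; split; [by rewrite /= iY aK|exact: e|].
by rewrite e -(len_desc Halpha (wlongV_neg Halpha iY)) /= sK.
Qed.

(** Matsumoto's theorem with error terms: each braid move changes the product only by shorter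
    words. *)
Lemma reduced_words_eq m I J : all (mem Xi) I -> all (mem Xi) J ->
  word I = word J -> size I = m -> size I = len (word I) -> size J = size I ->
  ws Xi m (Xword I - Xword J).
Proof.
elim: m I J => [|m IH] [|i I] [|j J] //; first by rewrite subrr; constructor.
have same k A B : all (mem Xi) (k :: A) -> all (mem Xi) (k :: B) ->
    word (k :: A) = word (k :: B) -> size (k :: A) = m.+1 ->
    size (k :: A) = len (word (k :: A)) -> size (k :: B) = size (k :: A) ->
    ws Xi m.+1 (Xword (k :: A) - Xword (k :: B)).
  move=> /andP[kX aA] /andP[_ aB] + [sA] rA [sB]; rewrite !wword_cons => /mulgI e.
  rewrite !Xword_cons -mulrBr; apply: word_span_X => //.
  by apply: IH => //; exact: reduced_tail rA.
move=> aI aJ e sI rI sJ; have [ij|ij] := eqVneq i j.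
  by subst j; apply: same.
have rJ : size (j :: J) = len (word (j :: J)) by rewrite sJ -e.
have ni := reduced_head rI; have nj := reduced_head rJ; rewrite -e in nj.
have [v [ev lv]] := dihedral_split Halpha ni nj.
have [K [aK eK rK]] := longest_reduced_word i j.
have [K' [aK' eK' rK']] := longest_reduced_word j i.
have setC : [set j; i] = [set i; j] by rewrite setUC.
rewrite setC in aK' eK'.
have iX : i \in Xi by move: aI => /andP[].
have jX : j \in Xi by move: aJ => /andP[].
have YX : [set i; j] \subset Xi by apply/subsetP => k; rewrite !inE => /orP[]/eqP->.
have sub A : all (mem [set i; j]) A -> all (mem Xi) A.
  by move=> /allP h; apply/allP => k /h /(subsetP YX).
have vX : v \in parabolic alpha Xi.
  have -> : v = ((wlong alpha [set i; j])^-1 * word (i :: I))%g by rewrite ev mulKg.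
  by rewrite groupM ?groupV ?word_parabolic // -eK word_parabolic // sub.
have [V [aV eV sV]] := parabolic_word Halpha vX.
have rKV : size ((i :: K) ++ V) = len (word (i :: I)).
  by rewrite size_cat lv sV rK eK.
have rKV' : size ((j :: K') ++ V) = len (word (i :: I)).
  by rewrite size_cat lv sV rK' eK'.
have eKV : word ((i :: K) ++ V) = word (i :: I) by rewrite wword_cat eK eV -ev.
have eKV' : word ((j :: K') ++ V) = word (i :: I) by rewrite wword_cat eK' eV -ev.
have aKV : all (mem Xi) ((i :: K) ++ V) by rewrite all_cat aV sub.
have aKV' : all (mem Xi) ((j :: K') ++ V) by rewrite all_cat aV sub.
(* The chain is I, (i :: K) ++ V, (j :: K') ++ V, J. The outer steps compare words with a common
   first letter; the middle one is a dihedral relation times [Xword V]. *)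
rewrite -[X in X - _](subrK (Xword ((i :: K) ++ V))) -addrA; apply: word_spanD.
  by apply: same; rewrite ?rKV.
rewrite -[X in X - _](subrK (Xword ((j :: K') ++ V))) -addrA; apply: word_spanD.
  rewrite !Xword_cat -mulrBl.
  have -> : m.+1 = (size (i :: K) + size V)%N by rewrite -size_cat rKV -rI.
  apply: word_span_mulXword => //; apply: word_span_le (leqnn _) YX _.
  apply: dihedral_relation => //; first exact: rank2.
  by apply/eqP; rewrite -(eqn_add2r (size V)) -!size_cat rKV rKV'.
by apply: same; rewrite ?rKV' ?eKV' -?rI // ?sJ -?e.
Qed.

(** Where reducedness first fails, counted from the right, exchange gives the tail a reduced word
    starting with the letter in front of it. The square X_i X_i that arises is a multiple of X_i. *)
Lemma nonreduced_word I : all (mem Xi) I -> (len (word I) < size I)%N ->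
  ws Xi (size I) (Xword I).
Proof.
elim: I => [|i I IH] //= /andP[iX aI] lI; rewrite Xword_cons.
have [nI|rI] := ltnP (len (word I)) (size I).
  by apply: word_span_X => //; exact: IH.
have {}rI : size I = len (word I) by apply/eqP; rewrite eqn_leq rI len_word.
have ni : neg (act (word I)^-1%g (alpha i)).
  apply/negPn/negP => h; move: lI; rewrite wword_cons (len_cons Halpha h) -rI; lia.
have [|K [sK zK eK]] := exchange Halpha (I := I) (b := alpha i).
  by rewrite in_Phi (pos_alpha Halpha).
have aK := all_subseq sK aI.
rewrite -[Xword I](subrK (Xword (i :: K))) mulrDr; apply: word_spanD.
  apply: word_span_X => //; apply: reduced_words_eq => //=; rewrite ?iX //.
  by rewrite wword_cons eK mulgA simple_reflK mul1g.
rewrite Xword_cons X_square; have [t ->] := xinv_opp_sum Hreg (alpha i).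
by rewrite -Xword_cons; apply/word_spanZ/word_span_word; rewrite /= ?iX ?zK.
Qed.

(** Only the coefficient at [wlong] has to be examined. Nonreduced words drop to shorter ones; a
    reduced word of another element vanishes there, and one of [wlong] has coefficient 1 /
    [pos_prod] up to sign. *)
Lemma integral_of_rank2 : integral F alpha Xi.
Proof.
apply: (integral_from Halpha (wlong_par alpha Xi)) => I.
have [m] := ubnP (size I); elim: m I => // m IH I sI aI.
have [nI|rI] := ltnP (len (word I)) (size I).
  elim: (nonreduced_word aI nI) => [|t J z aJ sJ _ h].
    by rewrite QW0E mulr0; exact: inS0.
  rewrite QWaddE QWscaleE mulrDr mulrCA; apply: inSD h.
  apply: inSM; first exact: inS_toQ.
  by apply: IH => //; apply: leq_trans sJ _; rewrite -ltnS.
have {}rI : size I = len (word I) by apply/eqP; rewrite eqn_leq rI len_word.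
have [e|ne] := eqVneq (wlong alpha Xi) (word I).
  rewrite e (Xword_lead F Halpha) // -e (Phi_wlong Halpha) mulrCA mulrC.
  by rewrite [toQ _ * _]mulrC prod_xinvK mul1r; exact: inS_sign.
rewrite (Xword_eq0 F Halpha) // ?mulr0; first exact: inS0.
by rewrite rI; apply: wlong_max => //; exact: word_parabolic.
Qed.

End Fixed.

End RankTwoReduction.

(** * The four Cartan matrices of rank two *)

Section RankTwoCases.
Variables (R : comNzRingType) (F : fgl R) (L : zmodType) (rd : rootDatum L).
Notation W := (weyl rd).
Notation roots := (rd_roots rd).
Notation S := (fga F L).
Notation xr := (@x_root R F L rd).
Notation x := (fga_x F).
Hypothesis Hreg : forall (a : roots) (s : S), xr a * s = 0 -> s = 0.
Variables (n : nat) (alpha : 'I_n -> roots).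
Hypothesis Halpha : simple_system alpha.
Notation s := (simple_refl alpha).

Lemma actS_mul w (t u : S) : actS w (t * u) = actS (rd := rd) w t * actS w u.
Proof. exact: rmorphM. Qed.

Section G2.
Variables (i j : 'I_n).
Hypothesis ij : i != j.
Notation a := (val (alpha i)).
Notation b := (val (alpha j)).
Notation Xi := ([set i; j]).
Notation WXi := (parabolic alpha Xi).
Notation comb := (comb2 alpha i j).
Hypotheses (ep : coroot (alpha i) b = -3) (eq : coroot (alpha j) a = -1).

Let short_mem (v : W) := v (comb (2, 1)) \in [seq comb m | m <- G2_short].
Let x123 : S := x (comb (2, 1)) * x (comb (-1, 0)) * x (comb (-1, -1)).

(* The short roots 2a+b, -a, -a-b are permuted by the long reflections and
   exchanged with their opposites by the short ones. *)
Definition G2_theta (v : W) : S := if short_mem v then x123 else 0.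

Let mem_comb m : (comb m \in [seq comb m | m <- G2_short]) = (m \in G2_short).
Proof. by rewrite mem_map //; exact: comb2_inj. Qed.

Let comb1 : - a = comb (-1, 0).
Proof. by rewrite /comb2 /= mulr0z addr0 mulrNz mulr1z. Qed.

Lemma G2_theta_div k : k \in Xi ->
  exists2 h, fun_gen alpha Xi G2_theta h & left_div alpha Xi k G2_theta h.
Proof.
have orb (v : W) : v \in WXi -> exists2 t, t \in G2_group & v (comb (2, 1)) = comb (mat_app t (2, 1)).
  move=> vX; have [t tG [ta tb]] := orbit_list ep eq G2_check vX.
  by exists t => //; exact: act_comb_mat.
have sh := allP G2_short_check.
case/in_pair => ->; last first.
  exists (fun _ => 0); first exact: gen_const.
  move=> v vX; rewrite mulr0 /G2_theta /short_mem weylMx; have [t tG ->] := orb v vX.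
  have /andP[_ /eqP e] := sh t tG; rewrite (simple_refl_comb2 eq) !mem_comb e.
  case: ifP => _; last by rewrite [actS _ 0]rmorph0 subrr.
  rewrite /x123 !actS_mul !actS_x.
  rewrite !(simple_refl_comb2 eq) /refl2 /=.
  by rewrite mulrAC subrr.
pose r := @xN_ratio R F L.
have reg1 : x_regular F (comb (-1, 0)).
  move=> t; rewrite -comb1 -opp_rootE; exact: (Hreg (a := opp_root (alpha i))).
have reg2 : x_regular F (comb (2, 1)).
  move=> t; rewrite -(root_of_wordE ep eq ([:: true; false], true)).
  exact: (Hreg (a := root_of_word alpha i j _)).
have sum0 : comb (-1, 0) + comb (2, 1) + comb (-1, -1) = 0.
  have combD m m' : comb m + comb m' = comb (m.1 + m'.1, m.2 + m'.2).
    by rewrite /comb2 !mulrzDr addrACA.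
  rewrite !combD.
  rewrite [X in comb X](_ : _ = (0, 0)); last by [].
  by rewrite /comb2 !mulr0z addr0.
have [t et] := xN_ratio3 reg1 reg2 sum0.
pose Y := x (comb (2, 1)) * r a * x (comb (-1, -1)).
pose U := r (comb (-1, 0)) * r (comb (2, 1)) * r (comb (-1, -1)).
have ex2 : x (comb (-1, 0)) = xr (alpha i) * r a by rewrite -comb1 xN_ratioE.
have e123 : x123 = xr (alpha i) * Y by rewrite /x123 /Y ex2; ring.
have act123 : actS (s i) x123 = x123 * U.
  rewrite {1}/x123 !actS_mul !actS_x.
  rewrite !(simple_refl_comb1 ep) /refl1 /=.
  have n1 : comb (1, 1) = - comb (-1, -1) by rewrite combN.
  have n2 : comb (1, 0) = - comb (-1, 0) by rewrite combN.
  have n3 : comb (-2, -1) = - comb (2, 1) by rewrite combN.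
  rewrite [X in x (comb X) * _ * _](_ : _ = (1, 1)) //.
  rewrite [X in _ * x (comb X) * _](_ : _ = (1, 0)) //.
  rewrite [X in _ * x (comb X)](_ : _ = (-2, -1)) //.
  by rewrite n1 n2 n3 !xN_ratioE /x123 /U; rewrite -/r; ring.
(* The quotient has to be Y on the long-root subgroup and -(Y U) off it. By [xN_ratio3] the
   difference Y (1 + U) equals [r a * t * x123], so the quotient is a constant plus a constant
   multiple of [G2_theta]. *)
exists (fun v => - (Y * U) + r a * t * G2_theta v).
  by apply: gen_add; [exact: gen_const|apply: gen_mul; [exact: gen_const|exact: gen_theta]].
move=> v vX; rewrite /G2_theta /short_mem weylMx; have [m mG ->] := orb v vX.
have /andP[/eqP e _] := sh m mG; rewrite (simple_refl_comb1 ep) !mem_comb e.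
case: (mat_app m (2, 1) \in G2_short) => /=.
  have eU : 1 + U = xr (alpha i) * r a * t by rewrite -ex2 -et.
  rewrite [actS _ 0]rmorph0 subr0.
  transitivity (- (xr (alpha i) * Y) * U + xr (alpha i) * r a * t * x123); last by ring.
  by rewrite -e123 -eU; ring.
by rewrite act123 mulr0 addr0 sub0r e123; ring.
Qed.

Lemma G2_integral : integral F alpha Xi.
Proof.
apply: (rank2_integral Halpha ep eq G2_check G2_theta_div) => [v t vX tG ta tb|].
  by rewrite /G2_theta /short_mem (act_comb_mat _ ta tb) mem_comb => /negPf ->.
(* These words name all six positive roots. [G2_theta] contributes -a and -a - b in place of a and a
   + b; [t1] and [t2] convert them. *)
pose ws : seq (seq bool * bool) := [:: ([:: true; false], true); ([::], true); ([:: false], true);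
  ([:: true], false); ([:: false; true], false); ([::], false)].
have [||u eu] := @pos_prod_div R F L rd n alpha Halpha i j ij _ _ ep eq ws; [by []|by []|].
have xd m : exists t, x (comb m) = x (comb (- m.1, - m.2)) * t.
  have [t] := fga_xN_div F (comb (- m.1, - m.2)); rewrite combN /= !opprK.
  by rewrite -[(m.1, m.2)]surjective_pairing; exists t.
have [t1 e1] := xd (1, 0); have [t2 e2] := xd (1, 1).
exists (t1 * t2 * u); rewrite eu /G2_theta /short_mem.
rewrite -[weyl_fun 1%g _]/(comb (2, 1)) mem_comb.
rewrite (_ : [seq word_vec (-3) (-1) w | w <- ws] =
  [:: (2, 1); (1, 0); (1, 1); (3, 1); (3, 2); (0, 1)]) //.
rewrite (_ : (2, 1) \in G2_short) // /x123 /G2_data !big_cons !big_nil e1 e2 /=.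
ring.
Qed.

End G2.

(** The inequality orders the pair so that only the four Cartan matrices of the data occur. *)
Lemma rank2_le (i j : 'I_n) : i != j ->
  `|coroot (alpha j) (val (alpha i))| <= `|coroot (alpha i) (val (alpha j))| ->
  integral F alpha [set i; j].
Proof.
move=> ij; have ji : j != i by rewrite eq_sym.
have q0 := cartan_le0 Halpha ij; have p0 := cartan_le0 Halpha ji.
have := cartan_prod_lt4 Halpha ij.
have z1 := @cartan_eq0 _ _ _ alpha i j; have z2 := @cartan_eq0 _ _ _ alpha j i.
set p := coroot (alpha i) _ in q0 z1 z2 *; set q := coroot (alpha j) _ in p0 z1 z2 *.
move=> pq4 qp.
have hpq : p = 0 /\ q = 0 \/ p = -1 /\ q = -1 \/ p = -2 /\ q = -1 \/ p = -3 /\ q = -1.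
  have [q1|q1] : q = 0 \/ q <= -1 by lia.
    by left; split => //; exact: z2.
  have [p1|p1] : p = 0 \/ p <= -1 by lia.
    by left; split => //; exact: z1.
  by right; nia.
case: hpq => [[ep eq]|[[ep eq]|[[ep eq]|[ep eq]]]].
- by apply: (rank2_integral_const Halpha ij ep eq A1_check (ws := [:: ([::], true); ([::], false)])).
- by apply: (rank2_integral_const Halpha ij ep eq A2_check
    (ws := [:: ([::], true); ([:: true], false); ([::], false)])).
- by apply: (rank2_integral_const Halpha ij ep eq B2_check
    (ws := [:: ([:: true], false); ([::], true); ([:: false], true); ([::], false)])).
- exact: G2_integral.
Qed.

Lemma integral_all Xi : integral F alpha Xi.
Proof.
apply: (integral_of_rank2 Hreg Halpha) => i j ij.
have [h|/ltW h] := leP `|coroot (alpha j) (val (alpha i))| `|coroot (alpha i) (val (alpha j))|.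
  exact: rank2_le.
by rewrite setUC; apply: rank2_le; rewrite // eq_sym.
Qed.

End RankTwoCases.

(** * The push-pull element in D_F and the integrality of [fe_tilde] *)

Section PushPull.
Variables (R : comNzRingType) (F : fgl R) (L : zmodType) (rd : rootDatum L).
Notation W := (weyl rd).
Notation roots := (rd_roots rd).
Notation S := (fga F L).
Notation Q := (QF F rd).
Notation QW := (QW F rd).
Notation toQ := (@toQ R F L rd).
Notation xinv := (@xinv R F L rd).
Notation inS := (@inS R F L rd).
Notation xr := (@x_root R F L rd).
Hypothesis Hreg : forall (a : roots) (s : S), xr a * s = 0 -> s = 0.
Variables (n : nat) (alpha : 'I_n -> roots).
Hypothesis Halpha : simple_system alpha.
Notation neg := (neg_root alpha).
Notation s := (simple_refl alpha).
Notation len := (inv_count alpha).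
Notation X := (X_elt F alpha).
Notation Y := (Y_elt F alpha).
Variable Xi : {set 'I_n}.
Notation WXi := (parabolic alpha Xi).
Notation PXi := (pos_par alpha Xi).
Notation wl := (wlong alpha Xi).
Notation Pos := (pos_par alpha setT).
Notation YXi := (Y_Xi F alpha Xi).
Implicit Types (z p q : QW) (u v w y : W).

Lemma wlongV (Z : {set 'I_n}) : (wlong alpha Z)^-1%g = wlong alpha Z.
Proof.
apply: (wlong_uniq Halpha); first by rewrite groupV wlong_par.
by move=> i iZ; rewrite invgK wlong_neg.
Qed.

Lemma prod_opp (Z : {set 'I_n}) (G : roots -> S) :
  \prod_(a : roots | neg a && (weyl_refl a \in parabolic alpha Z)) G a =
  \prod_(b in pos_par alpha Z) G (opp_root b).
Proof.
rewrite [LHS](reindex_inj (inv_inj (@opp_rootK _ _))) /=; apply: eq_bigl => b.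
by rewrite in_pos_par weyl_refl_opp (neg_opp Halpha).
Qed.

Lemma x_XiE : x_Xi F alpha Xi = \prod_(b in PXi) xr (opp_root b).
Proof. exact: prod_opp. Qed.

Lemma x_PiE : x_Pi F alpha = \prod_(b in Pos) xr (opp_root b).
Proof.
rewrite -(prod_opp setT); apply: eq_bigl => b.
by rewrite (parabolicT Halpha) andbT.
Qed.

Definition inv_x_Xi : Q := \prod_(b in PXi) xinv (opp_root b).

Lemma inv_x_XiE : Q_frac rd 1 (x_Xi F alpha Xi) = inv_x_Xi.
Proof.
have e1 : Q_frac rd 1 (x_Xi F alpha Xi) * toQ (x_Xi F alpha Xi) = 1.
  by rewrite [LHS]Q_fracK ?[LHS]toQ1 //; exact: x_Xi_xprod.
have e2 : inv_x_Xi * toQ (x_Xi F alpha Xi) = 1.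
  rewrite x_XiE /inv_x_Xi [X in _ * X]rmorph_prod -big_split big1 // => b _.
  exact: xinvK.
by rewrite -[LHS]mulr1 -e2 mulrCA e1 mulr1.
Qed.

Lemma Y_XiE u : YXi u = if u \in WXi then actQ u inv_x_Xi else 0.
Proof.
rewrite /Y_Xi mul_Q_inclE inv_x_XiE QWsumE; case: ifP => uX.
  rewrite (bigD1 u) //= big1 => [|v /andP[_ /negPf vu]]; last by rewrite deltaE eq_sym vu.
  by rewrite deltaE eqxx addr0 mul1r.
rewrite big1 ?mul0r // => v vX; rewrite deltaE; case: eqP => // e.
by rewrite e vX in uX.
Qed.

Lemma mul_X_E z i u : (z * X i) u =
  z u * actQ u (xinv (alpha i)) - z (u * s i)%g * actQ (u * s i)%g (xinv (alpha i)).
Proof.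
rewrite /X_elt mulrA [LHS](_ : _ = (z * Q_incl (xinv (alpha i)) -
  z * Q_incl (xinv (alpha i)) * delta F (s i)) u).
  by rewrite QWsubE mul_deltaE !mul_Q_inclE simple_reflV.
by rewrite [in LHS]mulrBr mulr1.
Qed.

(** s_i permutes the positive roots of [WXi] other than alpha_i and exchanges the two remaining
    factors, the inverses of x at alpha_i and at -alpha_i. *)
Lemma inv_x_Xi_simple i : i \in Xi ->
  actQ (s i) (inv_x_Xi * xinv (alpha i)) = inv_x_Xi * xinv (alpha i).
Proof.
move=> iX; have aP := alpha_pos_par Halpha iX.
rewrite /inv_x_Xi (big_setD1 _ aP) /= !actQ_mul !actQ_xinv act_opp act_alpha opp_rootK.
have -> : actQ (s i) (\prod_(b in PXi :\ alpha i) xinv (opp_root b)) =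
    \prod_(b in PXi :\ alpha i) xinv (opp_root b).
  rewrite [LHS]rmorph_prod -[in RHS](act_simple_pos_par Halpha iX).
  rewrite big_imset /=; last by move=> b b' _ _ /act_inj.
  by apply: eq_bigr => b _; rewrite [LHS]actQ_xinv act_opp.
by ring.
Qed.

Lemma Y_Xi_X i : i \in Xi -> YXi * X i = 0.
Proof.
move=> iX; apply/ffunP => u; rewrite mul_X_E QW0E !Y_XiE.
have -> : ((u * s i)%g \in WXi) = (u \in WXi) by rewrite groupMr // simple_refl_parabolic.
case: ifP => _; last by rewrite !mul0r subrr.
by rewrite -!actQ_mul actQM inv_x_Xi_simple // subrr.
Qed.

Lemma delta_Y_Xi w : w \in WXi -> delta F w * YXi = YXi.
Proof.
move=> wX; apply/ffunP => u; rewrite delta_mulE !Y_XiE groupMl ?groupV //.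
by case: ifP => _; rewrite ?[LHS](rmorph0 (actQ w)) // -actQM mulKVg.
Qed.

(** By [Y_Xi_X] the test of [span_of_integral] is nontrivial only for the empty word, and there the
    coefficient at the longest element is exactly 1 / [pos_prod]. *)
Lemma Y_Xi_DF : DF alpha YXi.
Proof.
have hX : integral F alpha Xi by exact: integral_all.
apply: (word_span_DF (Xi := Xi) (k := (len wl).+1)).
apply: (span_of_integral Halpha hX) => [u uX|u lu|[|i J] aJ].
- by rewrite Y_XiE (negPf uX).
- rewrite Y_XiE; case: ifP => // uX; have := wlong_max uX.
  by rewrite leqNgt lu.
- rewrite Xword_nil mulr1 Y_XiE wlong_par /inv_x_Xi [actQ _ _]rmorph_prod.
  have -> : \prod_(b in PXi) GRing.RMorphism.sort (actQ wl) (xinv (opp_root b)) =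
      \prod_(b in PXi) xinv b.
    rewrite -[in RHS](act_wlong_pos_par Halpha Xi) big_imset /=; last first.
      by move=> b b' _ _ /act_inj /(inv_inj (@opp_rootK _ _)).
    by apply: eq_bigr => b _; exact: actQ_xinv.
  by rewrite mulrC prod_xinvK; exact: inS1.
- move: aJ => /andP[iX _].
  by rewrite Xword_cons mulrA Y_Xi_X // mul0r QW0E mulr0; exact: inS0.
Qed.

Lemma Y_elt_DF i : DF alpha (Y i).
Proof.
have [t et] := xinv_opp_sum Hreg (alpha i).
have -> : Y i = Q_incl (toQ t) - X i.
  apply/ffunP => u; rewrite -[Y i]mulr1 -[X i]mulr1 QWsubE Y_mulE X_mulE.
  by rewrite -[Q_incl _]mulr1 Q_incl_mul QWscaleE -et; ring.
have -> : - X i = Q_incl (toQ (-1)) * X i.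
  by rewrite Q_incl_mul [toQ _]rmorphN1 scaleN1r.
apply: DF_add; first exact: DF_scal.
by apply: DF_mul; [exact: DF_scal|exact: DF_X].
Qed.

Lemma fe_tildeE z : fe_tilde F alpha z = z 1%g * toQ (x_Pi F alpha).
Proof.
rewrite -[LHS]/((z * Q_incl (toQ (x_Pi F alpha))) 1%g) mul_Q_inclE.
by rewrite actQ1.
Qed.

Lemma xr_opp_prod (A : {set roots}) :
  exists t, \prod_(b in A) xr (opp_root b) = (\prod_(b in A) xr b) * t.
Proof.
have /choice[t tP] : forall b, exists t, xr (opp_root b) = xr b * t.
  by move=> b; have [t e] := fga_xN_div F (val b); exists t; rewrite -e /x_root opp_rootE.
exists (\prod_(b in A) t b); rewrite -big_split; apply: eq_bigr => b _; exact: tP.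
Qed.

Lemma xr_prod_opp (A : {set roots}) :
  exists t, \prod_(b in A) xr b = (\prod_(b in A) xr (opp_root b)) * t.
Proof.
have /choice[t tP] : forall b, exists t, xr b = xr (opp_root b) * t.
  move=> b; have [t e] := fga_xN_div F (val (opp_root b)); exists t.
  by rewrite -e /x_root opp_rootE opprK.
exists (\prod_(b in A) t b); rewrite -big_split; apply: eq_bigr => b _; exact: tP.
Qed.

Lemma fe_tilde_DF z : DF alpha z -> inS (fe_tilde F alpha z).
Proof.
move=> /DF_word_span[k hk]; rewrite fe_tildeE x_PiE.
have [t ->] := xr_opp_prod Pos; rewrite toQM mulrA; apply: inSM (inS_toQ _ _).
rewrite mulrC; exact: (integral_all Hreg Halpha hk (group1 _)).
Qed.

End PushPull.

Lemma lead_cancel (A : comPzRingType) (a b g t p : A) :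
  g * p * a = 1 -> a * b * (g * (t * p)) = t * b.
Proof. by move=> h; rewrite -[RHS]mul1r -h; ring. Qed.

Lemma top_cancel (A : comPzRingType) (a b e f p x : A) :
  e * e = 1 -> f * f = 1 -> p * (a * b) = 1 ->
  x = e * f * (b * (e * p * x)) * (f * a).
Proof.
move=> ee ff h; transitivity ((p * (a * b)) * (e * e) * (f * f) * x); last by ring.
by rewrite h ee ff !mul1r.
Qed.

(** * Triangularity of the two families and the basis property *)

Section TriangularFamily.
Variables (R : comNzRingType) (F : fgl R) (L : zmodType) (rd : rootDatum L).
Notation W := (weyl rd).
Notation roots := (rd_roots rd).
Notation act := (@weyl_act_root L rd).
Notation S := (fga F L).
Notation Q := (QF F rd).
Notation QW := (QW F rd).
Notation toQ := (@toQ R F L rd).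
Notation xinv := (@xinv R F L rd).
Notation inS := (@inS R F L rd).
Notation xr := (@x_root R F L rd).
Hypothesis Hreg : forall (a : roots) (s : S), xr a * s = 0 -> s = 0.
Variables (n : nat) (alpha : 'I_n -> roots).
Hypothesis Halpha : simple_system alpha.
Notation s := (simple_refl alpha).
Notation word := (wword alpha).
Notation Phi := (Phi alpha).
Notation len := (inv_count alpha).
Notation Xword := (Xword F alpha).
Variable Xi : {set 'I_n}.
Notation WXi := (parabolic alpha Xi).
Notation WmXi := (min_coset_reps alpha Xi).
Notation PXi := (pos_par alpha Xi).
Notation wl := (wlong alpha Xi).
Notation w0 := (wlong alpha setT).
Notation Pos := (pos_par alpha setT).
Notation YXi := (Y_Xi F alpha Xi).
Implicit Types (z p q : QW) (u v w y : W).

Lemma prod_xinv_opp (A : {set roots}) :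
  (\prod_(b in A) xinv (opp_root b)) * toQ (\prod_(b in A) xr (opp_root b)) = 1.
Proof. rewrite [X in _ * X]rmorph_prod -big_split big1 // => b _; exact: xinvK. Qed.

Lemma Phi_inv u : Phi u = [set opp_root (act u b) | b in Phi u^-1%g].
Proof.
apply/setP => c; apply/idP/imsetP => [|[b + ->]].
  rewrite in_Phi => /andP[pc nc]; exists (opp_root (act u^-1%g c)).
    by rewrite in_Phi invgK act_opp actVK !(neg_opp Halpha) nc pc.
  by rewrite act_opp actVK opp_rootK.
rewrite !in_Phi invgK act_opp actK !(neg_opp Halpha) negbK.
by move=> /andP[-> ->].
Qed.

Variables (T : 'I_n -> QW) (c : 'I_n -> Q) (e : bool).
Hypothesis TE : forall i z u, (T i * z) u = c i * z u +
  (-1) ^+ e * xinv (alpha i) * actQ (s i) (z (s i * u)%g).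
Hypothesis T_DF : forall i, DF alpha (T i).
Variable rI : W -> seq 'I_n.
Hypothesis HI : forall u, u \in WmXi -> is_reduced alpha (rI u) u.

Let Tw I := \prod_(i <- I) T i.

Definition push_family u z : Q := fe_tilde F alpha (z * YXi * Tw (rev (rI u))).
Notation fam := push_family.

Let rI_word u : u \in WmXi -> word (rev (rI u)) = u^-1%g.
Proof. by move=> /HI[e1 _]; rewrite wword_rev e1. Qed.

Let rI_size u : u \in WmXi -> size (rev (rI u)) = len u.
Proof. by move=> /HI[_ e1]; rewrite size_rev e1 wlenE. Qed.

Lemma fam_delta u v : fam u (delta F v) = toQ (x_Pi F alpha) *
  \sum_(w in WXi) actQ (v * w)%g (inv_x_Xi F alpha Xi) *
    actQ (v * w)%g (Tw (rev (rI u)) (v * w)^-1%g).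
Proof.
rewrite /fam fe_tildeE mulrC -mulrA delta_mulE mulg1 QWmulE; congr (_ * _).
rewrite [LHS](rmorph_sum (actQ v)) [RHS]big_mkcond; apply: eq_bigr => w _.
rewrite -[LHS]/(actQ v (YXi w * actQ w (Tw (rev (rI u)) (w^-1 * v^-1)%g))).
have -> : (w^-1 * v^-1)%g = (v * w)^-1%g by rewrite invMg.
rewrite actQ_mul (Y_XiE F Halpha); case: ifP => _; first by rewrite -!actQM.
by rewrite [actQ v 0](rmorph0 (actQ v)) mul0r.
Qed.

Lemma fam_delta_eq0 u v : u \in WmXi -> v \in WmXi -> (len u <= len v)%N -> v != u ->
  fam u (delta F v) = 0.
Proof.
move=> uX vX uv vu; rewrite fam_delta big1 ?mulr0 // => w wX.
rewrite [Tw _ _](prod_eq0 Halpha TE) ?[actQ _ 0]rmorph0 ?mulr0 //.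
  by rewrite rI_size // (lenV Halpha) (len_coset Halpha vX wX) (leq_trans uv) ?leq_addr.
rewrite rI_word // (inj_eq invg_inj); apply: contra vu => /eqP e1.
by have [<- _] := coset_uniq Halpha vX uX wX (esym e1).
Qed.

(** The P_u of the overview: [w0] exchanges signs, so this [Phi] is the complement of [Phi (u * wl)]
    in the positive roots. *)
Definition fam_lead u : S := \prod_(b in Phi (u * wl * w0)%g) xr (opp_root b).

Lemma fam_delta_lead u : u \in WmXi ->
  fam u (delta F u) = (-1) ^+ (e * len u) * toQ (fam_lead u).
Proof.
move=> uX; rewrite fam_delta (bigD1 1%g) ?group1 //= big1 ?addr0 => [|w /andP[wX w1]].
  rewrite mulg1 -(rI_word uX) [Tw _ _](prod_lead Halpha TE); last first.
    by rewrite rI_size // rI_word // (lenV Halpha).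
  rewrite rI_size // rI_word // actQ_mul actQ_sign.
  have -> : actQ u (\prod_(b in Phi u^-1%g) xinv b) = \prod_(b in Phi u) xinv (opp_root b).
    rewrite [in RHS]Phi_inv big_imset /=; last first.
      by move=> b b' _ _ /(inv_inj (@opp_rootK _ _)) /act_inj.
    rewrite [LHS]rmorph_prod; apply: eq_bigr => b _.
    by rewrite opp_rootK; exact: actQ_xinv.
  have -> : actQ u (inv_x_Xi F alpha Xi) =
      \prod_(b in [set act u b | b in PXi]) xinv (opp_root b).
    rewrite big_imset /=; last by move=> b b' _ _ /act_inj.
    rewrite [LHS]rmorph_prod; apply: eq_bigr => b _.
    by rewrite [LHS]actQ_xinv act_opp.
  have wlX := wlong_par alpha Xi.
  (* [x_Pi] is split along [Phi (u * wl)], the disjoint union of u [PXi] and [Phi u]. That part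
     cancels against the denominators of [YXi] and of the leading term. *)
  rewrite (x_PiE F Halpha) (big_setID (Phi (u * wl)%g)) /= -(Phi_mul_wlong Halpha) toQM.
  rewrite (setIidPr (Phi_par Halpha (parabolicT Halpha _))).
  have e1 : (\prod_(b in [set act u b | b in PXi]) xinv (opp_root b)) *
      (\prod_(b in Phi u) xinv (opp_root b)) = \prod_(b in Phi (u * wl)%g) xinv (opp_root b).
    rewrite (Phi_coset Halpha uX wlX) (Phi_wlong Halpha).
    rewrite mulrC -bigU; last by rewrite -(Phi_wlong Halpha) Phi_coset_disjoint.
    by apply: eq_bigl => b; rewrite inE in_setU.
  rewrite -/(fam_lead u); have := prod_xinv_opp (Phi (u * wl)%g); rewrite -e1.
  exact: lead_cancel.
rewrite [Tw _ _](prod_eq0 Halpha TE) ?[actQ _ 0]rmorph0 ?mulr0 //.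
  by rewrite rI_size // (lenV Halpha) (len_coset Halpha uX wX) leq_addr.
rewrite rI_word // (inj_eq invg_inj); apply: contra w1 => /eqP e1.
by rewrite -(mulKg u w) e1 mulVg.
Qed.

Lemma fam_lead_reg u t : fam_lead u * t = 0 -> t = 0.
Proof.
rewrite /fam_lead; elim/big_rec: _ => [|b d _ IH]; first by rewrite mul1r.
by rewrite -mulrA => /Hreg.
Qed.

(** Stated for bare functions, so that remainders can be formed without constructing linear
    forms. *)
Definition dual_inv (f : QW -> Q) :=
  [/\ forall a z z', f (a *: z + z') = a * f z + f z', forall z, DF alpha z -> inS (f z)
    & forall w z, w \in WXi -> f (z * delta F w) = f z].

Section Dual.
Variable f : QW -> Q.
Hypothesis hf : dual_inv f.

Lemma dual0 : f 0 = 0.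
Proof.
have [lf _ _] := hf; have := lf 1 0 0; rewrite scaler0 addr0 mul1r.
by move=> /eqP; rewrite -subr_eq subrr eq_sym => /eqP.
Qed.

Lemma dualE z : f z = \sum_u z u * f (delta F u).
Proof.
have [lf _ _] := hf; have zE : z = \sum_u z u *: delta F u.
  apply/ffunP => u; rewrite QWsumE (bigD1 u) //= big1 ?addr0 => [|v /negPf vu].
    by rewrite QWscaleE deltaE eqxx mulr1.
  by rewrite QWscaleE deltaE eq_sym vu mulr0.
rewrite {1}zE; elim/big_rec2: _ => [|u a b _ <-]; first exact: dual0.
exact: lf.
Qed.

Lemma dual_coset v w : w \in WXi -> f (delta F (v * w)%g) = f (delta F v).
Proof. by move=> wX; have [_ _ h] := hf; rewrite delta_mul h. Qed.

Lemma dual_top v : v \in WmXi ->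
  (forall u, u \in WmXi -> (len v < len u)%N -> f (delta F u) = 0) ->
  exists t, f (delta F v) = toQ t * fam v (delta F v).
Proof.
move=> vX h; have wlX := wlong_par alpha Xi.
have [J eJ sJ] := reduced_word Halpha (v * wl * w0)%g.
have zD : DF alpha (Xword J * delta F w0).
  have [k hk] := word_span_delta F Halpha (parabolicT Halpha w0).
  have aJ : all (mem [set: 'I_n]) J by apply/allP => i _; rewrite /= inE.
  exact: word_span_DF (word_span_mul (word_span_word F alpha aJ (ltnSn _)) hk).
have [_ fD _] := hf; have [t et] := fD _ zD.
(* In the sum over y only y = v wl survives: on cosets of longer representatives [f] vanishes, and
   elsewhere y w0 is at least as long as [J], where [Xword J] has no other coefficient. *)
have fE : f (Xword J * delta F w0) =
    (-1) ^+ size J * (\prod_(b in Phi (v * wl * w0)%g) xinv b) * f (delta F v).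
  rewrite dualE (bigD1 (v * wl)%g) //= big1 ?addr0 => [|y yv].
    rewrite dual_coset // mul_deltaE (wlongV Halpha) -{1}eJ.
    by rewrite (Xword_lead F Halpha) ?eJ.
  have [y' [w' [y'X w'X ey]]] := coset_decomp Halpha Xi y.
  have [vy|yv'] := ltnP (len v) (len y').
    by rewrite ey dual_coset // h // mulr0.
  rewrite mul_deltaE (wlongV Halpha) (Xword_eq0 F Halpha) ?mul0r //; last first.
    by rewrite eJ (inj_eq (mulIg _)).
  have e1 := len_mul_wlong Halpha y; have e2 := len_mul_wlong Halpha (v * wl)%g.
  have e3 := len_coset Halpha y'X w'X; rewrite -ey in e3.
  have e4 := len_coset Halpha vX wlX; have e5 := wlong_max w'X.
  by rewrite sJ; lia.
(* The evaluation yields a denominator over positive roots, while [fam_lead] is a product over their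
   opposites; [d] converts one into the other. *)
have [d ed] := xr_prod_opp F (Phi (v * wl * w0)%g).
exists ((-1) ^+ size J * (-1) ^+ (e * len v) * (d * t)).
have ss k' : (-1) ^+ k' * (-1) ^+ k' = 1 :> Q by rewrite -expr2 sqrr_sign.
rewrite fam_delta_lead // !toQM !toQ_sign -et fE.
have := prod_xinvK F (Phi (v * wl * w0)%g); rewrite ed toQM -/(fam_lead v).
exact: top_cancel (ss _) (ss _).
Qed.

End Dual.

Lemma Tw_DF I : DF alpha (Tw I).
Proof.
rewrite /Tw; elim: I => [|i I IH]; first by rewrite big_nil; exact: DF1.
by rewrite big_cons; exact: DF_mul.
Qed.

Lemma fam_dual u : dual_inv (fam u).
Proof.
split=> [a z z'|z zD|w z wX].
- rewrite /fam !mulrDl -!scaler_mulr; exact: linearP.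
- apply: (fe_tilde_DF Hreg Halpha); apply: DF_mul; last exact: Tw_DF.
  by apply: DF_mul => //; exact: Y_Xi_DF.
- by rewrite /fam -[z * _ * YXi]mulrA (delta_Y_Xi F Halpha).
Qed.

Notation J := {u : W | u \in WmXi}.

Lemma dual_decomp k f : dual_inv f ->
  (forall v, v \in WmXi -> (k <= len v)%N -> f (delta F v) = 0) ->
  exists a : {ffun J -> S}, forall z, f z = \sum_j toQ (a j) * fam (val j) z.
Proof.
elim: k f => [|k IH] f hf f0.
  exists [ffun=> 0] => z; rewrite big1 => [|j _]; last by rewrite ffunE [toQ 0]rmorph0 mul0r.
  rewrite (dualE hf) big1 // => y _.
  have [y' [w' [y'X w'X ->]]] := coset_decomp Halpha Xi y.
  by rewrite (dual_coset hf) // f0 // mulr0.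
have /choice[t tP] : forall j : J, exists t, len (val j) = k ->
    f (delta F (val j)) = toQ t * fam (val j) (delta F (val j)).
  move=> j; have [jk|jk] := eqVneq (len (val j)) k; last first.
    by exists 0 => e1; rewrite e1 eqxx in jk.
  have [u uX uj|t ht] := dual_top hf (valP j); last by exists t.
  by apply: f0; rewrite // -jk.
(* The members of length [k] correct the top values. Each vanishes at all other representatives of
   length at least [k], so the corrections do not interfere. *)
pose a0 (j : J) : S := if len (val j) == k then t j else 0.
pose g z := f z - \sum_j toQ (a0 j) * fam (val j) z.
have hg : dual_inv g.
  have [lf fD fw] := hf; split=> [a z z'|z zD|w z wX].
  - rewrite /g lf mulrBr mulr_sumr.
    under eq_bigr => j _ do rewrite (let: And3 h _ _ := fam_dual (val j) in h) mulrDr mulrCA.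
    by rewrite big_split opprD addrACA.
  - apply: inSD; first exact: fD.
    apply/inSN/inS_sum => j _; apply: inSM; first exact: inS_toQ.
    by have [_ h _] := fam_dual (val j); exact: h.
  - rewrite /g (fw w z wX) (eq_bigr (fun j => toQ (a0 j) * fam (val j) z)) // => j _.
    by have [_ _ h] := fam_dual (val j); rewrite h.
have [|a ha] := IH g hg.
  move=> v vX kv; rewrite /g (bigD1 (Sub v vX : J)) //= big1 ?addr0 => [|j jv].
    rewrite /a0 /=; case: eqP => [vk|vk]; first by rewrite (tP (Sub v vX : J)) // subrr.
    by rewrite [toQ 0]rmorph0 mul0r subr0 f0 // ltn_neqAle kv eq_sym andbT; apply/eqP.
  rewrite /a0; case: eqP => [jk|_]; last by rewrite [toQ 0]rmorph0 mul0r.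
  rewrite fam_delta_eq0 ?mulr0 //; first exact: valP; first by rewrite jk.
  by apply: contra jv => /eqP e1; apply/eqP/val_inj.
exists [ffun j => a j + a0 j] => z.
under eq_bigr => j _ do rewrite ffunE toQD mulrDl.
by rewrite big_split -ha; exact/esym/subrK.
Qed.

(** At [delta F (val j)] the longer members drop out by induction and the others by [fam_delta_eq0];
    the leading value that remains is a regular element up to sign. *)
Lemma fam_free (a : {ffun J -> S}) :
  (forall z, \sum_j toQ (a j) * fam (val j) z = 0) -> forall j, a j = 0.
Proof.
move=> h j; have [m] := ubnP (#|Pos| - len (val j)); elim: m j => // m IH j jm.
have lenj (j' : J) : (len (val j') <= #|Pos|)%N.
  by rewrite -(len_mul_wlong Halpha (val j')) leq_addl.
have := h (delta F (val j)); rewrite (bigD1 j) //= big1 ?addr0 => [|j' jj'].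
  rewrite fam_delta_lead ?(valP j) // => e1.
  apply: (fam_lead_reg (u := val j)); apply: (toQ_inj Hreg).
  rewrite [RHS](rmorph0 toQ) mulrC toQM.
  have ss k' : (-1) ^+ k' * (-1) ^+ k' = 1 :> Q by rewrite -expr2 sqrr_sign.
  by rewrite -[LHS]mul1r -(ss (e * len (val j))%N) -mulrA [X in _ * X]mulrCA e1 mulr0.
have [jl|lj] := ltnP (len (val j)) (len (val j')).
  rewrite IH ?[toQ 0]rmorph0 ?mul0r //.
  apply: leq_trans (ltn_sub2l _ jl) _; last by rewrite -ltnS.
  exact: leq_trans jl (lenj j').
rewrite fam_delta_eq0 ?mulr0 ?(valP j) ?(valP j') //.
by rewrite eq_sym; apply: contra jj' => /eqP e1; apply/eqP/val_inj.
Qed.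

Lemma push_family_basis (b : J -> QW_dual F rd) :
  (forall j z, b j z = fam (val j) z) -> is_basis b (DF_dual_inv alpha Xi).
Proof.
move=> hb; split=> [j|f [fD fw]].
  have [lf gD gw] := fam_dual (val j); split=> [z zD|w wX z].
    by rewrite hb; exact: gD.
  by rewrite -[LHS]/(b j (z * delta F w)) !hb gw.
have hf : dual_inv f.
  by split=> [a z z'|z /fD|w z wX]; [exact: linearP| |exact: fw].
(* No length exceeds the number of positive roots, so the vanishing condition is empty. *)
have [|a ha] := dual_decomp (k := #|Pos|.+1) hf.
  move=> v vX; rewrite ltnNge -(len_mul_wlong Halpha v) leq_addl //.
exists a; split=> [z|a' ha']; first by rewrite ha; apply: eq_bigr => j _; rewrite hb.
apply/ffunP => j; apply/eqP; rewrite -subr_eq0; apply/eqP.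
have h : forall j, [ffun j => a j - a' j] j = 0 :> S.
  apply: fam_free => z.
  under eq_bigr => k _ do rewrite ffunE toQB mulrBl.
  rewrite sumrB -ha ha'; apply/eqP; rewrite subr_eq0; apply/eqP.
  by apply: eq_bigr => k _; rewrite hb.
by have := h j; rewrite ffunE.
Qed.

End TriangularFamily.

Lemma A_seqE (R : comNzRingType) (F : fgl R) (L : zmodType) (rd : rootDatum L)
    (n : nat) (alpha : 'I_n -> rd_roots rd) (I : seq 'I_n) (f : QW_dual F rd) (z : QW F rd) :
  A_seq alpha I f z = f (z * \prod_(i <- I) Y_elt F alpha i).
Proof.
elim: I z => [|i I IH] z; first by rewrite big_nil mulr1.
by rewrite big_cons mulrA -IH.
Qed.

Lemma B_seqE (R : comNzRingType) (F : fgl R) (L : zmodType) (rd : rootDatum L)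
    (n : nat) (alpha : 'I_n -> rd_roots rd) (I : seq 'I_n) (f : QW_dual F rd) (z : QW F rd) :
  B_seq alpha I f z = f (z * \prod_(i <- I) X_elt F alpha i).
Proof.
elim: I z => [|i I IH] z; first by rewrite big_nil mulr1.
by rewrite big_cons mulrA -IH.
Qed.

Theorem theorem14p3
  (R : comNzRingType) (F : fgl R)
  (L : zmodType) (rd : rootDatum L)
  (n : nat) (alpha : 'I_n -> rd_roots rd) (Halpha : simple_system alpha)
  (Hreg : forall (a : rd_roots rd) (s : fga F L), x_root F a * s = 0 -> s = 0)
  (Xi : {set 'I_n})
  (I : weyl rd -> seq 'I_n)
  (HI : forall u, u \in min_coset_reps alpha Xi -> is_reduced alpha (I u) u) :
  is_basis
    (fun u : {u : weyl rd | u \in min_coset_reps alpha Xi} =>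
       A_Xi alpha Xi (A_seq alpha (rev (I (val u))) (fe_tilde F alpha)))
    (DF_dual_inv alpha Xi) /\
  is_basis
    (fun u : {u : weyl rd | u \in min_coset_reps alpha Xi} =>
       A_Xi alpha Xi (B_seq alpha (rev (I (val u))) (fe_tilde F alpha)))
    (DF_dual_inv alpha Xi).
Proof.
split.
  apply: (push_family_basis Hreg Halpha (@Y_mul_signE _ F _ _ _ alpha) (Y_elt_DF Hreg alpha) HI).
  by move=> u z; exact: A_seqE.
apply: (push_family_basis Hreg Halpha (@X_mul_signE _ F _ _ _ alpha) (@DF_X _ F _ _ _ alpha) HI).
by move=> u z; exact: B_seqE.
Qed.
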